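(* For any two types $\mathbf t,\mathbf t^*$ over $(K,v)$, the following conditions are equivalent: (1) $\mathbf t\equiv\mathbf t^*$; (2) $\mathrm{ord}_{\mathbf t}(g)=\mathrm{ord}_{\mathbf t^*}(g)$ for all $g\in K[x]$; (3) $\mathrm{Rep}(\mathbf t)=\mathrm{Rep}(\mathbf t^* )$.
   Context: Let $K$ be a field with a surjective discrete valuation $v\colon K^*\to\mathbb Z$, valuation ring $\mathcal O$, a fixed generator $\pi$ of its maximal ideal, residue field $\mathbb F$. Valuations $\mu$ on $K(x)$ extend $v$ with $\mu(x)\ge0$; Gauss valuation $\mu_0(\sum a_sx^s)=\min v(a_s)$; $\Gamma(\mu)=\mu(K(x)^* )$, $e(\mu)\Gamma(\mu)=\mathbb Z$; $\mathcal P_\alpha=\{g:\mu(g)\ge\alpha\}\supset\mathcal P_\alpha^+=\{g:\mu(g)>\alpha\}$, $\mathcal{G}r(\mu)=\bigoplus_\alpha\mathcal P_\alpha/\mathcal P_\alpha^+$, $\Delta(\mu)=\mathcal P_0/\mathcal P_0^+$, $H_\mu(g)$ the class of $g\ne0$ in $\mathcal P_{\mu(g)}/\mathcal P^+_{\mu(g)}$. $\phi\mid_\mu g$ means $H_\mu(\phi)\mid H_\mu(g)$. Key polynomials ($\mathrm{KP}(\mu)$): monic $\phi$ with $H_\mu(\phi)\mathcal{G}r(\mu)$ nonzero prime and $\phi\nmid_\mu h$ for nonzero $h$ of smaller degree. Augmentation $[\mu;\phi,\nu](\sum a_s\phi^s)=\min_s\{\mu(a_s\phi^s)+s\nu\}$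 ($\phi$-expansion, $\deg a_s<\deg\phi$). MacLane chain: $\mu_i=[\mu_{i-1};\phi_i,\nu_i]$, $\phi_i\in\mathrm{KP}(\mu_{i-1})$, $\nu_i>0$, $\phi_{i+1}\nmid_{\mu_i}\phi_i$. Data: $\phi_0=x,\nu_0=0,\mu_{-1}=\mu_0$; $\Delta_i=\Delta(\mu_i)$, $\mathbb F_0=\mathbb F$, $\mathbb F_i=\mathrm{Im}(\Delta_{i-1}\to\Delta_i)$; $e_i=e(\mu_i)/e(\mu_{i-1})$, $h_i=e(\mu_i)\nu_i$, $V_i=e(\mu_{i-1})\mu_{i-1}(\phi_i)$, $\ell_ih_i+\ell'_ie_i=1$, $0\le\ell_i<e_i$; $p_0=H_{\mu_0}(\pi)$, $x_i=H_{\mu_i}(\phi_i)p_i^{-V_i}$, $y_i=x_i^{e_i}p_i^{-h_i}$, $p_{i+1}=x_i^{\ell_i}p_i^{\ell'_i}$. Residual polynomial $R_i(g)\in\mathbb F_i[y]$ ($R_i(0)=0$): for $g\ne0$, with $(s_i(g),u_i(g)/e(\mu_{i-1}))$ the left end point of the intersection of $N_{\mu_{i-1},\phi_i}(g)$ (lower convex hull of $\{(s,\mu_{i-1}(a_s\phi_i^s))\}$, $\phi_i$-expansion) with the line of slope $-\nu_i$ first touching it from below ($s_0=0,u_0=\mu_0(g)$), $R_i(g)$ is the unique polynomial with $H_{\mu_i}(g)=x_i^{s_i(g)}p_i^{u_i(g)}R_i(g)(y_i)$. Types: a type of order $r\ge0$ is $\mathbf t=(\psi_0;(\phi_1,\lambda_1,\psi_1);\dots;(\phi_r,\lambda_r,\psi_r))$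 such that with $\nu_i=\lambda_i/e(\mu_{i-1})$ the pairs $(\phi_i,\nu_i)$ form a MacLane chain $\mu_0\to\cdots\to\mu_r$, $\psi_i=R_i(\phi_{i+1})$ for $i<r$, and $\psi_r\in\mathbb F_r[y]$ is monic irreducible, $\psi_r\ne y$ if $r>0$. $\mu_{\mathbf t}=\mu_r$, $v_\mathbf t=e(\mu_r)\mu_r$, $\mathcal L_{\mathbf t}=\psi_r(y_r)\Delta(\mu_{\mathbf t})$ (a maximal ideal). With $\mathcal R_\mu(g)=\Delta(\mu)\cap H_\mu(g)\mathcal{G}r(\mu)$, $\mathrm{Rep}(\mathbf t)=\{\phi\in\mathrm{KP}(\mu_{\mathbf t}):\mathcal R_{\mu_{\mathbf t}}(\phi)=\mathcal L_{\mathbf t}\}$. $\mathrm{ord}_{\mathbf t}(g)$ is the largest integer $a$ with $\psi_r^a\mid R_r(g)$ in $\mathbb F_r[y]$ (using the residual operator $R_r$ of the last level of $\mathbf t$'s own chain). $\mathbf t\equiv\mathbf t^*$ means $v_{\mathbf t}=v_{\mathbf t^*}$ and $\mathcal L_{\mathbf t}=\mathcal L_{\mathbf t^*}$. Types may have different orders. *)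

(* Defs.v *)
From HB Require Import structures.
From mathcomp Require Import all_boot all_order all_algebra.
From mathcomp Require Import generic_quotient.
From mathcomp Require Import boolp classical_sets.

Set Implicit Arguments.
Unset Strict Implicit.
Unset Printing Implicit Defensive.

Import Order.TTheory GRing.Theory Num.Theory.
Local Open Scope ring_scope.
Local Open Scope quotient_scope.
Local Open Scope classical_set_scope.

(** A valuation takes the value +oo at 0; here it is a total function whose
    value at 0 is arbitrary and never used. *)

Record surj_discrete_valuation (K : fieldType) (v : K -> int) : Prop := {
  sdvM : forall a b, a != 0 -> b != 0 -> v (a * b) = v a + v b;
  sdvD : forall a b, a != 0 -> b != 0 -> a + b != 0 ->
    Num.min (v a) (v b) <= v (a + b);
  sdv_surj : forall n : int, exists2 a, a != 0 & v a = n }.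

Definition valring (K : fieldType) (v : K -> int) : set K :=
  [set a | a = 0 \/ 0 <= v a].

Definition maxideal (K : fieldType) (v : K -> int) : set K :=
  [set a | a = 0 \/ 0 < v a].

Definition uniformizer (K : fieldType) (v : K -> int) (pi : K) : Prop :=
  maxideal v = [set pi * b | b in valring v].

(** Valuations on K(x) extending v, nonnegative at x, with value group
    (1 / e) Z.  The number [ram] is determined by the function [vfun]. *)
Record valuation (K : fieldType) (v : K -> int) := Valuation {
  vfun :> {fraction {poly K}} -> rat;
  ram : nat;
  valM : forall f g, f != 0 -> g != 0 -> vfun (f * g) = vfun f + vfun g;
  valD : forall f g, f != 0 -> g != 0 -> f + g != 0 ->
    Num.min (vfun f) (vfun g) <= vfun (f + g);
  val_ext : forall c : K, c != 0 -> vfun (tofrac c%:P) = (v c)%:~R;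
  valX : 0 <= vfun (tofrac 'X);
  ram_gt0 : (0 < ram)%N;
  ramP : forall a : rat,
    (exists2 f, f != 0 & vfun f = a) <-> ram%:R * a \is a Num.int }.

Section Graded.
Variables (K : fieldType) (v : K -> int) (mu : valuation v).
Implicit Types (g h : {poly K}) (a b : rat).

Definition pval g : rat := mu (tofrac g).

Definition filt a : set {poly K} := [set g | g = 0 \/ a <= pval g].
Definition filtp a : set {poly K} := [set g | g = 0 \/ a < pval g].

Lemma pvalM g h : g != 0 -> h != 0 -> pval (g * h) = pval g + pval h.
Proof. by move=> g0 h0; rewrite /pval tofracM valM // tofrac_eq0. Qed.

Lemma pval1 : pval 1 = 0.
Proof.
have := @pvalM 1 1 (oner_neq0 _) (oner_neq0 _).
by rewrite mulr1 -[LHS]addr0 => /addrI.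
Qed.

Lemma pvalN g : pval (- g) = pval g.
Proof.
have N1 : - 1 != 0 :> {poly K} by rewrite oppr_eq0 oner_neq0.
have pN1 : pval (- 1) = 0.
  have := pvalM N1 N1; rewrite mulrNN mulr1 pval1.
  by move/esym/eqP; rewrite -mulr2n mulrn_eq0 /= => /eqP.
have [->|g0] := eqVneq g 0; first by rewrite oppr0.
by rewrite -mulN1r pvalM // pN1 add0r.
Qed.

Lemma pvalD g h : g != 0 -> h != 0 -> g + h != 0 ->
  Num.min (pval g) (pval h) <= pval (g + h).
Proof.
by move=> g0 h0 gh0; rewrite /pval tofracD valD -?tofracD ?tofrac_eq0.
Qed.

Lemma filtD a g h : filt a g -> filt a h -> filt a (g + h).
Proof.
have [->|g0] := eqVneq g 0; first by rewrite add0r.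
have [->|h0] := eqVneq h 0; first by rewrite addr0.
case=> [/eqP|ag]; first by rewrite (negPf g0).
case=> [/eqP|ah]; first by rewrite (negPf h0).
have [->|gh0] := eqVneq (g + h) 0; first by left.
by right; apply: le_trans (pvalD g0 h0 gh0); rewrite le_min ag.
Qed.

Lemma filtpD a g h : filtp a g -> filtp a h -> filtp a (g + h).
Proof.
have [->|g0] := eqVneq g 0; first by rewrite add0r.
have [->|h0] := eqVneq h 0; first by rewrite addr0.
case=> [/eqP|ag]; first by rewrite (negPf g0).
case=> [/eqP|ah]; first by rewrite (negPf h0).
have [->|gh0] := eqVneq (g + h) 0; first by left.
by right; apply: lt_le_trans (pvalD g0 h0 gh0); rewrite lt_min ag.
Qed.

Lemma filtN a g : filt a g -> filt a (- g).
Proof. by case=> [->|ag]; [left; rewrite oppr0|right; rewrite pvalN]. Qed.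

Lemma filtpN a g : filtp a g -> filtp a (- g).
Proof. by case=> [->|ag]; [left; rewrite oppr0|right; rewrite pvalN]. Qed.

Lemma filtM a b g h : filt a g -> filt b h -> filt (a + b) (g * h).
Proof.
have [->|g0] := eqVneq g 0; first by move=> _ _; left; rewrite mul0r.
have [->|h0] := eqVneq h 0; first by move=> _ _; left; rewrite mulr0.
case=> [/eqP|ag]; first by rewrite (negPf g0).
case=> [/eqP|bh]; first by rewrite (negPf h0).
by right; rewrite pvalM // lerD.
Qed.

Lemma filtpM a b g h : filt a g -> filtp b h -> filtp (a + b) (g * h).
Proof.
have [->|g0] := eqVneq g 0; first by move=> _ _; left; rewrite mul0r.
have [->|h0] := eqVneq h 0; first by move=> _ _; left; rewrite mulr0.
case=> [/eqP|ag]; first by rewrite (negPf g0).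
case=> [/eqP|bh]; first by rewrite (negPf h0).
by right; rewrite pvalM // ler_ltD.
Qed.

(** An element of Gr(mu) is represented by a formal sum of pairs (a, g) with
    g in P_a; two sums are identified when, in every degree a, their
    components (elements of P_a) differ by an element of P_a^+.  Degrees range
    over all of rat: P_a = P_a^+ for a outside the value group, so those
    degrees contribute nothing. *)

Definition hom_pair : pred (rat * {poly K}) := fun t => `[< filt t.1 t.2 >].

Record hsum := HSum { hseq :> seq (rat * {poly K}); _ : all hom_pair hseq }.
HB.instance Definition _ := [isSub for hseq].
HB.instance Definition _ := [Choice of hsum by <:].

Implicit Types s t u : hsum.

Definition hcoef (s : seq (rat * {poly K})) a : {poly K} :=
  \sum_(p <- s | p.1 == a) p.2.

Lemma hsumP s p : p \in hseq s -> filt p.1 p.2.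
Proof. by case: s => l /= /allP ls /ls /asboolP. Qed.

Definition heq s t : bool :=
  `[< forall a, filtp a (hcoef s a - hcoef t a) >].

Lemma heq_refl : reflexive heq.
Proof. by move=> s; apply/asboolP => a; left; rewrite subrr. Qed.

Lemma heq_symW s t : heq s t -> heq t s.
Proof.
by move=> /asboolP st; apply/asboolP => a; rewrite -opprB; apply: filtpN.
Qed.

Lemma heq_sym : symmetric heq.
Proof. by move=> s t; apply/idP/idP; apply: heq_symW. Qed.

Lemma heq_trans : transitive heq.
Proof.
move=> t s u /asboolP st /asboolP tu; apply/asboolP => a.
by rewrite -(subrKA (hcoef t a)); apply: filtpD.
Qed.

Canonical heq_equiv := EquivRel heq heq_refl heq_sym heq_trans.

Definition gr := {eq_quot heq}.
HB.instance Definition _ : EqQuotient _ heq gr := EqQuotient.on gr.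
HB.instance Definition _ := Choice.on gr.

Lemma eq_gr s t :
  (forall a, hcoef s a = hcoef t a) -> \pi_gr s = \pi_gr t.
Proof. by move=> st; apply/eqmodP/asboolP => a; left; rewrite st subrr. Qed.

Definition hadd s t : hsum.
Proof.
exists (hseq s ++ hseq t); rewrite all_cat.
by apply/andP; split; [case: s|case: t].
Defined.

Definition hopp s : hsum.
Proof.
exists [seq (p.1, - p.2) | p <- hseq s]; apply/allP => _ /mapP[p ps ->].
by apply/asboolP/filtN; apply: hsumP ps.
Defined.

Definition hmul s t : hsum.
Proof.
exists [seq (p.1 + q.1, p.2 * q.2) | p <- hseq s, q <- hseq t].
apply/allP => _ /allpairsP[[p q] /= [ps qt ->]].
by apply/asboolP/filtM; [apply: hsumP ps|apply: hsumP qt].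
Defined.

Definition hzero : hsum := HSum (isT : all hom_pair [::]).

(** (a, g) if g lies in P_a, and 0 otherwise. *)
Definition hmono a g : hsum := insubd hzero [:: (a, g)].

Lemma hmonoE a g : filt a g -> hseq (hmono a g) = [:: (a, g)].
Proof. by move=> ag; apply: insubdK; rewrite unfold_in /= andbT; apply/asboolP. Qed.

Lemma hcoef0 a : hcoef hzero a = 0. Proof. exact: big_nil. Qed.

Lemma hcoefD s t a : hcoef (hadd s t) a = hcoef s a + hcoef t a.
Proof. exact: big_cat. Qed.

Lemma hcoefN s a : hcoef (hopp s) a = - hcoef s a.
Proof. by rewrite /hcoef big_map sumrN. Qed.

Lemma hcoefM s t a :
  hcoef (hmul s t) a = \sum_(p <- hseq s) p.2 * hcoef t (a - p.1).
Proof.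
rewrite /hcoef big_mkcond big_allpairs_dep; apply: eq_bigr => p _.
rewrite mulr_sumr [RHS]big_mkcond; apply: eq_bigr => q _ /=.
by rewrite [in RHS]eq_sym subr_eq [q.1 + _]addrC [in RHS]eq_sym.
Qed.

Lemma hcoefM_comm s t a : hcoef (hmul s t) a = hcoef (hmul t s) a.
Proof.
rewrite /hcoef !(big_mkcond (fun p => p.1 == a)) !big_allpairs_dep exchange_big /=.
by apply: eq_bigr => p _; apply: eq_bigr => q _ /=; rewrite addrC mulrC.
Qed.

Lemma filtp_sum a (I : eqType) (r : seq I) (F : I -> {poly K}) :
  (forall i, i \in r -> filtp a (F i)) -> filtp a (\sum_(i <- r) F i).
Proof.
move=> rF; rewrite big_seq_cond.
apply: (big_ind (filtp a)); [by left|by move=> ? ?; apply: filtpD|].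
by move=> i; rewrite andbT => /rF.
Qed.

Lemma heqM2l s t u : heq t u -> heq (hmul s t) (hmul s u).
Proof.
move=> /asboolP tu; apply/asboolP => a.
rewrite !hcoefM -sumrB; apply: filtp_sum => p /hsumP ps.
by rewrite -mulrBr -[a in filtp a](subrKC p.1); apply: filtpM.
Qed.

Lemma heqM2r s t u : heq t u -> heq (hmul t s) (hmul u s).
Proof.
move=> /(heqM2l s)/asboolP tu; apply/asboolP => a.
by rewrite hcoefM_comm [hcoef (hmul u s) a]hcoefM_comm.
Qed.

Definition gradd := lift_op2 gr hadd.
Definition gropp := lift_op1 gr hopp.
Definition grmul := lift_op2 gr hmul.
Definition grzero : gr := \pi_gr hzero.
Definition grone : gr := \pi_gr (hmono 0 1).

Lemma heq_repr s : heq s (repr (\pi_gr s)).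
Proof. by apply/eqmodP; rewrite reprK. Qed.

Lemma pi_gradd : {morph \pi_gr : s t / hadd s t >-> gradd s t}.
Proof.
move=> s t; unlock gradd; apply/eqmodP/asboolP => a; rewrite !hcoefD.
rewrite opprD addrACA; have /asboolP es := heq_repr s.
by have /asboolP et := heq_repr t; apply: filtpD.
Qed.
Canonical pi_gradd_morph := PiMorph2 pi_gradd.

Lemma pi_gropp : {morph \pi_gr : s / hopp s >-> gropp s}.
Proof.
move=> s; unlock gropp; apply/eqmodP/asboolP => a; rewrite !hcoefN -opprD.
by have /asboolP es := heq_repr s; apply: filtpN.
Qed.
Canonical pi_gropp_morph := PiMorph1 pi_gropp.

Lemma pi_grmul : {morph \pi_gr : s t / hmul s t >-> grmul s t}.
Proof.
move=> s t; unlock grmul; apply/eqmodP => /=.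
apply: (@heq_trans (hmul s (repr (\pi_gr t)))).
  exact/heqM2l/heq_repr.
exact/heqM2r/heq_repr.
Qed.
Canonical pi_grmul_morph := PiMorph2 pi_grmul.

Lemma graddA : associative gradd.
Proof.
elim/quotW=> s; elim/quotW=> t; elim/quotW=> u; rewrite !piE.
by apply: eq_gr => a; rewrite !hcoefD addrA.
Qed.

Lemma graddC : commutative gradd.
Proof.
elim/quotW=> s; elim/quotW=> t; rewrite !piE.
by apply: eq_gr => a; rewrite !hcoefD addrC.
Qed.

Lemma gradd0 : left_id grzero gradd.
Proof.
elim/quotW=> s; rewrite /grzero !piE.
by apply: eq_gr => a; rewrite hcoefD hcoef0 add0r.
Qed.

Lemma graddN : left_inverse grzero gropp gradd.
Proof.
elim/quotW=> s; rewrite /grzero !piE.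
by apply: eq_gr => a; rewrite hcoefD hcoefN hcoef0 addNr.
Qed.

HB.instance Definition _ := GRing.isZmodule.Build gr graddA graddC gradd0 graddN.

Lemma grmulA : associative grmul.
Proof.
elim/quotW=> s; elim/quotW=> t; elim/quotW=> u; rewrite !piE.
apply: eq_gr => a; rewrite !hcoefM /= big_allpairs_dep; apply: eq_bigr => p _.
rewrite hcoefM mulr_sumr; apply: eq_bigr => q _ /=.
by rewrite mulrA opprD addrA.
Qed.

Lemma grmulC : commutative grmul.
Proof.
elim/quotW=> s; elim/quotW=> t; rewrite !piE.
exact/eq_gr/hcoefM_comm.
Qed.

Lemma filt01 : filt 0 1. Proof. by right; rewrite pval1. Qed.

Lemma grmul1 : left_id grone grmul.
Proof.
elim/quotW=> s; rewrite /grone !piE; apply: eq_gr => a.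
by rewrite hcoefM (hmonoE filt01) big_seq1 mul1r subr0.
Qed.

Lemma grmulDl : left_distributive grmul gradd.
Proof.
elim/quotW=> s; elim/quotW=> t; elim/quotW=> u; rewrite !piE.
by apply: eq_gr => a; rewrite hcoefD !hcoefM /= big_cat.
Qed.

Lemma grone_neq0 : grone != grzero.
Proof.
apply/negP => /eqP/eqmodP/asboolP/(_ 0).
rewrite hcoef0 subr0 /hcoef (hmonoE filt01) big_cons /= big_nil addr0.
by case=> [/eqP|]; rewrite ?oner_eq0 // pval1 ltxx.
Qed.

HB.instance Definition _ :=
  GRing.Zmodule_isComNzRing.Build gr grmulA grmulC grmul1 grmulDl grone_neq0.

Definition grunit : {pred gr} := fun c => `[< exists d, d * c = 1 >].
Definition grinv (c : gr) : gr := xget c [set d | d * c = 1].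

Lemma grmulV : {in grunit, left_inverse 1 grinv *%R}.
Proof. by move=> c /asboolP[d dc]; rewrite /grinv; case: xgetP => [e _ //|/(_ d)]. Qed.

Lemma grunitP (c d : gr) : d * c = 1 -> grunit c.
Proof. by move=> dc; apply/asboolP; exists d. Qed.

Lemma grinv_out : {in [predC grunit], grinv =1 id}.
Proof.
move=> c /asboolP cu; apply: xgetPN => d dc.
by apply: cu; exists d.
Qed.

HB.instance Definition _ :=
  GRing.ComNzRing_hasMulInverse.Build gr grmulV grunitP grinv_out.

(** The class of g in P_a / P_a^+ (0 if g does not lie in P_a). *)
Definition grclass a g : gr := \pi_gr (hmono a g).

Definition Hmu g : gr := if g == 0 then 0 else grclass (pval g) g.

(** Delta(mu) = P_0 / P_0^+, inside the graded algebra. *)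
Definition Delta : set gr := [set grclass 0 g | g in filt 0].

(** The component of degree a of an element of the graded algebra, as an
    actual coset in P_a / P_a^+.  It allows residual ideals of different
    valuations, i.e. sets of cosets of polynomials, to be compared. *)
Definition coset (a : rat) (c : gr) : set {poly K} :=
  [set g | filt a g /\ filtp a (hcoef (repr c) a - g)].

Definition gr_dvd (c d : gr) : Prop := exists q, d = c * q.

Definition gr_ideal (c : gr) : set gr := [set d | gr_dvd c d].

Definition prime_ideal (I : set gr) : Prop :=
  ~ I 1 /\ forall c d, I (c * d) -> I c \/ I d.

Definition mu_dvd g h : Prop := gr_dvd (Hmu g) (Hmu h).

Definition KP : set {poly K} := [set phi |
  [/\ phi \is monic, gr_ideal (Hmu phi) <> [set 0],
      prime_ideal (gr_ideal (Hmu phi))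
    & forall h, h != 0 -> (size h < size phi)%N -> ~ mu_dvd phi h] ].

Definition Rideal g : set gr := Delta `&` gr_ideal (Hmu g).

End Graded.

Arguments filt {K v} mu a.
Arguments filtp {K v} mu a.
Arguments gr {K v} mu.
Arguments grclass {K v} mu a g.
Arguments Hmu {K v} mu g.
Arguments Delta {K v} mu.
Arguments coset {K v mu} a c.
Arguments mu_dvd {K v} mu g h.
Arguments KP {K v} mu.
Arguments Rideal {K v} mu g.

Definition is_min (A : set rat) (m : rat) : Prop :=
  A m /\ forall a, A a -> m <= a.

(** a = sum_s a_s Y^s encodes the expansion g = sum_s a_s phi^s. *)
Definition is_expansion (K : fieldType) (phi g : {poly K})
    (a : {poly {poly K}}) : Prop :=
  g = a.[phi] /\ forall s, (size (a`_s)%R < size phi)%N.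

Definition is_gauss (K : fieldType) (v : K -> int) (mu : valuation v) : Prop :=
  forall g : {poly K}, g != 0 ->
    is_min [set z | exists2 s, g`_s != 0 & z = (v g`_s)%:~R] (pval mu g).

Definition is_augmentation (K : fieldType) (v : K -> int) (mu : valuation v)
    (phi : {poly K}) (nu : rat) (mu' : valuation v) : Prop :=
  forall g : {poly K}, g != 0 -> exists2 a, is_expansion phi g a &
    is_min [set z | exists2 s, a`_s != 0
              & z = pval mu (a`_s * phi ^+ s) + s%:R * nu] (pval mu' g).

(** The homomorphism Gr(mu) -> Gr(mu') for mu <= mu': the class of g in
    P_a(mu) / P_a^+(mu) is sent to its class in P_a(mu') / P_a^+(mu'). *)
Definition gr_map (K : fieldType) (v : K -> int) (mu mu' : valuation v)
    (c : gr mu) : gr mu' :=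
  \sum_(p <- hseq (repr c)) grclass mu' p.1 p.2.

(** Since all vertices are rational, the plane Q^2 is used instead of R^2. *)
Definition convex (C : set (rat * rat)) : Prop :=
  forall (P Q : rat * rat) (t : rat), 0 <= t <= 1 -> C P -> C Q ->
    C (t * P.1 + (1 - t) * Q.1, t * P.2 + (1 - t) * Q.2).

Definition convex_hull (A : set (rat * rat)) : set (rat * rat) :=
  [set P | forall C, convex C -> A `<=` C -> C P].

Definition lower_hull (A : set (rat * rat)) : set (rat * rat) :=
  [set P | convex_hull A P /\ forall y, convex_hull A (P.1, y) -> P.2 <= y].

Definition newton_polygon (K : fieldType) (v : K -> int) (mu : valuation v)
    (phi g : {poly K}) : set (rat * rat) :=
  lower_hull [set P | exists2 a, is_expansion phi g a & exists2 s, a`_s != 0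
                & P = (s%:R, pval mu (a`_s * phi ^+ s))].

(** P lies on the line of slope - nu first touching N from below. *)
Definition touching (N : set (rat * rat)) (nu : rat) : set (rat * rat) :=
  [set P | N P /\ forall Q, N Q -> P.2 - nu * (Q.1 - P.1) <= Q.2].

Definition left_endpoint (S : set (rat * rat)) (P : rat * rat) : Prop :=
  S P /\ forall Q, S Q -> P.1 <= Q.1.

(** A chain is indexed by nat; only the levels up to its length are
    meaningful.  Level 0 carries phi_0 = x, lambda_0 = 0, and mu_(-1) = mu_0
    is [mu i.-1] at i = 0.  The slopes are nu_i = lambda_i / e(mu_(i-1)). *)

Record chain (K : fieldType) (v : K -> int) := Chain {
  c_phi : nat -> {poly K};
  c_lam : nat -> rat;
  c_mu : nat -> valuation v }.

Section ChainData.
Variables (K : fieldType) (v : K -> int) (pi : K) (C : chain v).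

Local Notation mu := (c_mu C).
Local Notation phi := (c_phi C).

Definition c_nu i : rat := c_lam C i / (ram (mu i.-1))%:R.

Definition maclane_chain (r : nat) : Prop :=
  [/\ phi 0 = 'X, c_lam C 0 = 0 & is_gauss (mu 0)] /\
  [/\ forall i, (i < r)%N -> KP (mu i) (phi i.+1),
      forall i, (i < r)%N -> 0 < c_nu i.+1,
      forall i, (i < r)%N ->
        is_augmentation (mu i) (phi i.+1) (c_nu i.+1) (mu i.+1)
    & forall i, (0 < i < r)%N -> ~ mu_dvd (mu i) (phi i.+1) (phi i)].

(** The floors below are taken at integers, and the division is exact. *)
Definition c_e i : nat := (ram (mu i) %/ ram (mu i.-1))%N.
Definition c_h i : int := Num.floor ((ram (mu i))%:R * c_nu i).
Definition c_V i : int :=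
  Num.floor ((ram (mu i.-1))%:R * pval (mu i.-1) (phi i)).

(** The Bezout pair (l_i, l'_i), unique because h_i and e_i are coprime. *)
Definition c_l i : int * int :=
  xget (0, 0) [set l : int * int |
    l.1 * c_h i + l.2 * (c_e i)%:Z = 1 /\ 0 <= l.1 < (c_e i)%:Z].

(** p_(i+1) is formed in Gr(mu_i) and then mapped to Gr(mu_(i+1)), where it
    is a unit; negative powers are only taken of the units p_i. *)
Fixpoint c_p i : gr (mu i) :=
  match i with
  | 0 => Hmu (mu 0) pi%:P
  | j.+1 => gr_map (mu j.+1)
      ((Hmu (mu j) (phi j) * c_p j ^ (- c_V j)) ^ (c_l j).1
         * c_p j ^ (c_l j).2)
  end.

Definition c_x i : gr (mu i) := Hmu (mu i) (phi i) * c_p i ^ (- c_V i).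
Definition c_y i : gr (mu i) := c_x i ^+ c_e i * c_p i ^ (- c_h i).

(** F_0 is the residue field of K, identified with its image in Delta_0. *)
Definition c_F i : set (gr (mu i)) :=
  match i with
  | 0 => [set grclass (mu 0) 0 a%:P | a in valring v]
  | j.+1 => [set gr_map (mu j.+1) c | c in Delta (mu j)]
  end.

(** Polynomials over F_i are polynomials over Gr(mu_i) with coefficients in
    the subset F_i. *)
Definition c_Fpoly i : set {poly gr (mu i)} :=
  [set R : {poly gr (mu i)} | forall k, c_F R`_k].

Definition c_su i (g : {poly K}) (s : nat) (u : int) : Prop :=
  match i with
  | 0 => s = 0%N /\ u%:~R = pval (mu 0) g
  | j.+1 => left_endpoint
      (touching (newton_polygon (mu j) (phi j.+1) g) (c_nu j.+1))
      (s%:R, u%:~R / (ram (mu j))%:R)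
  end.

Definition is_residual i (g : {poly K}) (R : {poly gr (mu i)}) : Prop :=
  c_Fpoly R /\ exists s u, c_su i g s u /\
    Hmu (mu i) g = c_x i ^+ s * c_p i ^ u * R.[c_y i].

(** The residual operator R_i; for g != 0 exactly one polynomial satisfies
    [is_residual i g]. *)
Definition residual i (g : {poly K}) : {poly gr (mu i)} :=
  if g == 0 then 0 else xget 0 [set R | is_residual g R].

Definition F_dvd i (f g : {poly gr (mu i)}) : Prop :=
  exists2 q, c_Fpoly q & g = f * q.

(** F_i is a field, so the units of F_i[y] are the nonzero constants. *)
Definition F_irreducible i (f : {poly gr (mu i)}) : Prop :=
  [/\ c_Fpoly f, (1 < size f)%N & forall p q, c_Fpoly p -> c_Fpoly q ->
        f = p * q -> size p = 1%N \/ size q = 1%N].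

End ChainData.

(** A type of order r; [t_psi i] is psi_i, and all components of level
    greater than r are irrelevant. *)
Record mltype (K : fieldType) (v : K -> int) (pi : K) := MLType {
  t_ord : nat;
  t_chain : chain v;
  t_psi : forall i, {poly gr (c_mu t_chain i)};
  t_chainP : maclane_chain t_chain t_ord;
  t_psiP : forall i, (i < t_ord)%N ->
    t_psi i = residual pi t_chain i (c_phi t_chain i.+1);
  t_monic : t_psi t_ord \is monic;
  t_irr : F_irreducible (t_psi t_ord);
  t_neqX : (0 < t_ord)%N -> t_psi t_ord != 'X }.

Section Types.
Variables (K : fieldType) (v : K -> int) (pi : K).
Implicit Type t : mltype v pi.

Definition t_mu t : valuation v := c_mu (t_chain t) (t_ord t).

Definition t_val t (f : {fraction {poly K}}) : rat :=
  (ram (t_mu t))%:R * t_mu t f.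

Definition t_ideal t : set (gr (t_mu t)) :=
  [set (t_psi t (t_ord t)).[c_y pi (t_chain t) (t_ord t)] * d
     | d in Delta (t_mu t)].
Arguments t_ideal : clear implicits.

Definition Rep t : set {poly K} :=
  [set phi | KP (t_mu t) phi /\ Rideal (t_mu t) phi = t_ideal t].

Definition is_ordt t (g : {poly K}) (n : nat) : Prop :=
  let dvd m := F_dvd (t_psi t (t_ord t) ^+ m)
                     (residual pi (t_chain t) (t_ord t) g) in
  dvd n /\ forall m, dvd m -> (m <= n)%N.

(** ord_t(g), with None standing for +oo, which occurs exactly at g = 0. *)
Definition ordt t (g : {poly K}) : option nat :=
  xget None [set o | exists2 n, is_ordt t g n & o = Some n].

(** v_t = v_t' on K(x)^*, and the ideals L_t and L_t' coincide as sets of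
    cosets of polynomials. *)
Definition type_equiv t t' : Prop :=
  (forall f, f != 0 -> t_val t f = t_val t' f) /\
  [set coset 0 d | d in t_ideal t] = [set coset 0 d | d in t_ideal t'].

End Types.

(* Main.v *)
(** Write H(g) for the class of g in the graded algebra of mu_t and Z for
    psi_r(y_r), which generates L_t.  Every class has a normal form
    H(g) = x^s p^u R(y) with 0 <= s < e and R a polynomial over the field F_r,
    unique because y is transcendental over F_r; since psi_r is prime to y, the
    power psi_r^n divides the residual polynomial of g exactly when Z^n divides
    H(g).  So ord_t depends only on v_t and L_t, and (1) implies (2).  Writing
    p^u Z as the class of a monic polynomial of degree e deg(psi_r) deg(phi_r)
    produces an element of Rep(t), and Rep(t) consists of the monic g of least
    degree with ord_t(g) > 0, so (2) implies (3).

    Suppose Rep(t) = Rep(t') contains Phi.  Following the MacLane chain of t,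
    on whose steps Phi has a Newton polygon with a single slope, shows that
    mu_t and mu_t' are comparable.  If mu_t < mu_t', the last key polynomial
    phi of the chain of t' has the degree of Phi and satisfies
    mu_t(Phi - phi) > mu_t(Phi), hence lies in Rep(t) = Rep(t').  Then H(phi)
    divides psi'(y), although it divides y and psi'(0) is a unit, which is
    absurd.  So mu_t = mu_t', and L_t and L_t' are both the residual ideal of
    Phi. *)

Require Import Defs.
From mathcomp Require Import all_boot all_order all_algebra.
From mathcomp Require Import generic_quotient zify ring lra.
From mathcomp Require Import boolp classical_sets.

Set Implicit Arguments.
Unset Strict Implicit.
Unset Printing Implicit Defensive.

Import Order.TTheory GRing.Theory Num.Theory.
Local Open Scope ring_scope.

(** * Polynomials with coefficients in a subfield of a ring *)

(** The graded algebra is a quotient with no structure at hand beyond that of a commutative ring,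
    and F_r is only a subset of it. So polynomials over F_r are polynomials over Gr(mu) with
    restricted coefficients, and arguments in Gr(mu) are reduced to homogeneous elements, which are
    classes of polynomials. Order 0 and positive orders are treated alike through [level]: besides
    numerical data, normal forms need only that polynomials smaller than phi have classes that are
    invertible and closed under products, and that values are read off phi-expansions. The graded
    algebras of two valuations are different types even when the valuations agree, so types are
    compared only through statements on polynomials: values, [mu_dvd] and cosets. Comparability
    rests on one estimate: if the value of phi is lowered while smaller polynomials keep theirs, the
    terms of phi^n - Phi become strictly larger in value than phi^n, so that phi^n and Phi get the
    same class. The case psi_0 = y is harmless because e_0 = 1 leaves no power of x_0 to cancel. *)

Section SubfieldPolynomials.
Variables (R : comUnitRingType) (S : set R).
Hypotheses (S1 : S 1) (SB : forall a b, S a -> S b -> S (a - b))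
  (SM : forall a b, S a -> S b -> S (a * b))
  (SV : forall a, S a -> a != 0 -> exists2 b, S b & b * a = 1).

(** Polynomials over the subfield [S] inside a ring not assumed to be a domain. The inverses given
    by [SV] make products of nonzero coefficients nonzero, so degrees still add. *)
Definition poly_in : set {poly R} := [set p : {poly R} | forall k, S p`_k].

Definition pdvd (f g : {poly R}) := exists2 q, poly_in q & g = f * q.

Let S0 : S 0. Proof. by rewrite -(subrr 1); apply: SB. Qed.

Let SD a b : S a -> S b -> S (a + b).
Proof. by move=> Sa Sb; rewrite -[b]opprK; apply/SB=> //; rewrite -sub0r; apply: SB. Qed.

Let S_mul_neq0 a b : S a -> S b -> a != 0 -> b != 0 -> a * b != 0.
Proof.
move=> Sa Sb a0 b0; have [c _ ca] := SV Sa a0.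
by apply: contra_neq b0 => /(congr1 ( *%R c)); rewrite mulrA ca mul1r mulr0.
Qed.

Lemma poly_in0 : poly_in 0. Proof. by move=> k; rewrite coef0. Qed.

Lemma poly_inC c : S c -> poly_in c%:P.
Proof. by move=> Sc k; rewrite coefC; case: ifP. Qed.

Lemma poly_in1 : poly_in 1. Proof. by rewrite -polyC1; apply: poly_inC. Qed.

Lemma poly_inD p q : poly_in p -> poly_in q -> poly_in (p + q).
Proof. by move=> Sp Sq k; rewrite coefD; apply: SD. Qed.

Lemma poly_inM p q : poly_in p -> poly_in q -> poly_in (p * q).
Proof.
by move=> Sp Sq k; rewrite coefM; apply: (big_ind S) => // i _; apply: SM.
Qed.

Lemma poly_inB p q : poly_in p -> poly_in q -> poly_in (p - q).
Proof. by move=> Sp Sq k; rewrite coefB; apply: SB. Qed.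

Lemma poly_inXn n : poly_in 'X^n.
Proof. by move=> k; rewrite coefXn; case: eqP. Qed.

Lemma poly_inX p n : poly_in p -> poly_in (p ^+ n).
Proof. by move=> Sp; elim: n => [|n IH]; rewrite ?exprS; [apply: poly_in1|apply: poly_inM]. Qed.

Lemma size_poly_inM p q : poly_in p -> poly_in q -> p != 0 -> q != 0 ->
  size (p * q) = (size p + size q).-1.
Proof.
move=> Sp Sq p0 q0; apply: size_proper_mul.
by apply: S_mul_neq0; rewrite ?lead_coef_eq0 //; [apply: Sp|apply: Sq].
Qed.

Lemma poly_inM_neq0 p q : poly_in p -> poly_in q -> p != 0 -> q != 0 -> p * q != 0.
Proof.
move=> Sp Sq p0 q0; rewrite -size_poly_gt0 size_poly_inM //.
by move: p0 q0; rewrite -!size_poly_gt0; case: (size p) (size q) => [|m] [|n] //; rewrite addnS.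
Qed.

Lemma pdvd_size p q : poly_in p -> pdvd p q -> q != 0 -> (size p <= size q)%N.
Proof.
move=> Sp [r Sr ->] pr0; have p0 : p != 0 by apply: contra_neq pr0 => ->; rewrite mul0r.
have r0 : r != 0 by apply: contra_neq pr0 => ->; rewrite mulr0.
rewrite size_poly_inM //; move: r0; rewrite -size_poly_gt0.
by case: (size r) => // n _; rewrite addnS leq_addr.
Qed.

(** The lead coefficient of the divisor has an inverse in [S], so cancelling top terms stays inside
    [poly_in]. *)
Lemma poly_in_divr d a : poly_in d -> poly_in a -> d != 0 ->
  exists q r, [/\ poly_in q, poly_in r, a = q * d + r & (size r < size d)%N].
Proof.
move=> Sd Sa d0; have [b Sb bd] : exists2 b, S b & b * lead_coef d = 1.
  by apply: SV; rewrite ?lead_coef_eq0 //; apply: Sd.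
move: {2}(size a) (leqnn (size a)) => n; elim: n a Sa => [|n IH] a Sa sa.
  exists 0, 0; split=> //; try exact: poly_in0.
    by rewrite mul0r addr0; apply/eqP; rewrite -size_poly_eq0; move: sa; rewrite leqn0.
  by rewrite size_poly0 size_poly_gt0.
have [ad|da] := ltnP (size a) (size d).
  by exists 0, a; split=> //; [exact: poly_in0|rewrite mul0r add0r].
have [m am] : exists m, (size a = m + size d)%N by exists (size a - size d)%N; rewrite subnK.
have Sc : S (lead_coef a * b) by apply: SM => //; apply: Sa.
pose c := (lead_coef a * b)%:P * 'X^m.
have Scp : poly_in c by apply: poly_inM; [apply: poly_inC|apply: poly_inXn].
have Sa' : poly_in (a - c * d) by apply: poly_inB => //; apply: poly_inM.
have sa' : (size (a - c * d)%R <= n)%N.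
  apply/leq_sizeP => j nj; rewrite /c -mulrA coefB coefCM coefXnM.
  have [jm|mj] := ltnP j m.
    have : (m <= n)%N by move: sa d0; rewrite am -size_poly_gt0; case: (size d) => // k; rewrite addnS ltnS => /(leq_trans (leq_addr _ _)).
    by move=> mn; move: (leq_trans jm (leq_trans mn nj)); rewrite ltnn.
  move: nj; rewrite leq_eqVlt => /orP[/eqP nj|nj]; last first.
    rewrite !nth_default ?mulr0 ?subr0 ?(leq_trans sa) //.
    by rewrite leq_subRL // -am; apply: leq_trans nj.
  move: (sa); rewrite leq_eqVlt => /orP[/eqP san|san]; last first.
    have sdj : (size d <= j - m)%N by rewrite leq_subRL // -am -nj.
    have saj : (size a <= j)%N by rewrite -nj.
    by rewrite !nth_default // mulr0 subr0.
  have -> : a`_j = lead_coef a by rewrite lead_coefE san nj.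
  have -> : d`_(j - m) = lead_coef d.
    by rewrite lead_coefE; congr (_`_ _); move: d0; rewrite -size_poly_gt0; lia.
  by rewrite -mulrA bd mulr1 subrr.
have [q [r [Sq Sr ar sr]]] := IH _ Sa' sa'.
exists (c + q), r; split=> //; first exact: poly_inD.
by rewrite mulrDl -addrA -ar addrC subrK.
Qed.

Variable f : {poly R}.
Hypotheses (Sf : poly_in f) (f_monic : f \is monic) (sf : (1 < size f)%N)
  (irrf : forall p q, poly_in p -> poly_in q -> f = p * q -> size p = 1%N \/ size q = 1%N).

(** Let d be an element of least size in the ideal generated by f and a; it divides both.
    Irreducibility of f = d q makes d or q constant: in the first case a Bezout relation multiplied
    by b shows that f divides b, in the second f divides a. *)
Lemma irr_prime a b : poly_in a -> poly_in b -> pdvd f (a * b) ->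
  pdvd f a \/ pdvd f b.
Proof.
move=> Sa Sb fab; have [fa|nfa] := pselect (pdvd f a); [by left|right].
pose I d := exists u w, [/\ poly_in u, poly_in w & d = u * f + w * a].
have IB p q : I p -> I q -> I (p - q).
  move=> [u [w [Su Sw ->]]] [u' [w' [Su' Sw' ->]]].
  by exists (u - u'), (w - w'); split; try exact: poly_inB; ring.
have IM r p : poly_in r -> I p -> I (r * p).
  move=> Sr [u [w [Su Sw ->]]]; exists (r * u), (r * w).
  by split; try exact: poly_inM; ring.
have If : I f by exists 1, 0; split; [exact: poly_in1|exact: poly_in0|ring].
have Ia : I a by exists 0, 1; split; [exact: poly_in0|exact: poly_in1|ring].
have Ip p : I p -> poly_in p.
  by move=> [u [w [Su Sw ->]]]; apply: poly_inD; apply: poly_inM.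
pose P n := `[< exists d, [/\ I d, d != 0 & size d = n] >].
have exP : exists n, P n.
  by exists (size f); apply/asboolP; exists f; split=> //; apply: monic_neq0.
case: (ex_minnP exP) => n /asboolP[d [Id d0 dn]] nmin.
have dvd p : I p -> pdvd d p.
  move=> pI; have [q [r [Sq Sr pE sr]]] := poly_in_divr (Ip _ Id) (Ip _ pI) d0.
  have [r0|r0] := eqVneq r 0; first by exists q => //; rewrite pE r0 addr0 mulrC.
  have Ir : I r by rewrite (_ : r = p - q * d); [apply/IB/IM|rewrite pE; ring].
  have Pr : P (size r) by apply/asboolP; exists r.
  by have := nmin _ Pr; rewrite leqNgt -dn sr.
have [q Sq fq] := dvd _ If; have [r Sr ar] := dvd _ Ia.
case: (irrf (Ip _ Id) Sq fq) => [/eqP/size_poly1P[c c0 dc]|/eqP/size_poly1P[c c0 qc]].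
  have Sc : S c by have := Ip _ Id 0%N; rewrite dc coefC.
  have [c' Sc' cc] := SV Sc c0; have := Id; rewrite dc => -[u [w [Su Sw uw]]].
  have [k Sk abk] := fab; exists (c'%:P * (u * b + w * k)).
    apply: poly_inM; [exact: poly_inC|].
    by apply: poly_inD; apply: poly_inM.
  rewrite -[LHS]mul1r -polyC1 -cc polyCM uw.
  rewrite -!mulrA mulrDl -[w * a * b]mulrA abk; ring.
have Sc : S c by have := Sq 0%N; rewrite qc coefC.
have [c' Sc' cc] := SV Sc c0; case: nfa; exists (c'%:P * r).
  by apply: poly_inM => //; apply: poly_inC.
rewrite fq qc ar -[LHS]mul1r -polyC1 -cc polyCM; ring.
Qed.

Lemma irr_coef0 : f != 'X -> f`_0 != 0.
Proof.
apply: contra_neq => f0.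
have fE : f = (\poly_(i < size f) f`_i.+1) * 'X.
  apply/polyP => -[|i]; rewrite coefMX //= coef_poly; case: ifP => // /negbT.
  by rewrite -leqNgt => si; rewrite nth_default // (leq_trans si).
set q := \poly_(i < _) _ in fE.
have Sq : poly_in q by move=> k; rewrite coef_poly; case: ifP.
have := irrf Sq (poly_inXn 1) fE; rewrite size_polyX => -[|//].
move/eqP/size_poly1P => [c c0 qc]; move: f_monic; rewrite fE qc => /monicP.
by rewrite lead_coef_Mmonic ?monicX // lead_coefC => ->; rewrite polyC1 mul1r.
Qed.

(** The constant coefficient of f^n is nonzero, so the cofactor q in X^(k+1) a = f^n q vanishes at 0
    and one X cancels. *)
Lemma pdvd_mulXn n k a : f != 'X -> poly_in a ->
  pdvd (f ^+ n) ('X^k * a) -> pdvd (f ^+ n) a.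
Proof.
move=> /irr_coef0 f0 Sa; elim: k => [|k IH]; first by rewrite mul1r.
move=> [q Sq]; rewrite exprS -mulrA => E; apply: IH.
have fn0 : (f ^+ n)`_0 != 0.
  elim: (n) => [|m IH]; first by rewrite coef1 oner_neq0.
  by rewrite exprS coef0M; apply: S_mul_neq0 => //; apply: poly_inX.
have q0 : q`_0 = 0.
  move/(congr1 (fun p : {poly R} => p`_0)): E; rewrite coefXM coef0M /= => /esym/eqP.
  by apply: contraTeq; apply: S_mul_neq0 => //; apply: poly_inX.
have qE : q = 'X * (\poly_(i < size q) q`_i.+1).
  apply/polyP => -[|i]; rewrite coefXM //= coef_poly; case: ifP => // /negbT.
  by rewrite -leqNgt => si; rewrite nth_default // (leq_trans si).
exists (\poly_(i < size q) q`_i.+1).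
  by move=> j; rewrite coef_poly; case: ifP.
by apply: (monic_lreg (monicX R)); rewrite E {1}qE mulrCA.
Qed.

End SubfieldPolynomials.

(** * Homogeneous components in the graded algebra *)

Section GradedAlgebra.
Variables (K : fieldType) (v : K -> int) (mu : valuation v).
Implicit Types (f g h : {poly K}) (a b : rat) (c d : gr mu).
Local Open Scope quotient_scope.
Local Notation pval := (pval mu).
Local Notation filt := (filt mu).
Local Notation filtp := (filtp mu).
Local Notation grclass := (grclass mu).
Local Notation Hmu := (Hmu mu).

Lemma filt0 a : filt a 0. Proof. by left. Qed.
Lemma filtpW a g : filtp a g -> filt a g.
Proof. by case=> [->|/ltW]; [left|right]. Qed.
Lemma filt_pval g : filt (pval g) g. Proof. by right. Qed.
Lemma filt_lt a b g : a < b -> filt b g -> filtp a g.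
Proof. by move=> ab [->|bg]; [left|right; apply: lt_le_trans bg]. Qed.
Lemma filtB a g h : filt a g -> filt a h -> filt a (g - h).
Proof. by move=> ag ah; apply/filtD/filtN. Qed.
Lemma filtE a g : g != 0 -> filt a g <-> a <= pval g.
Proof. by move=> g0; split=> [[/eqP|//]|]; [rewrite (negPf g0)|right]. Qed.
Lemma filtpE a g : g != 0 -> filtp a g <-> a < pval g.
Proof. by move=> g0; split=> [[/eqP|//]|]; [rewrite (negPf g0)|right]. Qed.
Lemma not_filtp a g : ~ filtp a g -> g != 0 /\ pval g <= a.
Proof.
move=> ng; have g0 : g != 0 by apply/eqP => g0; apply: ng; left.
by split=> //; rewrite leNgt; apply/negP => ag; apply: ng; right.
Qed.
Lemma not_filt a g : ~ filt a g -> g != 0 /\ pval g < a.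
Proof.
move=> ng; have g0 : g != 0 by apply/eqP => g0; apply: ng; left.
by split=> //; rewrite ltNge; apply/negP => ag; apply: ng; right.
Qed.
Lemma filtp_pval g : g != 0 -> ~ filtp (pval g) g.
Proof. by move=> g0; rewrite filtpE // ltxx. Qed.
Lemma filt_exact a g : filt a g -> ~ filtp a g -> g != 0 /\ pval g = a.
Proof.
move=> ag /not_filtp[g0 ga]; split=> //; apply/le_anti; rewrite ga /=.
exact/(filtE _ g0).
Qed.
Lemma pvalX g n : g != 0 -> pval (g ^+ n) = n%:R * pval g.
Proof.
move=> g0; elim: n => [|n IH]; first by rewrite pval1 mul0r.
by rewrite exprS pvalM ?expf_neq0 // IH -[n.+1]add1n natrD; ring.
Qed.
Lemma filtX a g n : filt a g -> filt (n%:R * a) (g ^+ n).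
Proof.
move=> ag; elim: n => [|n IH]; first by right; rewrite pval1 mul0r.
by rewrite exprS -[n.+1]add1n natrD mulrDl mul1r; apply: filtM.
Qed.
Lemma pval_eq g h : g != 0 -> filtp (pval g) (g - h) -> h != 0 /\ pval h = pval g.
Proof.
move=> g0 gh; have hE : h = g - (g - h) by ring.
apply: filt_exact; first by rewrite hE; apply: filtB (filt_pval g) (filtpW gh).
move=> ph; by apply: (filtp_pval g0); have := filtpD ph gh; rewrite addrC subrK.
Qed.

Lemma filt_hcoef (s : hsum mu) a : filt a (hcoef s a).
Proof.
rewrite /hcoef big_seq_cond; apply: (big_ind (filt a)); [exact: filt0|exact: filtD|].
by move=> p /andP[/hsumP ps /eqP <-].
Qed.

Lemma hcoef_mono a g b : filt a g -> hcoef (hmono mu a g) b = if a == b then g else 0.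
Proof. by move=> ag; rewrite /hcoef hmonoE // big_cons big_nil /=; case: ifP; rewrite ?addr0. Qed.

Lemma pi_eq0 (s : hsum mu) : (forall a, filtp a (hcoef s a)) -> \pi_(gr mu) s = 0.
Proof.
move=> s0; apply/eqmodP/asboolP => a; rewrite hcoef0 subr0; exact: s0.
Qed.

Lemma grclassD a g h : filt a g -> filt a h ->
  grclass a (g + h) = grclass a g + grclass a h.
Proof.
move=> ag ah; rewrite /grclass -[RHS]/(gradd _ _) -pi_gradd; apply: eq_gr => b.
by rewrite hcoefD !hcoef_mono //; [case: ifP; rewrite ?addr0|exact: filtD].
Qed.

Lemma grclass0 a : grclass a 0 = 0.
Proof. by apply: pi_eq0 => b; rewrite hcoef_mono ?if_same; [left|left]. Qed.

Lemma grclassN a g : filt a g -> grclass a (- g) = - grclass a g.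
Proof.
move=> ag; apply/eqP; rewrite -subr_eq0 opprK -grclassD ?addNr ?grclass0 //.
exact: filtN.
Qed.

Lemma grclassB a g h : filt a g -> filt a h ->
  grclass a (g - h) = grclass a g - grclass a h.
Proof. by move=> ag ah; rewrite grclassD ?grclassN //; apply: filtN. Qed.

Lemma grclassM a b g h : filt a g -> filt b h ->
  grclass (a + b) (g * h) = grclass a g * grclass b h.
Proof.
move=> ag bh; rewrite /grclass -[RHS]/(grmul _ _) -pi_grmul; apply: eq_gr => e.
rewrite /hcoef hmonoE /=; last exact: filtM.
by rewrite !hmonoE.
Qed.

Lemma grclass1 : grclass 0 1 = 1. Proof. by []. Qed.

Lemma grclass_eq0 a g : filt a g -> grclass a g = 0 <-> filtp a g.
Proof.
move=> ag; split=> [/eqmodP/asboolP/(_ a)|pg].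
  by rewrite hcoef0 subr0 hcoef_mono ?eqxx.
by apply: pi_eq0 => b; rewrite hcoef_mono //; case: eqP => [<-|_] //; left.
Qed.

Lemma grclass_eq a g h : filt a g -> filt a h ->
  grclass a g = grclass a h <-> filtp a (g - h).
Proof.
move=> ag ah; rewrite -grclass_eq0; last exact: filtB.
rewrite grclassB //; split=> [->|/eqP]; first by rewrite subrr.
by rewrite subr_eq0 => /eqP.
Qed.

Lemma grclass_sum a (I : Type) (r : seq I) (P : pred I) (F : I -> {poly K}) :
  (forall i, P i -> filt a (F i)) ->
  filt a (\sum_(i <- r | P i) F i) /\
  grclass a (\sum_(i <- r | P i) F i) = \sum_(i <- r | P i) grclass a (F i).
Proof.
move=> aF; elim/big_rec2: _ => [|i c g Pi [ag <-]]; first by rewrite grclass0; split=> //; left.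
by split; [apply: filtD => //; apply: aF|rewrite grclassD //; apply: aF].
Qed.

Lemma grclassX a g n : filt a g -> grclass (n%:R * a) (g ^+ n) = grclass a g ^+ n.
Proof.
move=> ag; elim: n => [|n IH]; first by rewrite mul0r.
rewrite !exprS -IH -grclassM //; last exact: filtX.
by rewrite -[n.+1]add1n natrD mulrDl mul1r.
Qed.

(** Projection onto degree a. The chosen representative matters only modulo P_a^+, so any other one
    may be used ([comp_pi]). *)
Definition comp a c : gr mu := grclass a (hcoef (repr c) a).

Lemma comp_pi a (s : hsum mu) : comp a (\pi_(gr mu) s) = grclass a (hcoef s a).
Proof.
apply/grclass_eq; try exact: filt_hcoef.
by have /asboolP/(_ a)/filtpN := heq_repr s; rewrite opprB.
Qed.

Lemma comp_homog a c : exists2 g, filt a g & comp a c = grclass a g.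
Proof. by exists (hcoef (repr c) a) => //; apply: filt_hcoef. Qed.

Lemma comp0 a : comp a 0 = 0.
Proof. by rewrite -[0]/(\pi_(gr mu) _) comp_pi hcoef0 grclass0. Qed.

Lemma compD a c d : comp a (c + d) = comp a c + comp a d.
Proof.
elim/quotW: c => s; elim/quotW: d => t; rewrite -[X in comp a X]/(gradd _ _) -pi_gradd.
by rewrite !comp_pi hcoefD grclassD //; apply: filt_hcoef.
Qed.

Lemma comp_sum a (I : Type) (r : seq I) (P : pred I) (F : I -> gr mu) :
  comp a (\sum_(i <- r | P i) F i) = \sum_(i <- r | P i) comp a (F i).
Proof. exact: (big_morph (comp a) (compD a) (comp0 a)). Qed.

Lemma comp_grclass a b g : filt b g ->
  comp a (grclass b g) = if b == a then grclass b g else 0.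
Proof.
move=> bg; rewrite /grclass comp_pi hcoef_mono //.
by case: eqP => [->|_] //; rewrite grclass0.
Qed.

Lemma comp_grclassM a b g c : filt b g ->
  comp a (grclass b g * c) = grclass b g * comp (a - b) c.
Proof.
move=> bg; elim/quotW: c => s; rewrite -[X in comp a X]/(grmul _ _) -pi_grmul !comp_pi.
rewrite hcoefM hmonoE // big_seq1 /= -grclassM //; last exact: filt_hcoef.
by rewrite subrKC.
Qed.

Lemma comp_ext c d : (forall a, comp a c = comp a d) -> c = d.
Proof.
elim/quotW: c => s; elim/quotW: d => t E; apply/eqmodP/asboolP => a.
by apply/grclass_eq; try exact: filt_hcoef; rewrite -!comp_pi.
Qed.

Definition degs c : seq rat := undup [seq p.1 | p <- hseq (repr c)].

Lemma comp_degs a c : a \notin degs c -> comp a c = 0.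
Proof.
rewrite mem_undup => /mapP na; rewrite /comp /hcoef big_seq_cond big_pred0 ?grclass0 //.
by move=> p; apply/negP => /andP[ps /eqP pa]; apply: na; exists p.
Qed.

Lemma comp_comp a b c : comp b (comp a c) = if a == b then comp a c else 0.
Proof. by have [g ag ->] := comp_homog a c; rewrite comp_grclass. Qed.

Lemma comp_dec c : c = \sum_(a <- degs c) comp a c.
Proof.
apply: comp_ext => b; rewrite comp_sum.
under eq_bigr do rewrite comp_comp.
have [bc|bc] := boolP (b \in degs c).
  rewrite (bigD1_seq b) ?undup_uniq //= eqxx big1 ?addr0 // => a /negPf ->.
  by [].
rewrite comp_degs // big_seq big1 // => a ac; case: eqP => // ab.
by rewrite -ab ac in bc.
Qed.

Lemma HmuE g : g != 0 -> Hmu g = grclass (pval g) g.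
Proof. by rewrite /Hmu => /negPf ->. Qed.

Lemma Hmu0 : Hmu 0 = 0. Proof. by rewrite /Hmu eqxx. Qed.

Lemma Hmu1 : Hmu 1 = 1. Proof. by rewrite HmuE ?oner_neq0 // pval1. Qed.

Lemma Hmu_neq0 g : g != 0 -> Hmu g != 0.
Proof. by move=> g0; rewrite HmuE //; apply/eqP => /grclass_eq0 -/(_ (filt_pval g)); apply: filtp_pval. Qed.

Lemma HmuM g h : Hmu (g * h) = Hmu g * Hmu h.
Proof.
have [->|g0] := eqVneq g 0; first by rewrite mul0r Hmu0 mul0r.
have [->|h0] := eqVneq h 0; first by rewrite mulr0 Hmu0 mulr0.
by rewrite !HmuE ?mulf_neq0 // pvalM // grclassM //; apply: filt_pval.
Qed.

Lemma HmuX g n : Hmu (g ^+ n) = Hmu g ^+ n.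
Proof. by elim: n => [|n IH]; rewrite ?Hmu1 // !exprS HmuM IH. Qed.

Lemma grclass_Hmu a g : g != 0 -> pval g = a -> grclass a g = Hmu g.
Proof. by move=> g0 <-; rewrite HmuE. Qed.

Lemma grclass_homog a g : filt a g -> grclass a g != 0 ->
  [/\ g != 0, pval g = a & grclass a g = Hmu g].
Proof.
move=> ag /eqP n0; have np : ~ filtp a g by move/(grclass_eq0 ag).
have [g0 ga] := filt_exact ag np.
by split=> //; apply: grclass_Hmu.
Qed.

Lemma Hmu_eq g h : g != 0 -> filtp (pval g) (g - h) -> Hmu g = Hmu h.
Proof.
move=> g0 gh; have [h0 hE] := pval_eq g0 gh.
rewrite !HmuE // hE; apply/grclass_eq => //; first exact: filt_pval.
by rewrite -hE; apply: filt_pval.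
Qed.

Lemma Hmu_inj g h : g != 0 -> Hmu g = Hmu h -> filtp (pval g) (g - h).
Proof.
move=> g0; have [->|h0] := eqVneq h 0.
  by rewrite Hmu0 => /eqP; rewrite (negPf (Hmu_neq0 g0)).
move=> E; have := congr1 (comp (pval g)) E; rewrite !HmuE // !comp_grclass; try exact: filt_pval.
rewrite eqxx; case: eqP => [hg|_ /eqP]; last by rewrite -HmuE // (negPf (Hmu_neq0 g0)).
by rewrite hg => /grclass_eq; apply; [exact: filt_pval|rewrite -hg; exact: filt_pval].
Qed.

Lemma Hmu_pval g h : g != 0 -> Hmu g = Hmu h -> h != 0 /\ pval h = pval g.
Proof. by move=> g0 /(Hmu_inj g0); apply: pval_eq. Qed.

Lemma gr_dvd_refl c : gr_dvd c c. Proof. by exists 1; rewrite mulr1. Qed.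
Lemma gr_dvd_trans c d e : gr_dvd c d -> gr_dvd d e -> gr_dvd c e.
Proof. by move=> [q ->] [r ->]; exists (q * r); rewrite mulrA. Qed.
Lemma gr_dvdMr c d e : gr_dvd c d -> gr_dvd c (d * e).
Proof. by move=> [q ->]; exists (q * e); rewrite mulrA. Qed.
Lemma gr_dvdD c d e : gr_dvd c d -> gr_dvd c e -> gr_dvd c (d + e).
Proof. by move=> [q ->] [r ->]; exists (q + r); rewrite mulrDr. Qed.
Lemma gr_dvd0 c : gr_dvd c 0. Proof. by exists 0; rewrite mulr0. Qed.
Lemma gr_dvdN c d : gr_dvd c d -> gr_dvd c (- d).
Proof. by move=> [q ->]; exists (- q); rewrite mulrN. Qed.

Lemma gr_dvd_comp a b g c : filt b g -> gr_dvd (grclass b g) c ->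
  exists q, filt (a - b) q /\ comp a c = grclass b g * grclass (a - b) q.
Proof.
move=> bg [q ->]; have [h ah hE] := comp_homog (a - b) q; exists h; split=> //.
by rewrite comp_grclassM // hE.
Qed.

(** Only the component of degree mu(h) - mu(g) of a quotient contributes to H(h), and that component
    is the class of a polynomial. *)
Lemma mu_dvdP g h : h != 0 -> mu_dvd mu g h ->
  g != 0 /\ exists2 q, q != 0 & Hmu h = Hmu g * Hmu q.
Proof.
move=> h0 gh; have g0 : g != 0.
  apply/eqP => g0; case: gh => q; rewrite g0 Hmu0 mul0r => /eqP.
  by rewrite (negPf (Hmu_neq0 h0)).
split=> //; move: gh; rewrite /mu_dvd (HmuE g0) => /(gr_dvd_comp (pval h) (filt_pval g)).
rewrite HmuE // comp_grclass ?eqxx; last exact: filt_pval.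
move=> [q [qf E]]; have q0 : grclass (pval h - pval g) q != 0.
  apply/eqP => q0; move/eqP: E; rewrite q0 mulr0 -HmuE //.
  by rewrite (negPf (Hmu_neq0 h0)).
by have [? _ qE] := grclass_homog qf q0; exists q => //; rewrite E qE.
Qed.

Lemma maxr_seq (P : rat -> Prop) (s : seq rat) : (exists2 a, a \in s & P a) ->
  exists2 a, a \in s /\ P a & forall b, b \in s -> a < b -> ~ P b.
Proof.
elim: s => [[a //]|x s IH] H.
have [/IH[a [as_ Pa] amax]|nP] := pselect (exists2 a, a \in s & P a).
  have [[ax Px]|nPx] := pselect (a < x /\ P x).
    exists x; first by rewrite mem_head.
    move=> b; rewrite inE => /orP[/eqP ->|bs]; first by rewrite ltxx.
    by move=> xb; apply: amax => //; apply: lt_trans xb.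
  exists a; first by rewrite inE as_ orbT.
  by move=> b; rewrite inE => /orP[/eqP -> ? ?|bs]; [apply: nPx|apply: amax].
case: H => a; rewrite inE => /orP[/eqP ->|as_] Pa; last by case: nP; exists a.
exists x; first by rewrite mem_head.
by move=> b; rewrite inE => /orP[/eqP ->|bs _ Pb]; [rewrite ltxx|apply: nP; exists b].
Qed.

(** Of two elements outside the ideal, the components of highest degree
    outside it have a product that is, modulo the ideal, a component of the
    product. *)
Lemma prime_homog w : w != 0 -> ~ gr_dvd (Hmu w) 1 ->
  (forall f g, f != 0 -> g != 0 -> gr_dvd (Hmu w) (Hmu f * Hmu g) ->
     gr_dvd (Hmu w) (Hmu f) \/ gr_dvd (Hmu w) (Hmu g)) ->
  prime_ideal (gr_ideal (Hmu w)).
Proof.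
move=> w0 w1 wP; split=> // c d wcd; apply: contrapT => /not_orP[wc wd].
have I_comp a e : gr_dvd (Hmu w) e -> gr_dvd (Hmu w) (comp a e).
  rewrite HmuE // => /(gr_dvd_comp a (filt_pval w))[q [_ ->]].
  exact/gr_dvdMr/gr_dvd_refl.
have I_sum e : (forall a, gr_dvd (Hmu w) (comp a e)) -> gr_dvd (Hmu w) e.
  move=> eI; rewrite [e]comp_dec; apply: (big_ind (gr_dvd (Hmu w))) => //.
    exact: gr_dvd0.
  by move=> x y; apply: gr_dvdD.
have top e : ~ gr_dvd (Hmu w) e -> exists2 a, ~ gr_dvd (Hmu w) (comp a e) &
    forall b, a < b -> gr_dvd (Hmu w) (comp b e).
  move=> we; have [|a [_ aP] amax] := @maxr_seq (fun a => ~ gr_dvd (Hmu w) (comp a e)) (degs e).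
    apply: contrapT => nex; apply: we; apply: I_sum => a; apply: contrapT => wa.
    apply: nex; exists a => //; apply: contrapT => /negP/comp_degs ae.
    by apply: wa; rewrite ae; apply: gr_dvd0.
  exists a => // b ab; apply: contrapT => wb; apply: (amax b) => //.
  apply: contrapT => /negP/comp_degs be.
  by apply: wb; rewrite be; apply: gr_dvd0.
have [a wa amax] := top c wc; have [b wb bmax] := top d wd.
have : gr_dvd (Hmu w) (comp a c * comp b d).
  have := I_comp (a + b) _ wcd; rewrite [c in c * d]comp_dec mulr_suml comp_sum.
  have E e : comp (a + b) (comp e c * d) = comp e c * comp (a + b - e) d.
    by have [g eg ->] := comp_homog e c; rewrite comp_grclassM.
  under eq_bigr do rewrite E.
  have [ac|/comp_degs -> _] := boolP (a \in degs c); last first.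
    by rewrite mul0r; apply: gr_dvd0.
  rewrite (bigD1_seq a) ?undup_uniq //= addrAC subrr add0r => S.
  set r := \sum_(_ <- _ | _) _ in S; rewrite -[X in gr_dvd _ X](addrK r).
  apply: gr_dvdD => //; apply: gr_dvdN; rewrite /r.
  apply: (big_ind (gr_dvd (Hmu w))) => [||e ea]; [exact: gr_dvd0|exact: gr_dvdD|].
  (* For e above a the first factor is in the ideal; for e below a the second factor has degree a +
     b - e > b and is in the ideal. *)
  have [/amax we|ea'] := ltP a e; first exact: gr_dvdMr.
  by rewrite mulrC; apply/gr_dvdMr/bmax; rewrite ltrBrDr; rewrite addrC ltrD2r lt_neqAle ea.
have [g ag gE] := comp_homog a c; have [h bh hE] := comp_homog b d.
rewrite gE hE in wa wb *.
have /(grclass_homog ag)[g0 _ gE'] : grclass a g != 0.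
  by apply/eqP => E; apply: wa; rewrite E; apply: gr_dvd0.
have /(grclass_homog bh)[h0 _ hE'] : grclass b h != 0.
  by apply/eqP => E; apply: wb; rewrite E; apply: gr_dvd0.
by rewrite gE' hE' in wa wb * => /wP[].
Qed.

End GradedAlgebra.

(** * Expansions and key polynomials *)

Lemma size_monicB (R : nzRingType) (p q : {poly R}) : p \is monic -> q \is monic ->
  size p = size q -> (size (p - q)%R < size q)%N.
Proof.
move=> mp mq spq; have q0 : (0 < size q)%N by rewrite size_poly_gt0 monic_neq0.
rewrite -(prednK q0) ltnS; apply/leq_sizeP => j; rewrite leq_eqVlt coefB => /orP[/eqP <-|].
  by rewrite -{1}spq -!lead_coefE (monicP mp) (monicP mq) subrr.
by rewrite prednK // => qj; rewrite !nth_default ?subrr ?spq.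
Qed.

Section Expansions.
Variables (K : fieldType) (phi : {poly K}).
Hypotheses (phi_monic : phi \is monic) (sphi : (1 < size phi)%N).
Implicit Types (g r q : {poly K}) (a b : {poly {poly K}}).

Let phi0 : phi != 0. Proof. exact: monic_neq0. Qed.

Lemma expansion_cons g q r a : is_expansion phi q a -> (size r < size phi)%N ->
  g = q * phi + r -> is_expansion phi g (a * 'X + r%:P).
Proof.
move=> [-> sa] sr ->; split=> [|s]; first by rewrite hornerMXaddC.
by rewrite coefD coefMX coefC; case: s => [|s] /=; rewrite ?add0r ?addr0.
Qed.

Lemma expansion_consP a r : is_expansion phi (a * 'X + r%:P).[phi] (a * 'X + r%:P) ->
  is_expansion phi a.[phi] a /\ (size r < size phi)%N.
Proof.
move=> [_ sa]; split; last by have := sa 0%N; rewrite coefD coefMX coefC add0r.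
by split=> // s; have := sa s.+1; rewrite coefD coefMX coefC addr0.
Qed.

(** As phi is monic and digits are shorter than phi, the top term is longer than all the others
    together and nothing cancels. Uniqueness of expansions follows by applying this to a
    difference. *)
Lemma expansion_size g a : is_expansion phi g a -> a != 0 ->
  [/\ g != 0, lead_coef g = lead_coef (lead_coef a)
    & size g = (size (lead_coef a) + (size a).-1 * (size phi).-1)%N].
Proof.
move=> ga; have gE : g = a.[phi] by case: ga.
rewrite gE in ga *; move: ga; elim/poly_ind: {g gE} a => [|a r IH]; first by rewrite eqxx.
move=> /expansion_consP[ea sr]; have [->|a0] := eqVneq a 0.
  rewrite mul0r add0r polyC_eq0 hornerC lead_coefC size_polyC => r0.
  by rewrite r0 addn0.
move=> _; have [g0 lE sE] := IH ea a0; rewrite hornerMXaddC.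
have sX : (size (r%:P : {poly {poly K}}) < size (a * 'X)%R)%N.
  by rewrite size_mulX // (leq_ltn_trans (size_polyC_leq1 _)) // ltnS size_poly_gt0.
have sg : (size (a.[phi] * phi)%R = (size a.[phi] + (size phi).-1)%N).
  by rewrite size_Mmonic //; move: sphi; lia.
have sgr : (size r < size (a.[phi] * phi)%R)%N.
  by rewrite sg; move: g0 sr; rewrite -size_poly_gt0; lia.
have lA : lead_coef (a * 'X + r%:P) = lead_coef a.
  by rewrite lead_coefDl // lead_coef_Mmonic ?monicX.
have sA : size (a * 'X + r%:P) = (size a).+1 by rewrite size_polyDl // size_mulX.
rewrite lA sA; split.
- by rewrite -size_poly_gt0 size_polyDl // (leq_ltn_trans _ sgr).
- by rewrite lead_coefDl // lead_coef_Mmonic.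
rewrite size_polyDl // sg sE.
move: a0; rewrite -size_poly_gt0; case: (size a) => // n _ /=.
by rewrite mulSn addnA addnAC.
Qed.

Lemma expansion_neq0 g a : is_expansion phi g a -> a != 0 -> g != 0.
Proof. by move=> ga /(expansion_size ga)[]. Qed.

Lemma expansion_exists g : exists a, is_expansion phi g a.
Proof.
have [n] := ubnP (size g); elim: n g => // n IH g; rewrite ltnS => gn.
have sr : (size (g %% phi)%R < size phi)%N by rewrite ltn_modp.
have [gphi|phig] := ltnP (size g) (size phi).
  exists g%:P; split=> [|s]; first by rewrite hornerC.
  by rewrite coefC; case: eqP; rewrite ?size_poly0 // ltnW.
have [|a ea] := IH (g %/ phi).
  have aux (k m : nat) : (1 < k)%N -> (k <= m)%N -> (m <= n)%N -> (m - k.-1 < n)%N by lia.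
  by rewrite size_divp //; apply: aux sphi phig gn.
by exists (a * 'X + (g %% phi)%:P); apply: expansion_cons ea sr (divp_eq g phi).
Qed.

Lemma expansionB g h a b : is_expansion phi g a -> is_expansion phi h b ->
  is_expansion phi (g - h) (a - b).
Proof.
move=> [-> sa] [-> sb]; split=> [|s]; first by rewrite hornerD hornerN.
by rewrite coefB (leq_ltn_trans (size_polyD _ _)) // gtn_max size_polyN sa sb.
Qed.

Lemma expansion_uniq g a b : is_expansion phi g a -> is_expansion phi g b -> a = b.
Proof.
move=> ga gb; apply/eqP; rewrite -subr_eq0; apply: contraT => ab.
by have := expansion_neq0 (expansionB ga gb) ab; rewrite subrr eqxx.
Qed.

Lemma expansion_small r : (size r < size phi)%N -> is_expansion phi r r%:P.
Proof.
move=> sr; split=> [|s]; first by rewrite hornerC.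
by rewrite coefC; case: eqP => // _; rewrite size_poly0 (leq_ltn_trans _ sr).
Qed.

Lemma expansion_phi : is_expansion phi phi 'X.
Proof.
split=> [|s]; first by rewrite hornerX.
by rewrite coefX; case: eqP => _; rewrite ?size_poly1 // size_poly0 ltnW.
Qed.

Lemma expansion_size_coef g a n : is_expansion phi g a -> a`_n != 0 ->
  (n * (size phi).-1 < size g)%N.
Proof.
move=> ga an; have a0 : a != 0 by apply: contra_neq an => ->; rewrite coef0.
have [_ _ ->] := expansion_size ga a0.
have na : (n < size a)%N by rewrite ltnNge; apply: contra_neqN an => /leq_sizeP->.
have : (0 < size (lead_coef a))%N by rewrite size_poly_gt0 lead_coef_eq0.
have : (n * (size phi).-1 <= (size a).-1 * (size phi).-1)%N.
  by rewrite leq_mul2r; apply/orP; right; lia.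
lia.
Qed.

End Expansions.

Section KeyPolynomials.
Variables (K : fieldType) (v : K -> int) (mu : valuation v) (phi : {poly K}).
Hypothesis phiKP : KP mu phi.
Implicit Types (f g h q r : {poly K}) (a b : rat).
Local Notation pval := (pval mu).
Local Notation filt := (filt mu).
Local Notation filtp := (filtp mu).
Local Notation Hmu := (Hmu mu).

Lemma KP_monic : phi \is monic. Proof. by case: phiKP. Qed.
Let phi0 : phi != 0. Proof. exact: monic_neq0 KP_monic. Qed.

Lemma KP_nunit : ~ gr_dvd (Hmu phi) 1.
Proof. by case: phiKP => _ _ []. Qed.

Lemma KP_prime f g : gr_dvd (Hmu phi) (Hmu f * Hmu g) -> mu_dvd mu phi f \/ mu_dvd mu phi g.
Proof. by case: phiKP => _ _ [_ P] _ /P. Qed.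

Lemma KP_min h : h != 0 -> (size h < size phi)%N -> ~ mu_dvd mu phi h.
Proof. by case: phiKP => _ _ _; apply. Qed.

Lemma KP_size : (1 < size phi)%N.
Proof.
rewrite ltnNge; apply/negP => /size1_polyC phiC; apply: KP_nunit.
have : phi = 1.
  by have := KP_monic; rewrite phiC monicE lead_coefC => /eqP ->.
by move=> ->; rewrite Hmu1; apply: gr_dvd_refl.
Qed.

(** If mu(r) < a, then r and -q phi have the same class, so phi divides r in the graded sense,
    against the minimality of phi. *)
Lemma KP_div a q r : (size r < size phi)%N -> filt a (q * phi + r) ->
  filt a r /\ filt a (q * phi).
Proof.
move=> sr ag; suff ar : filt a r.
  by split=> //; rewrite -(addrK r (q * phi)); apply: filtB.
apply: contrapT => /not_filt[r0 ra]; apply: (KP_min r0 sr); rewrite /mu_dvd.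
have /(Hmu_eq r0) -> : filtp (pval r) (r - (- (q * phi))).
  by rewrite opprK addrC; apply: filt_lt ag.
by exists (Hmu (- q)); rewrite -mulNr mulrC -HmuM.
Qed.

Lemma KP_div_p a q r : (size r < size phi)%N -> filtp a (q * phi + r) ->
  filtp a r /\ filtp a (q * phi).
Proof.
move=> sr [g0|ag].
  (* The sum is zero and lies in every P_m; a bound m above a turns the weak conclusion into the
     strict one. *)
  have [n] := KP_div (a := 1 + Num.max (Num.max a (pval r)) (pval (q * phi))) sr (or_introl g0).
  set m := 1 + _; have am : a < m by rewrite ltr_pwDl // !le_max lexx.
  by move=> n'; split; apply: filt_lt am _.
have [ar aq] := KP_div sr (filt_pval mu (q * phi + r)).
by split; apply: filt_lt ag _.
Qed.

(** Were mu(r) larger than mu(f g), the product would have the class of q phi, and primality would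
    make phi divide f or g. *)
Lemma KP_mod f g q r : f != 0 -> g != 0 -> ~ mu_dvd mu phi f -> ~ mu_dvd mu phi g ->
  (size r < size phi)%N -> f * g = q * phi + r ->
  [/\ r != 0, pval r = pval (f * g) & filt (pval (f * g)) (q * phi)].
Proof.
move=> f0 g0 nf ng sr E; have fg0 : f * g != 0 by rewrite mulf_neq0.
have := filt_pval mu (f * g); rewrite {2}E => /(KP_div sr)[fr fq].
have [|r0 rE] := @filt_exact _ _ mu _ _ fr; last by split.
move=> pr; have : gr_dvd (Hmu phi) (Hmu f * Hmu g).
  rewrite -HmuM (@Hmu_eq _ _ _ (f * g) (q * phi)) //; last by rewrite {2}E addrC addKr.
  by exists (Hmu q); rewrite mulrC HmuM.
by move/KP_prime => [].
Qed.

Lemma KP_ndvdM f g : ~ mu_dvd mu phi f -> ~ mu_dvd mu phi g -> ~ mu_dvd mu phi (f * g).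
Proof. by move=> nf ng; rewrite /mu_dvd HmuM => /KP_prime[]. Qed.

Lemma KP_ndvdX f n : ~ mu_dvd mu phi f -> ~ mu_dvd mu phi (f ^+ n).
Proof.
move=> nf; elim: n => [|n IH]; rewrite ?exprS; last exact: KP_ndvdM.
by rewrite /mu_dvd Hmu1; apply: KP_nunit.
Qed.

Lemma KP_dvd_size h : h != 0 -> mu_dvd mu phi h -> (size phi <= size h)%N.
Proof. by move=> h0 ph; rewrite leqNgt; apply/negP => sh; apply: KP_min ph. Qed.

(** In a factorization of phi the prime H(phi) divides the class of one factor; by minimality that
    factor has the full degree. *)
Lemma KP_irreducible : irreducible_poly phi.
Proof.
have aux (k m n : nat) : n <> 1%N -> (0 < n)%N -> k = (m + n).-1 -> (k <= m)%N -> False.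
  by lia.
split=> [|d /eqP sd dphi]; first exact: KP_size.
have [q phiE] : exists q : {poly K}, phi = q * d by apply/dvdpP.
have q0 : q != 0 by apply: contra_neq phi0 => q0; rewrite phiE q0 mul0r.
have d0 : d != 0 by apply: contra_neq phi0 => d0; rewrite phiE d0 mulr0.
have sE : size phi = (size q + size d).-1 by rewrite {1}phiE size_mul.
have : gr_dvd (Hmu phi) (Hmu q * Hmu d) by rewrite -HmuM -phiE; apply: gr_dvd_refl.
move: (dvdp_leq phi0 dphi) q0 d0; rewrite -!size_poly_gt0 => sdp sq0 sd0.
move=> /KP_prime[] /KP_dvd_size; rewrite -size_poly_gt0 => /(_ ltac:(by [])) sp.
  by exfalso; apply: aux sd sd0 sE sp.
by rewrite -dvdp_size_eqp // eqn_leq sdp.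
Qed.

Lemma KP_bezout f : f != 0 -> (size f < size phi)%N ->
  exists g q, [/\ g != 0, (size g < size phi)%N & f * g = q * phi + 1].
Proof.
move=> f0 sf; have [_ irr] := KP_irreducible.
have /Bezout_eq1_coprimepP[[u w] /= E] : coprimep f phi.
  rewrite /coprimep; apply/contraT => /irr/(_ (dvdp_gcdr _ _)) gphi.
  have := dvdp_leq f0 (dvdp_gcdl f phi).
  by rewrite (eqp_size gphi) leqNgt sf.
have uE := divp_eq u phi; set q := u %/ phi in uE; set g := u %% phi in uE.
have E' : f * g = (- w - f * q) * phi + 1.
  by rewrite -E uE; ring.
exists g, (- w - f * q); split=> //; last by rewrite ltn_modp.
apply/eqP => g0; move: E'; rewrite g0 mulr0 => /esym/eqP; rewrite addr_eq0 => /eqP W.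
have : phi %| 1 by rewrite -[1]opprK -W -mulNr dvdp_mull.
by move/(dvdp_leq (oner_neq0 _)); rewrite size_poly1 leqNgt KP_size.
Qed.

(** [KP_div] applied to each digit in turn: mu(g) is at most the value of every term of the
    phi-expansion. *)
Lemma KP_expansion_filt a g e : is_expansion phi g e -> filt a g ->
  forall s, filt a (e`_s * phi ^+ s).
Proof.
move=> ge; have gE : g = e.[phi] by case: ge.
rewrite gE in ge *; move: ge a; elim/poly_ind: {g gE} e => [|e r IH] ee a.
  by move=> _ s; rewrite coef0 mul0r; left.
have [ee' sr] := expansion_consP ee; rewrite hornerMXaddC => /(KP_div sr)[ar aq].
have ae : filt (a - pval phi) e.[phi].
  have [->|e0] := eqVneq e.[phi] 0; [by left|right].
  case: aq => [/eqP|]; first by rewrite mulf_eq0 (negPf e0) (negPf phi0).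
  by rewrite pvalM // lerBlDr.
move=> [|s]; rewrite coefD coefMX coefC /=; first by rewrite add0r mulr1.
rewrite addr0 exprSr mulrA -[a](subrK (pval phi)); apply: filtM; first exact: IH.
exact: filt_pval.
Qed.

End KeyPolynomials.

(** * Valuations above a key polynomial *)

Section AboveKeyPolynomial.
Variables (K : fieldType) (v : K -> int) (mu mu' : valuation v).
Hypothesis le_mu : forall g : {poly K}, g != 0 -> pval mu g <= pval mu' g.
Implicit Types (f g q r : {poly K}) (a b : rat).

Lemma filt_mono a g : filt mu a g -> filt mu' a g.
Proof.
have [->|g0] := eqVneq g 0; first by left.
by move=> /(filtE _ _ g0) ag; apply/(filtE _ _ g0)/(le_trans ag)/le_mu.
Qed.

Lemma filtp_mono a g : filtp mu a g -> filtp mu' a g.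
Proof.
have [->|g0] := eqVneq g 0; first by left.
by move=> /(filtpE _ _ g0) ag; apply/(filtpE _ _ g0)/(lt_le_trans ag)/le_mu.
Qed.

Lemma comp_gr_map b (c : gr mu) :
  comp b (gr_map mu' c) = grclass mu' b (hcoef (repr c) b).
Proof.
rewrite /gr_map /hcoef comp_sum big_seq [in RHS]big_seq_cond.
rewrite (eq_bigr (fun p => if p.1 == b then grclass mu' p.1 p.2 else 0)); last first.
  by move=> p /hsumP/filt_mono pf; rewrite comp_grclass.
rewrite -big_mkcondr (eq_bigr (fun p => grclass mu' b p.2)); last first.
  by move=> p /andP[_ /eqP ->].
have [|_ ->] := @grclass_sum _ _ mu' b _ (hseq (repr c))
  (fun p => (p \in hseq (repr c)) && (p.1 == b)) (fun p => p.2) => //.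
by move=> p /andP[/hsumP/filt_mono ? /eqP <-].
Qed.

(** [gr_map] uses a chosen representative; it differs from g by an element of P_a^+ for mu, which
    stays in P_a^+ for the larger mu'. *)
Lemma gr_map_grclass a g : filt mu a g -> gr_map mu' (grclass mu a g) = grclass mu' a g.
Proof.
move=> ag; apply: comp_ext => b; rewrite comp_gr_map comp_grclass; last exact: filt_mono.
have /asboolP/(_ b) := heq_repr (hmono mu a g); rewrite hcoef_mono // => H.
transitivity (grclass mu' b (if a == b then g else 0)).
  apply/esym/grclass_eq; last exact: filtp_mono.
    by case: eqP => [<-|_]; [apply: filt_mono|left].
  exact/filt_mono/filt_hcoef.
by case: eqP => [->|_] //; rewrite grclass0.
Qed.

Variable phi : {poly K}.
Hypotheses (phiKP : KP mu phi) (lt_phi : pval mu phi < pval mu' phi).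

Let phi0 : phi != 0. Proof. exact: monic_neq0 (KP_monic phiKP). Qed.

(** Multiples of phi gain value strictly from mu to mu', so their classes die under Gr(mu) ->
    Gr(mu'). *)
Lemma above_mulphi a q : filt mu a (q * phi) -> filtp mu' a (q * phi).
Proof.
have [->|q0] := eqVneq q 0; first by rewrite mul0r; left.
have qp0 : q * phi != 0 by rewrite mulf_neq0.
move=> /(filtE _ _ qp0) aq; apply/(filtpE _ _ qp0)/(le_lt_trans aq).
by rewrite !pvalM // ler_ltD // le_mu.
Qed.

(** An inverse g of f modulo phi gives f g = q phi + 1 with q phi of positive mu'-value, whence
    H'(f) H'(g) = 1. Both valuations of f g are then 0, and mu <= mu' on each factor forces
    equality. *)
Lemma above_small f : f != 0 -> (size f < size phi)%N ->
  pval mu' f = pval mu f /\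
  exists g, [/\ g != 0, (size g < size phi)%N & Hmu mu' f * Hmu mu' g = 1].
Proof.
move=> f0 sf; have [g [q [g0 sg E]]] := KP_bezout phiKP f0 sf.
have [|_ ] := KP_mod phiKP f0 g0 (KP_min phiKP f0 sf) (KP_min phiKP g0 sg) _ E.
  by rewrite size_poly1; apply: KP_size phiKP.
rewrite pval1 => fg0; move=> /above_mulphi qp.
have P : filtp mu' (pval mu' 1) (1 - f * g).
  by rewrite pval1 E opprD addrCA subrr addr0; apply/filtpN; rewrite fg0.
have [fg' pE] := pval_eq (oner_neq0 _) P.
split.
  have := le_mu f0; have := le_mu g0; move: fg0 pE; rewrite !pvalM // pval1.
  lra.
exists g; split=> //; rewrite -HmuM -Hmu1; by apply/esym/Hmu_eq; rewrite ?oner_neq0.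
Qed.

(** When phi does not divide f, the remainder of f modulo phi carries the value, and in Gr(mu') also
    the class, of f. *)
Lemma above_mod f : f != 0 -> ~ mu_dvd mu phi f -> exists r,
  [/\ r != 0, (size r < size phi)%N, pval mu' r = pval mu f,
      Hmu mu' f = Hmu mu' r & pval mu' f = pval mu f].
Proof.
move=> f0 nf; have E : f * 1 = (f %/ phi) * phi + f %% phi by rewrite mulr1 {1}(divp_eq f phi).
have n1 : ~ mu_dvd mu phi 1 by rewrite /mu_dvd Hmu1; apply: KP_nunit phiKP.
have sr : (size (f %% phi)%R < size phi)%N by rewrite ltn_modp.
have [r0 rE qf] := KP_mod phiKP f0 (oner_neq0 _) nf n1 sr E.
have [rE' _] := above_small r0 sr; rewrite mulr1 in E rE qf.
have rf : filtp mu' (pval mu' (f %% phi)) (f %% phi - f).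
  by rewrite rE' rE {3}E opprD addrCA subrr addr0; apply/filtpN/above_mulphi.
exists (f %% phi); split=> //; first by rewrite rE'.
  by apply/esym/Hmu_eq.
by have [_ ->] := pval_eq r0 rf; rewrite rE'.
Qed.

End AboveKeyPolynomial.

(** The properties shared by (mu_0, x) and by every (mu_i, phi_i), i > 0, on
    which the structure of the graded algebra rests. *)
Record level (K : fieldType) (v : K -> int) (mu : valuation v) (phi : {poly K}) : Prop := {
  lv_monic : phi \is monic;
  lv_size : (1 < size phi)%N;
  lv_filt : forall g a M, is_expansion phi g a -> filt mu M g ->
    forall s, filt mu M (a`_s * phi ^+ s);
  lv_mul : forall f g : {poly K}, f != 0 -> g != 0 ->
    (size f < size phi)%N -> (size g < size phi)%N ->
    exists r : {poly K}, [/\ r != 0, (size r < size phi)%N & Hmu mu f * Hmu mu g = Hmu mu r];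
  lv_inv : forall f : {poly K}, f != 0 -> (size f < size phi)%N ->
    exists g : {poly K}, [/\ g != 0, (size g < size phi)%N & Hmu mu f * Hmu mu g = 1] }.

Section Level.
Variables (K : fieldType) (v : K -> int) (mu : valuation v) (phi : {poly K}).
Hypothesis lv : level mu phi.
Implicit Types (f g q r : {poly K}) (a b M : rat) (c d : gr mu) (G : {poly gr mu}).
Local Notation pval := (pval mu).
Local Notation filt := (filt mu).
Local Notation filtp := (filtp mu).
Local Notation grclass := (grclass mu).
Local Notation Hmu := (Hmu mu).

Let phi0 : phi != 0. Proof. exact: monic_neq0 (lv_monic lv). Qed.
Let sphi := lv_size lv.
Let phi_monic := lv_monic lv.

(** For [a = 0] this is the field F_i. *)
Definition small a c : Prop :=
  exists f, [/\ (size f < size phi)%N, filt a f & c = grclass a f].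

Lemma small0 a : small a 0.
Proof. by exists 0; split; [rewrite size_poly0 ltnW|left|rewrite grclass0]. Qed.

Lemma small1 : small 0 1.
Proof. by exists 1; split; [rewrite size_poly1|right; rewrite pval1|rewrite grclass1]. Qed.

Lemma smallB a c d : small a c -> small a d -> small a (c - d).
Proof.
move=> [f [sf af ->]] [g [sg ag ->]]; exists (f - g); split.
- by rewrite (leq_ltn_trans (size_polyD _ _)) // gtn_max size_polyN sf.
- exact: filtB.
by rewrite grclassB.
Qed.

Lemma small_Hmu f : f != 0 -> (size f < size phi)%N -> small (pval f) (Hmu f).
Proof. by move=> f0 sf; exists f; split=> //; [exact: filt_pval|rewrite HmuE]. Qed.

Lemma small_homog a c : small a c -> c != 0 ->
  exists f, [/\ f != 0, (size f < size phi)%N, pval f = a & c = Hmu f].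
Proof. by move=> [f [sf af ->]] c0; exists f; have [] := grclass_homog af c0. Qed.

Lemma small_deg a b c : small a c -> small b c -> c != 0 -> a = b.
Proof.
move=> ac bc c0; have [f [f0 _ <- fE]] := small_homog ac c0.
have [g [g0 _ <- gE]] := small_homog bc c0.
by have [|_ ->] := @Hmu_pval _ _ mu f g f0; rewrite -?fE.
Qed.

Lemma smallM a b c d : small a c -> small b d -> small (a + b) (c * d).
Proof.
move=> ac bd; have [->|c0] := eqVneq c 0; first by rewrite mul0r; apply: small0.
have [->|d0] := eqVneq d 0; first by rewrite mulr0; apply: small0.
have [f [f0 sf <- ->]] := small_homog ac c0.
have [g [g0 sg <- ->]] := small_homog bd d0.
have [r [r0 sr E]] := lv_mul lv f0 g0 sf sg; rewrite E -pvalM //.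
have [|_ <-] := @Hmu_pval _ _ mu (f * g) r (mulf_neq0 f0 g0); first by rewrite HmuM.
exact: small_Hmu.
Qed.

Lemma smallV a c : small a c -> c != 0 -> c \is a GRing.unit /\ small (- a) c^-1.
Proof.
move=> ac c0; have [f [f0 sf fa ->]] := small_homog ac c0.
have [g [g0 sg E]] := lv_inv lv f0 sf.
have u : Hmu f \is a GRing.unit by apply/unitrPr; exists (Hmu g).
split=> //; have -> : (Hmu f)^-1 = Hmu g by rewrite -[LHS]mulr1 -E mulKr.
have [|_] := @Hmu_pval _ _ mu 1 (f * g) (oner_neq0 _); first by rewrite Hmu1 HmuM.
rewrite pval1 pvalM // fa => E'.
by rewrite (_ : - a = pval g); [apply: small_Hmu|lra].
Qed.

Lemma smallXn a c n : small a c -> small (n%:R * a) (c ^+ n).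
Proof.
move=> ac; elim: n => [|n IH]; first by rewrite mul0r; apply: small1.
by rewrite exprS -[n.+1]add1n natrD mulrDl mul1r; apply: smallM.
Qed.

Lemma smallXz a c (z : int) : small a c -> c != 0 -> small (z%:~R * a) (c ^ z).
Proof.
move=> ac c0; case: z => n; first by apply: smallXn.
have [u ac'] := smallV ac c0.
rewrite NegzE -exprz_inv mulrNz mulNr -mulrN; exact: smallXn.
Qed.

Lemma small_unit_neq0 c : c \is a GRing.unit -> c != 0.
Proof. by move=> u; apply: contraTneq u => ->; rewrite unitr0. Qed.

Lemma lv_filtp g e M : is_expansion phi g e -> filtp M g ->
  forall s, filtp M (e`_s * phi ^+ s).
Proof.
move=> ge [g0|Mg] s; last by apply: filt_lt Mg _; apply: (lv_filt lv) ge (filt_pval _ _) s.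
have -> : e = 0; last by rewrite coef0 mul0r; left.
apply/eqP; apply: contraT => e0.
by have := expansion_neq0 phi_monic sphi ge e0; rewrite g0 eqxx.
Qed.

Lemma filt_divX M j f : filt M (f * phi ^+ j) <-> filt (M - j%:R * pval phi) f.
Proof.
have [->|f0] := eqVneq f 0; first by rewrite mul0r; split=> _; left.
by rewrite !filtE ?mulf_neq0 ?expf_neq0 // pvalM ?expf_neq0 // pvalX // lerBlDr.
Qed.

Lemma filtp_divX M j f : filtp M (f * phi ^+ j) <-> filtp (M - j%:R * pval phi) f.
Proof.
have [->|f0] := eqVneq f 0; first by rewrite mul0r; split=> _; left.
by rewrite !filtpE ?mulf_neq0 ?expf_neq0 // pvalM ?expf_neq0 // pvalX // ltrBlDr.
Qed.

Lemma grclass_mulX M j f : filt (M - j%:R * pval phi) f ->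
  grclass M (f * phi ^+ j) = grclass (M - j%:R * pval phi) f * Hmu phi ^+ j.
Proof.
move=> fM; rewrite HmuE // -grclassX -?grclassM ?subrK //; try exact: filt_pval.
exact/filtX/filt_pval.
Qed.

(** The j-th coefficient has degree M - j mu(phi), so that the value of G at H(phi) is homogeneous
    of degree M. *)
Definition graded M G : Prop := forall j, small (M - j%:R * pval phi) G`_j.

(** Coefficients are lifted to digits. A coefficient 1 must have degree 0 and is lifted to the
    polynomial 1, so that G with lead coefficient 1 lifts to a monic polynomial; this is how monic
    key polynomials arise. The lift has value exactly M because values are read off its digits. *)
Lemma graded_repr M G : graded M G -> exists g,
  [/\ filt M g, grclass M g = G.[Hmu phi], G != 0 -> ~ filtp M g &
      lead_coef G = 1 -> g \is monic /\ size g = ((size G).-1 * (size phi).-1).+1].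
Proof.
move=> MG; have [d dP] : exists d : nat -> {poly K}, forall j,
    [/\ (size (d j) < size phi)%N, filt (M - j%:R * pval phi) (d j),
      G`_j = grclass (M - j%:R * pval phi) (d j) & G`_j = 1 -> d j = 1].
  have [j|d dP] := @choice _ _ (fun (j : nat) (dj : {poly K}) =>
    [/\ (size dj < size phi)%N, filt (M - j%:R * pval phi) dj,
      G`_j = grclass (M - j%:R * pval phi) dj & G`_j = 1 -> dj = 1]); last by exists d.
  have [G1|G1] := eqVneq G`_j 1.
    have D := small_deg (MG j); rewrite G1 in D; have {D}-> := D _ small1 (oner_neq0 _).
    by exists 1; split; rewrite ?size_poly1 ?G1 //; right; rewrite pval1.
  by have [f [sf ff fE]] := MG j; exists f; split=> // /eqP; rewrite (negPf G1).
pose e := \poly_(j < size G) d j.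
have ge : is_expansion phi e.[phi] e.
  split=> // s; rewrite coef_poly; case: ifP => _; first by case: (dP s).
  by rewrite size_poly0 ltnW.
have gE : e.[phi] = \sum_(j < size G) d j * phi ^+ j.
  rewrite (horner_coef_wide _ (size_poly _ _)); apply: eq_bigr => j _.
  by rewrite coef_poly ltn_ord.
have [|gM E] := @grclass_sum _ _ mu M _ (index_enum 'I_(size G)) predT
  (fun j => d (val j) * phi ^+ val j).
  by move=> j _; apply/filt_divX; case: (dP j).
exists e.[phi]; split.
- by rewrite gE.
- rewrite gE E horner_coef; apply: eq_bigr => j _.
  by case: (dP j) => _ dj -> _; rewrite grclass_mulX.
- move=> G0 /(lv_filtp ge)/(_ (size G).-1)/filtp_divX; rewrite coef_poly.
  have -> : ((size G).-1 < size G)%N by move: G0; rewrite -size_poly_gt0; lia.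
  case: (dP (size G).-1) => _ dn dE _ /(grclass_eq0 dn).
  by rewrite -dE -lead_coefE => /eqP; rewrite lead_coef_eq0 (negPf G0).
move=> G1; have G0 : G != 0 by rewrite -lead_coef_eq0 G1 oner_neq0.
have sG : size G = (size G).-1.+1 by move: G0; rewrite -size_poly_gt0; lia.
have d1 : d (size G).-1 = 1 by case: (dP (size G).-1) => _ _ _; apply.
have el : e`_(size G).-1 = 1 by rewrite coef_poly d1 -sG leqnn.
have se : size e = size G.
  apply/eqP; rewrite eqn_leq size_poly /= leqNgt; apply/negP => se.
  move: el; rewrite nth_default; first by move/esym/eqP; rewrite oner_eq0.
  by rewrite -ltnS -sG.
have [|_ lE ->] := expansion_size phi_monic sphi ge.
  by rewrite -size_poly_gt0 se sG.
have lce : lead_coef e = 1 by rewrite lead_coefE se.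
by rewrite monicE lE lce lead_coef1 size_poly1 se.
Qed.

Lemma graded_of M g e : is_expansion phi g e -> filt M g -> exists G,
  [/\ graded M G, grclass M g = G.[Hmu phi], (size G <= size e)%N &
    forall j, G`_j = grclass (M - j%:R * pval phi) e`_j].
Proof.
move=> ge gM; have eM s : filt (M - s%:R * pval phi) e`_s.
  exact/filt_divX/(lv_filt lv ge gM).
exists (\poly_(j < size e) grclass (M - j%:R * pval phi) e`_j).
have cE j : (\poly_(j < size e) grclass (M - j%:R * pval phi) e`_j)`_j
    = grclass (M - j%:R * pval phi) e`_j.
  rewrite coef_poly; case: ltnP => // ej.
  by rewrite nth_default // grclass0.
split=> //.
  by move=> j; rewrite cE; exists e`_j; split=> //; case: ge.
case: (ge) => -> _; rewrite horner_coef.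
have [|_ ->] := @grclass_sum _ _ mu M _ (index_enum 'I_(size e)) predT
  (fun j => e`_(val j) * phi ^+ val j).
  by move=> j _; apply/filt_divX.
rewrite (horner_coef_wide _ (size_poly _ _)); apply: eq_bigr => j _.
by rewrite grclass_mulX // cE.
Qed.

End Level.

(** * Normal forms of homogeneous elements *)

(** The numerical data of a level: [p] and [x = H(phi) p^-V] are the elements
    p_i and x_i, [em] is e(mu_(i-1)), and [e], [h], [nu] are e_i, h_i, nu_i. *)
Record level_data (K : fieldType) (v : K -> int) (mu : valuation v) (phi : {poly K})
    (p : gr mu) (em e : nat) (V h : int) (nu : rat) : Prop := {
  ld_em : (0 < em)%N;
  ld_e : (0 < e)%N;
  ld_p : small phi em%:R^-1 p;
  ld_p0 : p != 0;
  ld_phi : pval mu phi = V%:~R / em%:R + nu;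
  ld_nu : e%:R * nu = h%:~R / em%:R;
  ld_min : forall k : int, em%:R * (k%:~R * nu) \is a Num.int -> (e %| k)%Z;
  ld_int : forall a (c : gr mu), small phi a c -> c != 0 -> em%:R * a \is a Num.int }.

Section LevelData.
Variables (K : fieldType) (v : K -> int) (mu : valuation v) (phi : {poly K}).
Variables (p : gr mu) (em e : nat) (V h : int) (nu : rat).
Hypotheses (lv : level mu phi) (ld : level_data phi p em e V h nu).
Implicit Types (f g q r : {poly K}) (a b M : rat) (c d : gr mu) (G R : {poly gr mu}).
Local Notation pval := (pval mu).
Local Notation filt := (filt mu).
Local Notation filtp := (filtp mu).
Local Notation grclass := (grclass mu).
Local Notation Hmu := (Hmu mu).

Definition ld_x : gr mu := Hmu phi * p ^ (- V).
Definition ld_y : gr mu := ld_x ^+ e * p ^ (- h).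
Local Notation x := ld_x.
Local Notation y := ld_y.
Local Notation S := (small phi 0 : set (gr mu)).
(** The degree of x^s p^u: x has degree nu, p has degree 1/em, and y has degree 0. *)
Definition nf_deg (s : nat) (u : int) : rat := s%:R * nu + u%:~R / em%:R.

Let em0 : em%:R != 0 :> rat.
Proof. by rewrite pnatr_eq0 -lt0n (ld_em ld). Qed.

Let pu : p \is a GRing.unit.
Proof. by have [] := smallV lv (ld_p ld) (ld_p0 ld). Qed.

Let small_p (z : int) : small phi (z%:~R / em%:R) (p ^ z).
Proof. exact: (smallXz lv z (ld_p ld) (ld_p0 ld)). Qed.

Let pD m n : p ^ (m + n) = p ^ m * p ^ n. Proof. exact: exprzDr. Qed.

Lemma ld_phiE : Hmu phi = x * p ^ V.
Proof. by rewrite /x -mulrA -pD addNr expr0z mulr1. Qed.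

Lemma ld_xe : x ^+ e = y * p ^ h.
Proof. by rewrite /y -mulrA -pD addNr expr0z mulr1. Qed.

Lemma ld_xek k : x ^+ (e * k) = y ^+ k * p ^ (h * k%:Z).
Proof. by rewrite exprM ld_xe exprMn -exprz_exp. Qed.

Lemma S_1 : S 1. Proof. exact: small1 lv. Qed.
Lemma S_B c d : S c -> S d -> S (c - d). Proof. exact: smallB. Qed.
Lemma S_M c d : S c -> S d -> S (c * d).
Proof. by move=> Sc Sd; have := smallM lv Sc Sd; rewrite addr0. Qed.
Lemma S_V c : S c -> c != 0 -> exists2 d, S d & d * c = 1.
Proof.
move=> Sc c0; have [u Sv] := smallV lv Sc c0; exists c^-1; last exact: mulVr.
by rewrite oppr0 in Sv.
Qed.

(** For j = s + e k one has H(phi)^j = x^s y^k p^(V j + h k). After p^u is taken out, the power p^z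
    left over brings the coefficient of index j to degree 0, that is, into F. *)
Lemma nf_of_graded M G s u : graded phi M G -> M = nf_deg s u ->
  (forall j, G`_j != 0 -> exists k, j = (s + e * k)%N) ->
  exists R, [/\ poly_in S R, G.[Hmu phi] = x ^+ s * p ^ u * R.[y] &
    forall k, R`_k != 0 -> (s + e * k < size G)%N].
Proof.
move=> MG ME Gs; rewrite horner_coef.
apply: (big_ind (fun c => exists R, [/\ poly_in S R, c = x ^+ s * p ^ u * R.[y] &
    forall k, R`_k != 0 -> (s + e * k < size G)%N])).
- exists 0; split; first exact: poly_in0 S_1 S_B.
    by rewrite horner0 mulr0.
  by move=> k; rewrite coef0 eqxx.
- move=> c d [R [SR -> sR]] [R' [SR' -> sR']]; exists (R + R'); split.
  + exact: poly_inD S_1 S_B _ _ SR SR'.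
  + by rewrite hornerD mulrDr.
  move=> k; rewrite coefD; have [->|/sR //] := eqVneq R`_k 0.
  by rewrite add0r => /sR'.
move=> [j jG] _ /=; have [Gj0|Gj] := eqVneq G`_j 0.
  exists 0; split; first exact: poly_in0 S_1 S_B.
    by rewrite Gj0 mul0r horner0 mulr0.
  by move=> k; rewrite coef0 eqxx.
have [k jE] := Gs _ Gj.
have [z zE] : exists z, z = V * j%:Z + h * k%:Z - u by exists (V * j%:Z + h * k%:Z - u).
have Sc : S (G`_j * p ^ z).
  have := smallM lv (MG j) (small_p z).
  suff -> : M - j%:R * pval phi + z%:~R / em%:R = 0 by [].
  rewrite ME (ld_phi ld) zE /nf_deg jE natrD natrM !(rmorphD, rmorphM, rmorphN, rmorphB) /=.
  have := ld_nu ld; rewrite !pmulrn => nuE.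
  transitivity (- k%:R * (e%:R * nu - h%:~R / em%:R) : rat); last by rewrite nuE; ring.
  by field.
exists ((G`_j * p ^ z)%:P * 'X^k); split.
- by apply: poly_inM S_1 S_B S_M _ _ (poly_inC S_1 S_B Sc) (poly_inXn S_1 S_B k).
- rewrite hornerM hornerC hornerXn.
  rewrite ld_phiE exprMn.
  have -> : (p ^ V) ^+ j = p ^ (V * j%:Z) by rewrite exprnP exprz_exp.
  have -> : x ^+ j = x ^+ s * (y ^+ k * p ^ (h * k%:Z)) by rewrite jE exprD ld_xek.
  have -> : V * j = u + (z - h * k%:Z) by rewrite zE; ring.
  rewrite !pD; have -> : p ^ (h * k%:Z) = (p ^ (- (h * k%:Z)))^-1.
    by rewrite invr_expz opprK.
  have pU : p ^ (- (h * k%:Z)) \is a GRing.unit by rewrite unitrXz.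
  transitivity (G`_j * (x ^+ s * y ^+ k * (p ^ u * p ^ z)) *
    ((p ^ (- (h * k%:Z)))^-1 * p ^ (- (h * k%:Z)))); first ring.
  by rewrite mulVr // mulr1; ring.
move=> l; rewrite coefCM coefXn; have [->|_] := eqVneq l k; first by rewrite -jE.
by rewrite mulr0 eqxx.
Qed.

(** The same identity read backwards: ['X] is replaced by ['X^e], shifted by s, and each coefficient
    absorbs the power of the unit p that its degree requires. *)
Lemma graded_of_nf R s u : poly_in S R ->
  exists G, [/\ graded phi (nf_deg s u) G, G.[Hmu phi] = x ^+ s * p ^ u * R.[y],
    forall k, G`_(s + e * k) = R`_k * p ^ (u - V * (s + e * k)%N%:Z - h * k%:Z) &
    forall j, G`_j != 0 -> exists k, j = (s + e * k)%N].
Proof.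
move=> SR; pose w k := u - V * (s + e * k)%N%:Z - h * k%:Z.
pose A := \poly_(k < size R) (R`_k * p ^ w k).
have AE k : A`_k = R`_k * p ^ w k.
  by rewrite coef_poly; case: ltnP => // sk; rewrite nth_default // mul0r.
pose G := (A \Po 'X^e) * 'X^s.
have GE k : G`_(s + e * k) = A`_k.
  by rewrite coefMXn ltnNge leq_addr /= addKn coef_comp_poly_Xn ?(ld_e ld) // dvdn_mulr // mulKn ?(ld_e ld).
have G0 j : G`_j != 0 -> exists k, j = (s + e * k)%N.
  rewrite coefMXn; case: ltnP => [_|sj]; first by rewrite eqxx.
  rewrite coef_comp_poly_Xn ?(ld_e ld) //; case: ifP => [/dvdnP[k jE] _|_]; last by rewrite eqxx.
  by exists k; rewrite mulnC -jE subnKC.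
exists G; split=> //; last by move=> k; rewrite GE AE.
  move=> j; have [->|Gj] := eqVneq G`_j 0; first exact: small0 lv _.
  have [k jE] := G0 _ Gj; rewrite jE GE AE.
  have := smallM lv (SR k) (small_p (w k)); rewrite add0r.
  suff -> : (w k)%:~R / em%:R = nf_deg s u - (s + e * k)%N%:R * pval phi by [].
  rewrite (ld_phi ld) /w /nf_deg natrD natrM !(rmorphD, rmorphM, rmorphN, rmorphB) /=.
  have := ld_nu ld; rewrite !pmulrn => nuE.
  apply/eqP; rewrite -subr_eq0; apply/eqP.
  transitivity (k%:R * (e%:R * nu - h%:~R / em%:R) : rat); last by rewrite nuE; ring.
  by rewrite /intmul /=; field.
rewrite hornerM hornerXn horner_comp hornerXn.
rewrite (horner_coef_wide _ (size_poly _ _)) (horner_coef R) mulr_suml mulr_sumr.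
apply: eq_bigr => -[k kR] _ /=; rewrite AE.
have -> : x ^+ s * p ^ u * (R`_k * y ^+ k) = R`_k * (x ^+ s * p ^ u * y ^+ k) by ring.
rewrite -!mulrA; congr (_ * _).
rewrite -exprM -exprD addnC ld_phiE exprMn.
have -> : (p ^ V) ^+ (s + e * k) = p ^ (V * (s + e * k)%N%:Z).
  by rewrite exprnP exprz_exp.
have -> : x ^+ (s + e * k) = x ^+ s * (y ^+ k * p ^ (h * k%:Z)) by rewrite exprD ld_xek.
have -> : w k = (u + - (h * k%:Z)) + (- (V * (s + e * k)%N%:Z)) by rewrite /w; ring.
rewrite !pD.
set P := p ^ (V * _); have PU : P \is a GRing.unit by rewrite unitrXz.
set Q := p ^ (h * k%:Z); have QU : Q \is a GRing.unit by rewrite unitrXz.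
have -> : p ^ (- (V * (s + e * k)%N%:Z)) = P^-1 by rewrite /P invr_expz.
have -> : p ^ (- (h * k%:Z)) = Q^-1 by rewrite /Q invr_expz.
transitivity (x ^+ s * p ^ u * y ^+ k * (Q * Q^-1) * (P * P^-1)); first ring.
by rewrite !mulrV // !mulr1; ring.
Qed.

End LevelData.

Section NormalForms.
Variables (K : fieldType) (v : K -> int) (mu : valuation v) (phi : {poly K}).
Variables (p : gr mu) (em e : nat) (V h : int) (nu : rat).
Hypotheses (lv : level mu phi) (ld : level_data phi p em e V h nu).
Implicit Types (f g q r : {poly K}) (a b M : rat) (c d : gr mu) (G R : {poly gr mu}).
Local Notation pval := (pval mu).
Local Notation filt := (filt mu).
Local Notation filtp := (filtp mu).
Local Notation grclass := (grclass mu).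
Local Notation Hmu := (Hmu mu).
Local Notation x := (ld_x phi p V).
Local Notation y := (ld_y phi p e V h).
Local Notation S := (small phi 0 : set (gr mu)).
Local Notation nf_deg := (nf_deg em nu).

Let em0 : em%:R != 0 :> rat.
Proof. by rewrite pnatr_eq0 -lt0n (ld_em ld). Qed.

Let pu : p \is a GRing.unit.
Proof. by have [] := smallV lv (ld_p ld) (ld_p0 ld). Qed.

Let S1 := S_1 lv.
Let SB c d : S c -> S d -> S (c - d). Proof. exact: S_B. Qed.
Let SM := S_M lv.
Let SV := S_V lv.

Lemma nf_homog R s u : poly_in S R -> R != 0 ->
  exists g, [/\ g != 0, pval g = nf_deg s u & Hmu g = x ^+ s * p ^ u * R.[y] ].
Proof.
move=> SR R0; have [G [MG <- GE _]] := graded_of_nf lv ld s u SR.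
have G0 : G != 0.
  have := GE (size R).-1; rewrite -lead_coefE; apply: contra_eqN => /eqP ->.
  rewrite coef0 eq_sym; apply: small_unit_neq0 => //.
  have l0 : lead_coef R != 0 by rewrite lead_coef_eq0.
  by rewrite unitrM unitrXz //; have [->] := smallV lv (SR _ : small _ _ (lead_coef R)) l0.
have [g [gM gE /(_ G0) np _]] := graded_repr lv MG.
have [g0 gv] := filt_exact gM np; exists g; split=> //.
by rewrite -gE grclass_Hmu.
Qed.

(** This is the transcendence of y over F: a nonzero R lifts to a polynomial of exact value, whose
    class cannot vanish. *)
Lemma nf_neq0 R s u : poly_in S R -> R != 0 -> x ^+ s * p ^ u * R.[y] != 0.
Proof. by move=> SR R0; have [g [g0 _ <-]] := nf_homog s u SR R0; apply: Hmu_neq0. Qed.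

(** Equal degrees put (s - s') nu in (1/em) Z, and e is the order of nu modulo that group. *)
Lemma nf_deg_inj s u s' u' : (s < e)%N -> (s' < e)%N -> nf_deg s u = nf_deg s' u' ->
  s = s' /\ u = u'.
Proof.
move=> se se' E; have s_s' : s = s'.
  have : (e %| s%:Z - s'%:Z)%Z.
    apply: (ld_min ld); have -> : em%:R * ((s%:Z - s'%:Z)%:~R * nu) = (u' - u)%:~R :> rat.
      move: E; rewrite /nf_deg !rmorphB /= -!pmulrn => E.
      have := congr1 ( *%R em%:R) E.
      by rewrite !mulrDr ![em%:R * (_ / _)]mulrCA divff // !mulr1 => E'; lra.
    exact: intr_int.
  by rewrite -eqz_mod_dvd !modz_nat !modn_small // => /eqP[].
split=> //; move: E; rewrite /nf_deg s_s' => /addrI/(congr1 ( *%R^~ em%:R)).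
by rewrite !divfK // => /intr_inj.
Qed.

Lemma nf_shift R s k u :
  x ^+ (s + e * k) * p ^ u * R.[y] = x ^+ s * p ^ (u + h * k%:Z) * ('X^k * R).[y].
Proof.
rewrite exprD (ld_xek lv ld) hornerM hornerXn (exprzDr pu); ring.
Qed.

Lemma nf_uniq R R' s s' u u' : poly_in S R -> poly_in S R' -> (s < e)%N -> (s' < e)%N ->
  R != 0 -> x ^+ s * p ^ u * R.[y] = x ^+ s' * p ^ u' * R'.[y] -> R = R'.
Proof.
move=> SR SR' se se' R0 E.
have [R'0|R'0] := eqVneq R' 0.
  by have /negP[] := nf_neq0 s u SR R0; rewrite E R'0 horner0 mulr0.
have [g [g0 gv gE]] := nf_homog s u SR R0; have [g' [g'0 gv' gE']] := nf_homog s' u' SR' R'0.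
have [|_] := @Hmu_pval _ _ mu g g' g0; first by rewrite gE gE'.
rewrite gv gv' => /esym/(nf_deg_inj se se')[ss' uu']; subst s' u'.
apply/eqP; rewrite -subr_eq0; apply: contraT => D.
have /negP[] := nf_neq0 s u (poly_inB SB SR SR') D.
by rewrite hornerD hornerN mulrBr E subrr.
Qed.

(** Nonzero coefficients have degrees in (1/em) Z, so (k - j) nu lies there too: the support of G is
    contained in one residue class modulo e. *)
Lemma pval_coef_int M G j k : graded phi M G -> G`_j != 0 -> G`_k != 0 ->
  (e %| k%:Z - j%:Z)%Z.
Proof.
move=> MG /(ld_int ld (MG j)) Ij /(ld_int ld (MG k)) Ik; apply: (ld_min ld).
have -> : em%:R * ((k%:Z - j%:Z)%:~R * nu) = (em%:R * (M - j%:R * pval phi)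
  - em%:R * (M - k%:R * pval phi)) - ((k%:Z - j%:Z) * V)%:~R.
  by rewrite (ld_phi ld) rmorphM !rmorphB /= -!pmulrn; field.
by rewrite !rpredB // intr_int.
Qed.

Lemma nf_deg_exists M G j : graded phi M G -> G`_j != 0 ->
  forall s k, j = (s + e * k)%N -> exists u, M = nf_deg s u.
Proof.
move=> MG /(ld_int ld (MG j))/intrP[z zE] s k jE.
exists (z + j%:Z * V + h * k%:Z); rewrite /nf_deg.
move: zE; rewrite (ld_phi ld) jE !(rmorphD, rmorphM) /= -!pmulrn ?natrD ?natrM => zE.
have nuE := ld_nu ld.
have -> : z%:~R = em%:R * (M - (s%:R + e%:R * k%:R) * (V%:~R / em%:R + nu)) by rewrite zE.
transitivity (M + k%:R * (h%:~R / em%:R - e%:R * nu)); first by rewrite nuE; ring.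
by field.
Qed.

(** The exponent s is the residue modulo e of the support of G. The last clause, a lower bound for
    deg g in terms of deg R, serves the minimality of representatives. *)
Lemma nf_exists g : g != 0 -> exists s u R,
  [/\ (s < e)%N, pval g = nf_deg s u, poly_in S R & R != 0] /\
  Hmu g = x ^+ s * p ^ u * R.[y] /\
  (forall n, (n < size R)%N -> ((s + e * n) * (size phi).-1 < size g)%N).
Proof.
move=> g0; have [a ga] := expansion_exists (lv_monic lv) (lv_size lv) g.
have [G [MG gE sG GE]] := graded_of lv ga (filt_pval mu g).
have G0 : G != 0.
  by apply: contra_neq (Hmu_neq0 mu g0) => G0; rewrite HmuE // gE G0 horner0.
set j := (size G).-1; have Gj : G`_j != 0 by rewrite -lead_coefE lead_coef_eq0.
have jE : j = (j %% e + e * (j %/ e))%N by rewrite addnC mulnC -divn_eq.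
have [u uE] := nf_deg_exists MG Gj jE.
have [|R [SR RE Rs]] := nf_of_graded lv ld MG uE.
  move=> k Gk; exists (k %/ e)%N.
  have := pval_coef_int MG Gj Gk; rewrite -eqz_mod_dvd => /eqP.
  rewrite !modz_nat => -[<-].
  by rewrite addnC mulnC -divn_eq.
have R0 : R != 0.
  by apply: contra_neq (Hmu_neq0 mu g0) => R0; rewrite HmuE // gE RE R0 horner0 mulr0.
exists (j %% e)%N, u, R; split; first by split=> //; rewrite ltn_mod (ld_e ld).
split; first by rewrite HmuE // gE RE.
move=> n nR; have lR : R`_(size R).-1 != 0 by rewrite -lead_coefE lead_coef_eq0.
have := Rs _ lR; set m := (_ + _)%N => mG.
have nm : (j %% e + e * n <= m)%N.
  by rewrite /m leq_add2l leq_mul2l; apply/orP; right; rewrite -ltnS (ltn_predK nR).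
have a0 : a != 0.
  by apply: contra_neq g0 => a0; case: ga => ->; rewrite a0 horner0.
have [_ _ ->] := expansion_size (lv_monic lv) (lv_size lv) ga a0.
have la : (0 < size (lead_coef a))%N by rewrite size_poly_gt0 lead_coef_eq0.
have ma : (j %% e + e * n <= (size a).-1)%N.
  by apply: leq_trans nm _; rewrite -ltnS (ltn_predK (leq_trans mG sG)) (leq_trans mG sG).
by rewrite -add1n leq_add // leq_mul2r ma orbT.
Qed.

(** Here s is the abscissa of the left end point and may exceed e. As the least abscissa where the
    value is attained, it makes all contributing ones of the form s + e k with k >= 0. *)
Lemma residual_form g (a : {poly {poly K}}) s u : g != 0 -> is_expansion phi g a ->
  pval g = nf_deg s u -> a`_s != 0 -> pval (a`_s * phi ^+ s) = pval g ->
  (forall j, (j < s)%N -> a`_j != 0 -> pval g < pval (a`_j * phi ^+ j)) ->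
  exists R, poly_in S R /\ Hmu g = x ^+ s * p ^ u * R.[y].
Proof.
move=> g0 ga gv as0 asv amin; have phi0 := monic_neq0 (lv_monic lv).
have [G [MG gE _ GE]] := graded_of lv ga (filt_pval mu g).
have filta j : filt (pval g - j%:R * pval phi) a`_j.
  exact/(filt_divX lv)/(lv_filt lv ga (filt_pval mu g)).
have [|R [SR RE _]] := nf_of_graded lv ld MG gv; last first.
  by exists R; split=> //; rewrite HmuE // gE RE.
have Gs : G`_s != 0.
  rewrite GE; apply/eqP => /(grclass_eq0 (filta s))/(filtp_divX lv).
  by rewrite -asv; apply: filtp_pval; rewrite mulf_neq0 ?expf_neq0.
move=> j Gj; have sj : (s <= j)%N.
  rewrite leqNgt; apply/negP => js.
  have aj : a`_j != 0 by apply: contra_neq Gj => aj; rewrite GE aj grclass0.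
  have := amin j js aj; rewrite -(filtpE mu (pval g)) ?mulf_neq0 ?expf_neq0 //.
  by move=> /(filtp_divX lv)/(grclass_eq0 (filta j)); rewrite -GE => /eqP; rewrite (negPf Gj).
have := pval_coef_int MG Gs Gj; rewrite subzn // dvdzE /= => /dvdnP[k jsk].
by exists k; rewrite mulnC -jsk subnKC.
Qed.

Variable psi : {poly gr mu}.
Hypotheses (Spsi : poly_in S psi) (psi_monic : psi \is monic) (spsi : (1 < size psi)%N)
  (psi_irr : forall P Q, poly_in S P -> poly_in S Q -> psi = P * Q -> size P = 1%N \/ size Q = 1%N).
Local Notation Z := psi.[y].

(** For [s > 0] a power of [y] has to be cancelled from [R], whence the
    condition on [psi]; at order 0, where psi_0 = y is allowed, [s = 0]. *)
Lemma nf_dvd g R s u n : g != 0 -> poly_in S R -> Hmu g = x ^+ s * p ^ u * R.[y] ->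
  s = 0%N \/ psi != 'X ->
  pdvd S (psi ^+ n) R <-> gr_dvd (Z ^+ n) (Hmu g).
Proof.
move=> g0 SR gE sX; split=> [[Q SQ RE]|].
  exists (x ^+ s * p ^ u * Q.[y]); rewrite gE RE hornerM horner_exp; ring.
have Spn : poly_in S (psi ^+ n) by apply: poly_inX.
have pn0 : psi ^+ n != 0 by rewrite monic_neq0 ?monic_exp.
have [w [w0 wv wE]] := nf_homog 0 0 Spn pn0.
have ZE : Z ^+ n = grclass 0 w.
  rewrite grclass_Hmu //; last by rewrite wv /nf_deg !mul0r addr0.
  by rewrite wE expr0 expr0z !mul1r horner_exp.
rewrite ZE => /(gr_dvd_comp (pval g))-/(_ _)[].
  by right; rewrite wv /nf_deg !mul0r addr0.
rewrite HmuE // comp_grclass ?eqxx; last exact: filt_pval.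
rewrite subr0 -ZE -HmuE // => q [qf qE].
have q0 : grclass (pval g) q != 0.
  by apply: contra_neq (Hmu_neq0 mu g0) => q0; rewrite qE q0 mulr0.
have [{q0}q0 _ qH] := grclass_homog qf q0.
have [s0 [u0 [B [[ss0 _ SB' B0] [BE _]]]]] := nf_exists q0.
rewrite qH BE gE in qE.
(* Uniqueness needs exponents of x below e, so the excess of s is turned into a power of y and moved
   into the polynomial, to be cancelled at the end. *)
have sE : s = (s %% e + e * (s %/ e))%N by rewrite addnC mulnC -divn_eq.
rewrite sE nf_shift mulrCA -horner_exp -hornerM in qE.
have R0 : R != 0.
  by apply: contra_neq (Hmu_neq0 mu g0) => R0; rewrite gE R0 horner0 mulr0.
have SXR : poly_in S ('X^(s %/ e) * R) by apply: poly_inM => //; apply: poly_inXn.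
have XR0 : 'X^(s %/ e) * R != 0.
  by apply: (poly_inM_neq0 SV) => //; [apply: poly_inXn|rewrite monic_neq0 ?monicXn].
have E := nf_uniq SXR (poly_inM S1 SB SM Spn SB') (ltn_pmod _ (ld_e ld)) ss0 XR0 qE.
have D : pdvd S (psi ^+ n) ('X^(s %/ e) * R) by exists B.
case: sX => [s00|psiX].
  by move: D; rewrite s00 div0n mul1r.
exact: (pdvd_mulXn S1 SB SM SV Spsi psi_monic psi_irr psiX SR D).
Qed.

Hypothesis psi_X : psi != 'X \/ e = 1%N.

Lemma nf_exists_prime f g : f != 0 -> g != 0 -> gr_dvd Z (Hmu f * Hmu g) ->
  gr_dvd Z (Hmu f) \/ gr_dvd Z (Hmu g).
Proof.
move=> f0 g0; have [s [u [A [[se _ SA _] [AE _]]]]] := nf_exists f0.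
have [s' [u' [B [[se' _ SB' _] [BE _]]]]] := nf_exists g0.
(* If psi may be y then e = 1, and s < e leaves only s = 0. *)
have sX : s = 0%N \/ psi != 'X by case: psi_X => [|e1]; [right|left; move: se; rewrite e1; case: (s)].
have sX' : s' = 0%N \/ psi != 'X by case: psi_X => [|e1]; [right|left; move: se'; rewrite e1; case: (s')].
have sX2 : (s + s')%N = 0%N \/ psi != 'X.
  by case: sX sX' => [->|?] [->|?]; [left|right|right|right].
have fgE : Hmu (f * g) = x ^+ (s + s') * p ^ (u + u') * (A * B).[y].
  by rewrite HmuM AE BE hornerM exprD (exprzDr pu); ring.
rewrite -HmuM -[X in gr_dvd X _]expr1.
rewrite -(nf_dvd 1 _ _ fgE) ?mulf_neq0 //; last exact: poly_inM.
rewrite expr1 => /(irr_prime S1 SB SM SV Spsi psi_monic psi_irr SA SB')[]; rewrite -[psi]expr1.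
  by move=> /(nf_dvd 1 f0 SA AE sX); rewrite expr1; left.
by move=> /(nf_dvd 1 g0 SB' BE sX'); rewrite expr1; right.
Qed.

End NormalForms.

(** * Key polynomials with a prescribed residual ideal *)

Section RepresentativeExists.
Variables (K : fieldType) (v : K -> int) (mu : valuation v) (phi : {poly K}).
Variables (p : gr mu) (em e : nat) (V h : int) (nu : rat).
Hypotheses (lv : level mu phi) (ld : level_data phi p em e V h nu).
Local Notation Hmu := (Hmu mu).
Local Notation y := (ld_y phi p e V h).
Local Notation S := (small phi 0 : set (gr mu)).
Variable psi : {poly gr mu}.
Hypotheses (Spsi : poly_in S psi) (psi_monic : psi \is monic) (spsi : (1 < size psi)%N)
  (psi_irr : forall P Q, poly_in S P -> poly_in S Q -> psi = P * Q -> size P = 1%N \/ size Q = 1%N)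
  (psi_X : psi != 'X \/ e = 1%N).
Local Notation Z := psi.[y].

Lemma psi_homog : exists2 w, filt mu 0 w & Z = grclass mu 0 w.
Proof.
have [w [w0 wv wE]] := nf_homog lv ld 0 0 Spsi (monic_neq0 psi_monic).
have w0' : pval mu w = 0 by rewrite wv /nf_deg !mul0r addr0.
exists w; first by rewrite -w0'; apply: filt_pval.
by rewrite grclass_Hmu // wE expr0 expr0z !mul1r.
Qed.

(** The residual polynomial of g is a nonzero multiple of psi, so it has degree at least n, and the
    degree bound in [nf_exists] applies. *)
Lemma psi_dvd_size g n : g != 0 -> (n < size psi)%N -> gr_dvd Z (Hmu g) ->
  (e * n * (size phi).-1 < size g)%N.
Proof.
move=> g0 nf Zg; have [s [u [B [[se _ SB' B0] [BE Bs]]]]] := nf_exists lv ld g0.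
have sX : s = 0%N \/ psi != 'X.
  by case: psi_X => [|e1]; [right|left; move: se; rewrite e1; case: (s)].
rewrite -[Z]expr1 in Zg; move: Zg.
move/(nf_dvd lv ld Spsi psi_monic psi_irr 1 g0 SB' BE sX); rewrite expr1.
move/(pdvd_size (S_V lv) Spsi)/(_ B0) => sB.
apply: leq_ltn_trans (Bs n (leq_trans nf sB)).
by rewrite leq_mul2r leq_addl orbT.
Qed.

Lemma rep_exists : exists Phi, [/\ KP mu Phi,
  forall c, gr_dvd (Hmu Phi) c <-> gr_dvd Z c
  & Rideal mu Phi = [set Z * d | d in Delta mu]%classic].
Proof.
pose f := (size psi).-1; have fE : size psi = f.+1 by rewrite /f prednK // ltnW.
(* The exponent is chosen so that the power of p in the top coefficient of G is p^0; as psi is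
   monic, this coefficient is then 1. *)
pose u : int := V * (e * f)%N%:Z + h * f%:Z.
have [G [MG GE Gc G0]] := graded_of_nf lv ld 0 u Spsi.
have Gf : G`_(e * f) = 1.
  have := Gc f; rewrite add0n => ->; rewrite -lead_coefE (monicP psi_monic).
  by rewrite /u mul1r (_ : _ - _ - _ = 0) ?expr0z //; ring.
have sG : size G = (e * f).+1.
  apply/eqP; rewrite eqn_leq; apply/andP; split; last first.
    rewrite ltnNge; apply/negP => /leq_sizeP/(_ _ (leqnn _))/eqP.
    by rewrite Gf oner_eq0.
  apply/leq_sizeP => j fj; apply/eqP; apply: contraTT fj => Gj.
  have [k jE] := G0 _ Gj; rewrite add0n in jE; rewrite jE -ltnNge ltnS leq_mul2l.
  apply/orP; right; rewrite leqNgt; apply: contra_neqN Gj => fk.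
  by rewrite jE -[(e * k)%N]add0n Gc nth_default ?mul0r // fE.
have Gn0 : G != 0 by rewrite -size_poly_gt0 sG.
have [Phi [PhiM PhiE /(_ Gn0) np Phim]] := graded_repr lv MG.
have [|Phi_monic sPhi] := Phim; first by rewrite lead_coefE sG.
have [Phi0 Phiv] := filt_exact PhiM np.
have HPhi : Hmu Phi = p ^ u * Z by rewrite -(grclass_Hmu Phi0 Phiv) PhiE GE expr0 mul1r.
have pU : p ^ u \is a GRing.unit.
  by rewrite unitrXz //; have [] := smallV lv (ld_p ld) (ld_p0 ld).
have dvdE c : gr_dvd (Hmu Phi) c <-> gr_dvd Z c.
  rewrite HPhi; split=> [[q ->]|[q ->]]; first by exists (p ^ u * q); rewrite mulrCA mulrA.
  by exists ((p ^ u)^-1 * q); rewrite mulrACA mulrV // mul1r.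
have minP (g : {poly K}) : g != 0 -> mu_dvd mu Phi g -> (size Phi <= size g)%N.
  have fpsi : (f < size psi)%N by rewrite fE.
  by move=> g0 /dvdE/(psi_dvd_size g0 fpsi); rewrite sPhi sG.
have n1 : ~ gr_dvd (Hmu Phi) 1.
  move=> d1; have := @minP 1 (oner_neq0 _); rewrite /mu_dvd Hmu1 => /(_ d1).
  have f0 : (0 < f)%N by rewrite -ltnS -fE.
  have m0 : (0 < (size phi).-1)%N by rewrite -ltnS prednK ?(lv_size lv) // ltnW // (lv_size lv).
  by rewrite size_poly1 sPhi sG ltnS leqNgt !muln_gt0 (ld_e ld) f0 m0.
exists Phi; split=> //; first split=> //.
- move=> I0; have : gr_ideal (Hmu Phi) (Hmu Phi) by apply: gr_dvd_refl.
  by rewrite I0 => /eqP; apply/negP; apply: Hmu_neq0.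
- apply: prime_homog => // f1 f2 f10 f20.
  by rewrite !dvdE; apply: (nf_exists_prime lv ld Spsi psi_monic psi_irr psi_X).
- by move=> g g0 sg /(minP _ g0); rewrite leqNgt sg.
(* Z is homogeneous of degree 0, so a quotient of an element of Delta by Z may be replaced by its
   component of degree 0. *)
have [w w0 wE] := psi_homog; apply/seteqP; split=> c.
  move=> [[g g0 <-] /dvdE]; rewrite wE => /(gr_dvd_comp 0 w0)[q [qf]].
  rewrite comp_grclass // eqxx subr0 => ->.
  by exists (grclass mu 0 q) => //; exists q => //; rewrite subr0 in qf.
move=> [d [g g0 <-] <-]; split; last by apply/dvdE/gr_dvdMr/gr_dvd_refl.
exists (w * g); last by rewrite wE -grclassM // addr0.
by have := filtM w0 g0; rewrite addr0.
Qed.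

End RepresentativeExists.

(** * MacLane chains *)

Section Augmentation.
Variables (K : fieldType) (v : K -> int).
Implicit Types (mu : valuation v) (f g phi : {poly K}).

Lemma ram_pval_int mu g : g != 0 -> (ram mu)%:R * pval mu g \is a Num.int.
Proof. by move=> g0; apply/(ramP mu); exists (tofrac g); rewrite ?tofrac_eq0. Qed.

Lemma pval_polyC mu (c : K) : c != 0 -> pval mu c%:P = (v c)%:~R.
Proof. exact: val_ext. Qed.

Section Step.
Variables (mu mu' : valuation v) (phi : {poly K}) (nu : rat).
Hypotheses (phiKP : KP mu phi) (nu0 : 0 < nu) (aug : is_augmentation mu phi nu mu').
Let phi_monic := KP_monic phiKP.
Let sphi := KP_size phiKP.
Let phi0 : phi != 0. Proof. exact: monic_neq0. Qed.

Lemma aug_min g a : g != 0 -> is_expansion phi g a ->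
  (exists s, pval mu' g = pval mu (a`_s * phi ^+ s) + s%:R * nu) /\
  forall s, a`_s != 0 -> pval mu' g <= pval mu (a`_s * phi ^+ s) + s%:R * nu.
Proof.
move=> g0 ga; have [b gb [[s bs E] min]] := aug g0.
rewrite (expansion_uniq phi_monic sphi ga gb); split; first by exists s.
by move=> j bj; apply: min; exists j.
Qed.

Lemma aug_le g : g != 0 -> pval mu g <= pval mu' g.
Proof.
move=> g0; have [b gb [[s bs ->] _]] := aug g0.
have := KP_expansion_filt phiKP gb (filt_pval mu g) s.
rewrite filtE ?mulf_neq0 ?expf_neq0 // => H; apply: (le_trans H).
by rewrite lerDl mulr_ge0 ?ler0n // ltW.
Qed.

Lemma aug_phi : pval mu' phi = pval mu phi + nu.
Proof.
have [b pb [[s bs ->] _]] := aug phi0.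
move: bs; rewrite (expansion_uniq phi_monic sphi pb (expansion_phi sphi)) coefX.
by have [-> _|] := eqVneq s 1%N; rewrite ?eqxx // expr1 !mul1r.
Qed.

Lemma aug_lt : pval mu phi < pval mu' phi.
Proof. by rewrite aug_phi ltrDl. Qed.

(** mu and mu' agree on digits, so the minimum defining the augmentation bounds the mu'-values of
    the terms. Products of small polynomials are reduced modulo phi without changing their class. *)
Lemma aug_level : level mu' phi.
Proof.
split=> //.
- move=> g a M ga; have [g00|g0] := eqVneq g 0.
    have [->|a0] := eqVneq a 0; first by move=> _ s; rewrite coef0 mul0r; left.
    by have := expansion_neq0 phi_monic sphi ga a0; rewrite g00 eqxx.
  move=> /(filtE _ _ g0) Mg s; have [->|as0] := eqVneq a`_s 0; first by rewrite mul0r; left.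
  have [_ /(_ s as0) min] := aug_min g0 ga; right; apply: (le_trans Mg); apply: (le_trans min).
  have [sE _] := above_small aug_le phiKP aug_lt as0 (ga.2 s).
  rewrite !pvalM ?expf_neq0 // !pvalX // sE aug_phi.
  by rewrite mulrDr addrA.
- move=> f g f0 g0 sf sg.
  have nd : ~ mu_dvd mu phi (f * g) by apply: KP_ndvdM => //; apply: KP_min.
  have [r [r0 sr _ E _]] := above_mod aug_le phiKP aug_lt (mulf_neq0 f0 g0) nd.
  by exists r; rewrite -HmuM.
by move=> f f0 sf; have [] := above_small aug_le phiKP aug_lt f0 sf.
Qed.

End Step.

Section Gauss.
Variable mu : valuation v.
Hypothesis muG : is_gauss mu.

Lemma gauss_X : pval mu 'X = 0.
Proof.
have X0 : 'X != 0 :> {poly K} by rewrite polyX_eq0.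
have v1 : (v 1)%:~R = 0 :> rat by rewrite -(pval_polyC mu (oner_neq0 K)) polyC1 pval1.
have [[s sX ->] _] := muG X0; move: sX; rewrite coefX.
by have [_ _|_] := eqVneq s 1%N; rewrite ?eqxx.
Qed.

(** The polynomials smaller than x are the constants, so products and inverses are those of K. *)
Lemma gauss_level : level mu 'X.
Proof.
have expX (g : {poly K}) : is_expansion 'X g (map_poly polyC g).
  split; first by rewrite -[LHS]comp_polyXr.
  by move=> s; rewrite coef_map size_polyX ltnS size_polyC_leq1.
have constP (f : {poly K}) : f != 0 -> (size f < size ('X : {poly K}))%N -> exists2 c, c != 0 & f = c%:P.
  by move=> f0; rewrite size_polyX => sf; apply/size_poly1P; rewrite eqn_leq -ltnS sf size_poly_gt0.
have sX : (1 < size ('X : {poly K}))%N by rewrite size_polyX.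
split; rewrite ?monicX //.
- move=> g a M /(expansion_uniq (monicX K) sX)/(_ (expX g)) ->.
  have [->|g0] := eqVneq g 0; first by move=> _ s; rewrite map_poly0 coef0 mul0r; left.
  move=> /(filtE _ _ g0) Mg s; rewrite coef_map /=.
  have [->|gs] := eqVneq g`_s 0; first by rewrite mul0r; left.
  right; apply: (le_trans Mg); rewrite pvalM ?polyC_eq0 ?expf_neq0 ?polyX_eq0 //.
  rewrite pvalX ?polyX_eq0 // gauss_X mulr0 addr0 pval_polyC //.
  by have [_] := muG g0; apply; exists s.
- move=> f g f0 g0 /(constP f f0)[c c0 ->] /(constP g g0)[d d0 ->].
  exists (c * d)%:P; rewrite polyC_eq0 mulf_neq0 // size_polyX polyCM HmuM.
  by rewrite -polyCM ltnS size_polyC_leq1.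
move=> f f0 /(constP f f0)[c c0 ->]; exists c^-1%:P.
rewrite polyC_eq0 invr_eq0 c0 size_polyX -HmuM -polyCM mulfV // polyC1 Hmu1.
by rewrite ltnS size_polyC_leq1.
Qed.

End Gauss.
End Augmentation.

Section FractionValues.
Local Open Scope quotient_scope.

Lemma fraction_numden (R : idomainType) (f : {fraction R}) :
  exists n d, d != 0 /\ f * tofrac d = tofrac n.
Proof.
elim/quotW: f => x; exists \n_x, \d_x; split; first exact: denom_ratioP.
rewrite /tofrac; unlock.
rewrite -[_ * _]/(FracField.mul _ _) !piE; apply/eqmodP.
rewrite /= FracField.equivfE /FracField.mulf.
by rewrite !numden_Ratio ?mulr1 ?mul1r ?oner_neq0 ?denom_ratioP // mulrC.
Qed.

Lemma val_numden (K : fieldType) (v : K -> int) (mu : valuation v) f : f != 0 ->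
  exists n d, [/\ n != 0, d != 0, mu f = pval mu n - pval mu d & f * tofrac d = tofrac n].
Proof.
move=> f0; have [n [d [d0 E]]] := fraction_numden f; exists n, d.
have n0 : n != 0 by rewrite -tofrac_eq0 -E mulf_neq0 ?tofrac_eq0.
by split=> //; rewrite /pval -E Defs.valM ?tofrac_eq0 // addrK.
Qed.

End FractionValues.

(** * The value group at a level and its Bezout relation *)

Section LevelDataBuild.
Variables (K : fieldType) (v : K -> int) (mu : valuation v) (phi : {poly K}).
Variables (p : gr mu) (em : nat) (w nu : rat).
Hypotheses (lv : level mu phi) (em_gt0 : (0 < em)%N) (p_small : small phi em%:R^-1 p)
  (p0 : p != 0) (em_int : forall a (c : gr mu), small phi a c -> c != 0 -> em%:R * a \is a Num.int)
  (w_int : em%:R * w \is a Num.int) (phiE : pval mu phi = w + nu).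
Let e := (ram mu %/ em)%N.
Let V : int := Num.floor (em%:R * w).
Let h : int := Num.floor ((ram mu)%:R * nu).

Let em0 : em%:R != 0 :> rat. Proof. by rewrite pnatr_eq0 -lt0n. Qed.
Let phi0 : phi != 0. Proof. exact: monic_neq0 (lv_monic lv). Qed.

(** The degree 1/em of p is a value of mu, which makes em a divisor of e(mu). *)
Lemma ld_ram : ram mu = (em * e)%N.
Proof.
have [b [b0 _ bv _]] := small_homog p_small p0.
have /intrP[z zE] := ram_pval_int mu b0; rewrite bv in zE.
suff : (em %| ram mu)%N by rewrite mulnC => /divnK.
have : (em %| (ram mu : int))%Z.
  apply/dvdzP; exists z; apply: (@intr_inj rat); rewrite rmorphM /= -zE.
  by rewrite -!pmulrn mulfVK.
by [].
Qed.

Lemma ld_e_gt0 : (0 < e)%N.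
Proof. by have := ram_gt0 mu; rewrite ld_ram muln_gt0 => /andP[]. Qed.

Let VE : V%:~R = em%:R * w. Proof. by rewrite /V floorK. Qed.

Let hE : h%:~R = (ram mu)%:R * nu.
Proof.
rewrite /h floorK // (_ : nu = pval mu phi - w); last by rewrite phiE; lra.
rewrite mulrBr rpredB ?ram_pval_int // ld_ram mulnC natrM -mulrA.
by rewrite rpredM ?natr_int.
Qed.

(** Value group on polynomials: a nonzero coefficient of the graded expansion expresses mu(g)
    through 1/em and nu. *)
Lemma pval_gen g : g != 0 -> exists z n : int, em%:R * pval mu g = z%:~R + n%:~R * (em%:R * nu).
Proof.
move=> g0; have [a ga] := expansion_exists (lv_monic lv) (lv_size lv) g.
have [G [MG gE _ _]] := graded_of lv ga (filt_pval mu g).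
have G0 : G != 0.
  by apply: contra_neq (Hmu_neq0 mu g0) => G0; rewrite HmuE // gE G0 horner0.
have Gj : G`_(size G).-1 != 0 by rewrite -lead_coefE lead_coef_eq0.
have /intrP[z zE] := em_int (MG _) Gj.
exists (z + (size G).-1%:Z * V), (size G).-1%:Z.
rewrite rmorphD rmorphM /= -!pmulrn -zE VE phiE; ring.
Qed.

(** Coprimality of e and h: the value 1/e(mu) is attained, hence is an integral combination of 1/em
    and nu; multiply by e(mu). *)
Lemma ld_bezout : exists z n : int, z * e%:Z + n * h = 1.
Proof.
have /(ramP mu)[f f0 fv] : (ram mu)%:R * (ram mu)%:R^-1 \is a @Num.int rat.
  by rewrite mulfV ?rpred1 // pnatr_eq0 -lt0n ram_gt0.
have [n [d [n0 d0 fE _]]] := val_numden mu f0.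
have [z1 [k1 E1]] := pval_gen n0; have [z2 [k2 E2]] := pval_gen d0.
exists (z1 - z2), (k1 - k2); apply: (@intr_inj rat).
rewrite rmorphD !rmorphM !rmorphB /= hE -!pmulrn.
have E : em%:R * (ram mu)%:R^-1 = em%:R * pval mu n - em%:R * pval mu d :> rat.
  by rewrite -mulrBr -fE fv.
rewrite E1 E2 in E; have e0 : e%:R != 0 :> rat by rewrite pnatr_eq0 -lt0n ld_e_gt0.
rewrite {1}ld_ram natrM in E; rewrite ld_ram natrM.
have := congr1 ( *%R e%:R) E; rewrite (_ : e%:R * (em%:R / _) = 1); last by field; rewrite em0 e0.
by move=> E1'; rewrite [RHS]E1'; ring.
Qed.

Lemma ld_build : level_data phi p em e V h nu.
Proof.
split=> //; first exact: ld_e_gt0.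
- by rewrite VE phiE mulrC mulKf.
- by rewrite hE ld_ram natrM; field.
(* If em k nu = t is an integer, then k h = t e, and the Bezout relation makes e divide k. *)
move=> k /intrP[t tE]; have [z [n E]] := ld_bezout; apply/dvdzP.
exists (k * z + n * t); rewrite -[LHS]mulr1 -E.
have kh : k * h = t * e%:Z.
  apply: (@intr_inj rat); rewrite !rmorphM /= -tE hE ld_ram natrM -!pmulrn; ring.
have -> : k * (z * e + n * h) = k * z * e + n * (k * h) by ring.
rewrite kh; ring.
Qed.

End LevelDataBuild.

Section NextLevel.
Variables (K : fieldType) (v : K -> int) (mu mu' : valuation v) (phi phi' : {poly K}).
Variables (p : gr mu) (em e : nat) (V h : int) (nu : rat).
Hypotheses (lv : level mu phi) (ld : level_data phi p em e V h nu).
Hypotheses (ramE : ram mu = (em * e)%N) (phi'KP : KP mu phi').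
Hypotheses (le_mu : forall g : {poly K}, g != 0 -> pval mu g <= pval mu' g)
  (lt_phi : pval mu phi' < pval mu' phi').
Variables (n : nat) (l : int).
Hypotheses (bez : n%:Z * h + l * e%:Z = 1) (ndvd : ~ mu_dvd mu phi' (phi ^+ n)).

(** The degree of x^n p^l is n nu + l/em = (n h + l e)/(em e) = 1/e(mu). The element is the class of
    phi^n b with b small, which phi' does not divide, so its image is the class of the remainder
    modulo phi'. *)
Lemma next_p : small phi' (ram mu)%:R^-1 (gr_map mu' (ld_x phi p V ^ n%:Z * p ^ l)) /\
  gr_map mu' (ld_x phi p V ^ n%:Z * p ^ l) != 0.
Proof.
have phi0 : phi != 0 := monic_neq0 (lv_monic lv).
have em0 : em%:R != 0 :> rat by rewrite pnatr_eq0 -lt0n (ld_em ld).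
have e0 : e%:R != 0 :> rat by rewrite pnatr_eq0 -lt0n (ld_e ld).
have [pu _] := smallV lv (ld_p ld) (ld_p0 ld).
have pz := smallXz lv (l - V * n%:Z) (ld_p ld) (ld_p0 ld).
have [b [b0 sb bv bE]] := small_homog pz (small_unit_neq0 (unitrXz _ pu)).
have E : ld_x phi p V ^ n%:Z * p ^ l = Hmu mu (phi ^+ n * b).
  rewrite HmuM HmuX -bE /ld_x -exprnP exprMn -mulrA; congr (_ * _).
  have -> : (p ^ (- V)) ^+ n = p ^ (- V * n%:Z) by rewrite exprnP exprz_exp.
  by rewrite -(exprzDr pu) mulNr addrC.
have nb : ~ mu_dvd mu phi' b.
  move=> db; have [c [_ _ bc]] := lv_inv lv b0 sb.
  by apply: (KP_nunit phi'KP); rewrite -bc; apply: gr_dvdMr.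
have pn0 : phi ^+ n * b != 0 by rewrite mulf_neq0 ?expf_neq0.
have [r [r0 sr rv rE fv]] := above_mod le_mu phi'KP lt_phi pn0 (KP_ndvdM phi'KP ndvd nb).
have {}E : gr_map mu' (ld_x phi p V ^ n%:Z * p ^ l) = Hmu mu' r.
  rewrite E -rE HmuE // gr_map_grclass //; last exact: filt_pval.
  by rewrite -fv HmuE.
rewrite E; split; last exact: Hmu_neq0.
suff <- : pval mu' r = (ram mu)%:R^-1 by apply: small_Hmu.
rewrite rv pvalM ?expf_neq0 // pvalX // bv (ld_phi ld) ramE natrM.
rewrite rmorphB rmorphM /= -pmulrn.
have bezq : n%:R * h%:~R + l%:~R * e%:R = 1 :> rat.
  by have := congr1 (intr : int -> rat) bez; rewrite rmorphD !rmorphM /= -!pmulrn.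
transitivity ((n%:R * (e%:R * nu * em%:R) + l%:~R * e%:R) / (em%:R * e%:R) : rat).
  by field; rewrite em0 e0.
by rewrite (ld_nu ld) divfK // bezq div1r.
Qed.

End NextLevel.

Section Chain.
Variables (K : fieldType) (v : K -> int) (pi : K).
Hypotheses (hv : surj_discrete_valuation v) (hpi : uniformizer v pi).
Variables (C : chain v) (r : nat).
Hypothesis HC : maclane_chain C r.
Local Notation mu := (c_mu C).
Local Notation phi := (c_phi C).
Local Notation nu := (c_nu C).

Lemma v1 : v 1 = 0.
Proof.
by apply: (@addrI _ (v 1)); rewrite -(sdvM hv) ?oner_neq0 // mulr1 addr0.
Qed.

Lemma uniformizer_val : pi != 0 /\ v pi = 1.
Proof.
have [a a0 va] := sdv_surj hv 1.
have : maxideal v a by right; rewrite va.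
rewrite hpi => -[b bv ab]; rewrite -ab in a0 va.
have pi0 : pi != 0 by apply: contra_neq a0 => ->; rewrite mul0r.
have b0 : b != 0 by apply: contra_neq a0 => ->; rewrite mulr0.
have : maxideal v pi by rewrite hpi; exists 1; rewrite ?mulr1 //; right; rewrite v1.
case: bv => [/eqP|vb]; first by rewrite (negPf b0).
case=> [/eqP|vpi]; first by rewrite (negPf pi0).
split=> //; move: va; rewrite (sdvM hv) // => va.
by move: (v pi) (v b) vb vpi va => m n; lia.
Qed.

Lemma chain_phi0 : phi 0 = 'X. Proof. by case: HC => -[]. Qed.
Lemma chain_gauss : is_gauss (mu 0). Proof. by case: HC => -[]. Qed.
Lemma chain_nu0 : nu 0 = 0. Proof. by case: HC => -[_ l0 _] _; rewrite /c_nu l0 mul0r. Qed.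
Lemma chain_KP i : (i < r)%N -> KP (mu i) (phi i.+1). Proof. by case: HC => _ [H]; auto. Qed.
Lemma chain_nu i : (i < r)%N -> 0 < nu i.+1. Proof. by case: HC => _ [_ H]; auto. Qed.
Lemma chain_aug i : (i < r)%N -> is_augmentation (mu i) (phi i.+1) (nu i.+1) (mu i.+1).
Proof. by case: HC => _ [_ _ H]; auto. Qed.
Lemma chain_ndvd i : (0 < i < r)%N -> ~ mu_dvd (mu i) (phi i.+1) (phi i).
Proof. by case: HC => _ [_ _ _ H]; auto. Qed.

Lemma chain_le1 i (g : {poly K}) : (i < r)%N -> g != 0 -> pval (mu i) g <= pval (mu i.+1) g.
Proof. by move=> ir g0; exact: (aug_le (chain_KP ir) (chain_nu ir) (chain_aug ir) g0). Qed.

Lemma chain_phi i : (i < r)%N -> pval (mu i.+1) (phi i.+1) = pval (mu i) (phi i.+1) + nu i.+1.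
Proof. by move=> ir; apply: aug_phi (chain_KP ir) (chain_aug ir). Qed.

Lemma chain_lt i : (i < r)%N -> pval (mu i) (phi i.+1) < pval (mu i.+1) (phi i.+1).
Proof. by move=> ir; rewrite chain_phi // ltrDl chain_nu. Qed.

Lemma chain_le i j (g : {poly K}) : (i <= j <= r)%N -> g != 0 -> pval (mu i) g <= pval (mu j) g.
Proof.
move=> /andP[ij jr] g0; elim: j ij jr => [|j IH]; first by rewrite leqn0 => /eqP ->.
rewrite leq_eqVlt => /orP[/eqP -> //|]; rewrite ltnS => ij jr.
exact: le_trans (IH ij (ltnW jr)) (chain_le1 jr g0).
Qed.

Lemma chain_level i : (i <= r)%N -> level (mu i) (phi i).
Proof.
case: i => [_|i ir]; first by rewrite chain_phi0; apply/gauss_level/chain_gauss.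
exact: aug_level (chain_KP ir) (chain_nu ir) (chain_aug ir).
Qed.

Lemma gauss_ram : ram (mu 0) = 1%N.
Proof.
have ram0 : (ram (mu 0))%:R != 0 :> rat by rewrite pnatr_eq0 -lt0n ram_gt0.
have /(ramP (mu 0))[f f0 fv] : (ram (mu 0))%:R * (ram (mu 0))%:R^-1 \is a @Num.int rat.
  by rewrite mulfV ?rpred1.
have int_pval (g : {poly K}) : g != 0 -> exists z : int, pval (mu 0) g = z%:~R.
  by move=> g0; have [[s _ ->] _] := chain_gauss g0; exists (v g`_s).
have [n [d [/int_pval[z zE] /int_pval[z' zE'] fE _]]] := val_numden (mu 0) f0.
have : (ram (mu 0))%:R * (z - z')%:~R = 1 :> rat.
  by rewrite rmorphB /= -zE -zE' -fE fv mulfV.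
rewrite pmulrn -intrM => /(@intr_inj rat _ 1) E.
by apply/eqP; rewrite -dvdn1; have : ((ram (mu 0))%:Z %| 1)%Z by apply/dvdzP; exists (z - z'); rewrite mulrC E.
Qed.

Local Notation LD i := (level_data (phi i) (c_p pi C i) (ram (mu i.-1)) (c_e C i) (c_V C i) (c_h C i) (nu i)).

Lemma chain_ld_build i : (i <= r)%N ->
  small (phi i) (ram (mu i.-1))%:R^-1 (c_p pi C i) -> c_p pi C i != 0 ->
  LD i /\ ram (mu i) = (ram (mu i.-1) * c_e C i)%N /\
  exists z n : int, z * (c_e C i)%:Z + n * c_h C i = 1.
Proof.
move=> ir ps p0; have lv := chain_level ir; have phi0 := monic_neq0 (lv_monic lv).
(* For i > 0 small polynomials keep the value they had for mu_(i-1), whose value group is known; for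
   i = 0 both valuations are mu_0. *)
have em_int a (c : gr (mu i)) : small (phi i) a c -> c != 0 -> (ram (mu i.-1))%:R * a \is a Num.int.
  move=> sc c0; have [f [f0 sf <- _]] := small_homog sc c0.
  suff -> : pval (mu i) f = pval (mu i.-1) f by apply: ram_pval_int.
  case: (i) ir sf => // j jr sf /=.
  by have [] := above_small (fun g => @chain_le1 j g jr) (chain_KP jr) (chain_lt jr) f0 sf.
have w_int : (ram (mu i.-1))%:R * pval (mu i.-1) (phi i) \is a Num.int by apply: ram_pval_int.
have phiE : pval (mu i) (phi i) = pval (mu i.-1) (phi i) + nu i.
  by case: (i) ir => [_|j jr]; [rewrite chain_nu0 addr0|apply: chain_phi].
split; first exact: ld_build lv (ram_gt0 _) ps p0 em_int w_int phiE.
split; first exact: (@ld_ram _ _ _ _ _ _ (ram_gt0 _) ps p0).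
exact: ld_bezout lv (ram_gt0 _) ps p0 em_int w_int phiE.
Qed.

Lemma c_l_spec i : (0 < c_e C i)%N -> (exists z n : int, z * (c_e C i)%:Z + n * c_h C i = 1) ->
  (c_l C i).1 * c_h C i + (c_l C i).2 * (c_e C i)%:Z = 1 /\ 0 <= (c_l C i).1 < (c_e C i)%:Z.
Proof.
move=> e0 [z [n E]]; apply: (@xgetPex _ (0, 0) [set l : int * int |
    l.1 * c_h C i + l.2 * (c_e C i)%:Z = 1 /\ 0 <= l.1 < (c_e C i)%:Z]%classic).
(* The coefficient of h is reduced modulo e, and the quotient times h is moved to the coefficient of
   e. *)
exists ((n %% c_e C i)%Z, z + (n %/ c_e C i)%Z * c_h C i); rewrite /=; split.
  by rewrite -E {3}(divz_eq n (c_e C i)); ring.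
by rewrite modz_ge0 ?ltz_pmod // eqz_nat -lt0n.
Qed.

Lemma c_e0 : c_e C 0 = 1%N. Proof. by rewrite /c_e /= divnn ram_gt0. Qed.

Lemma chain_ld i : (i <= r)%N -> LD i /\ ram (mu i) = (ram (mu i.-1) * c_e C i)%N /\
  exists z n : int, z * (c_e C i)%:Z + n * c_h C i = 1.
Proof.
elim: i => [|i IH] ir.
  have [pi0 vpi] := uniformizer_val; apply: chain_ld_build => //.
    rewrite gauss_ram invr1 chain_phi0.
    have <- : pval (mu 0) pi%:P = 1 by rewrite pval_polyC // vpi.
    by apply: small_Hmu; rewrite ?polyC_eq0 // size_polyX ltnS size_polyC_leq1.
  by apply: Hmu_neq0; rewrite polyC_eq0.
suff [ps p0] : small (phi i.+1) (ram (mu i))%:R^-1 (c_p pi C i.+1) /\ c_p pi C i.+1 != 0.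
  exact: chain_ld_build.
have [ldi [ramE bez]] := IH (ltnW ir).
have := c_l_spec (ld_e ldi) bez; rewrite /=; case: (c_l C i) => l1 l2 /= [bz].
case: l1 bz => // n bz /andP[_ ne].
have nd : ~ mu_dvd (mu i) (phi i.+1) (phi i ^+ n).
  (* For i = 0 the chain condition does not exclude that phi_1 divides phi_0; but e_0 = 1 forces l_0
     = 0, so that phi_0 does not occur in p_1. *)
  have [i0|i0] := posnP i; last by apply: KP_ndvdX (chain_KP ir) _ _ (chain_ndvd _); rewrite i0.
  have -> : n = 0%N by move: ne; rewrite i0 c_e0; case: (n).
  by rewrite /mu_dvd expr0 Hmu1; apply: KP_nunit (chain_KP ir).
exact: (next_p (chain_level (ltnW ir)) ldi ramE (chain_KP ir) (fun g => @chain_le1 i g ir)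
  (chain_lt ir) bz nd).
Qed.

(** For i > 0, reduction modulo phi_i does not change the image in Gr(mu_i) of a class in
    Delta_(i-1); for i = 0 both sides are classes of constants. *)
Lemma small_c_F i : (i <= r)%N -> @c_F _ _ C i = (small (phi i) 0 : set (gr (mu i))).
Proof.
case: i => [_|i ir]; apply/seteqP; split=> c /=.
- move=> [a av <-]; exists a%:P; rewrite chain_phi0 size_polyX ltnS size_polyC_leq1.
  split=> //; have [->|a0] := eqVneq a 0; first by rewrite polyC0; left.
  by case: av => [/eqP|av]; [rewrite (negPf a0)|right; rewrite pval_polyC // ler0z].
- move=> [f [sf fv ->]]; rewrite chain_phi0 size_polyX ltnS in sf.
  have fE := size1_polyC sf; rewrite fE in fv *; exists f`_0 => //.
  have [->|a0] := eqVneq f`_0 0; [by left|right].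
  by move: fv; rewrite filtE ?polyC_eq0 // pval_polyC // ler0z.
- have le := fun g => @chain_le1 i g ir; have phi0 := monic_neq0 (KP_monic (chain_KP ir)).
  move=> [_ [g g0 <-] <-]; rewrite gr_map_grclass //.
  have sr : (size (g %% phi i.+1)%R < size (phi i.+1))%N by rewrite ltn_modp.
  have gE := divp_eq g (phi i.+1).
  have [] := KP_div (a := 0) (chain_KP ir) sr (q := g %/ phi i.+1); first by rewrite -gE.
  move=> r0 q0; exists (g %% phi i.+1); split=> //; first exact: (filt_mono le r0).
  apply/grclass_eq; [exact: (filt_mono le g0)|exact: (filt_mono le r0)|].
  rewrite {1}gE addrK; exact: (above_mulphi le (chain_KP ir) (chain_lt ir)).
move=> [f [sf fv ->]]; have le := fun g => @chain_le1 i g ir.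
have fv' : filt (mu i) 0 f.
  have [->|f0] := eqVneq f 0; first by left.
  have [fE _] := above_small le (chain_KP ir) (chain_lt ir) f0 sf.
  by move: fv; rewrite !filtE // fE.
by exists (grclass (mu i) 0 f); [exists f|rewrite gr_map_grclass].
Qed.

End Chain.

(** * Residual polynomials *)

Section NewtonPolygon.
Local Open Scope classical_set_scope.
Variables (A : set (rat * rat)) (nu : rat) (P0 : rat * rat).
(** The height at which the line of slope - nu through Q meets the vertical axis. *)
Let ht (Q : rat * rat) : rat := Q.2 + nu * Q.1.
Hypotheses (AP0 : A P0) (Amin : forall Q, A Q -> ht P0 <= ht Q)
  (Aleft : forall Q, A Q -> ht Q = ht P0 -> P0.1 <= Q.1).

Let ht_conv (P Q : rat * rat) t :
  ht (t * P.1 + (1 - t) * Q.1, t * P.2 + (1 - t) * Q.2) = t * ht P + (1 - t) * ht Q.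
Proof. by rewrite /ht /=; ring. Qed.

Lemma hull_above Q : convex_hull A Q -> ht P0 <= ht Q.
Proof.
move=> /(_ [set Q' | ht P0 <= ht Q']).
apply=> [P R t /andP[t0 t1] PP PR|]; last exact: Amin.
rewrite /= ht_conv; have := mulr_ge0 t0 (_ : 0 <= ht P - ht P0).
have := mulr_ge0 (_ : 0 <= 1 - t) (_ : 0 <= ht R - ht P0).
rewrite !subr_ge0 => /(_ t1 PR) H1 /(_ PP) H2.
move: H1 H2; rewrite !mulrBr mulrBl; lra.
Qed.

(** The points strictly above the line, together with those on it not left of P0, form a convex set
    containing A. *)
Lemma hull_left Q : convex_hull A Q -> ht P0 < ht Q \/ ht Q = ht P0 /\ P0.1 <= Q.1.
Proof.
pose D := [set Q | ht P0 < ht Q \/ ht Q = ht P0 /\ P0.1 <= Q.1].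
move=> /(_ D); apply=> [P R t /andP[t0 t1] DP DR|]; last first.
  move=> P AP; have := Amin AP; rewrite le_eqVlt => /orP[/eqP E|]; [right|by left].
  by split=> //; apply: Aleft.
rewrite /D /= ht_conv.
move: t0; rewrite le_eqVlt => /orP[/eqP <-|t0].
  by rewrite !(mul0r, subr0, add0r, mul1r).
move: t1; rewrite le_eqVlt => /orP[/eqP ->|t1].
  by rewrite !(mul1r, subrr, mul0r, addr0).
have t1' : 0 < 1 - t by rewrite subr_gt0.
case: DP DR => [HP|[-> HP]] [HR|[-> HR]].
- left; have := mulr_gt0 t0 (_ : 0 < ht P - ht P0); rewrite subr_gt0 => /(_ HP).
  have := mulr_gt0 t1' (_ : 0 < ht R - ht P0); rewrite subr_gt0 => /(_ HR).
  rewrite !mulrBr; lra.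
- left; have := mulr_gt0 t0 (_ : 0 < ht P - ht P0); rewrite subr_gt0 => /(_ HP).
  rewrite !mulrBr; lra.
- left; have := mulr_gt0 t1' (_ : 0 < ht R - ht P0); rewrite subr_gt0 => /(_ HR).
  rewrite !mulrBr; lra.
right; split; first ring.
have := mulr_ge0 (ltW t0) (_ : 0 <= P.1 - P0.1); rewrite subr_ge0 => /(_ HP).
have := mulr_ge0 (ltW t1') (_ : 0 <= R.1 - P0.1); rewrite subr_ge0 => /(_ HR).
rewrite !mulrBr; lra.
Qed.

Lemma left_endpoint_hull : left_endpoint (touching (lower_hull A) nu) P0.
Proof.
have hullA : convex_hull A P0 by move=> D _; apply.
have lP0 : lower_hull A P0.
  by split=> // y' /hull_above; rewrite /ht /= lerD2r.
split.
  split=> // Q [/hull_above]; rewrite /ht; lra.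
move=> Q [[/hull_left QL _] /(_ _ lP0)]; case: QL => [|[_ //]].
rewrite /ht; lra.
Qed.

End NewtonPolygon.

Section Residual.
Variables (K : fieldType) (v : K -> int) (pi : K).
Hypotheses (hv : surj_discrete_valuation v) (hpi : uniformizer v pi).
Variables (C : chain v) (r : nat).
Hypothesis HC : maclane_chain C r.
Local Notation mu := (c_mu C).
Local Notation phi := (c_phi C).
Local Notation nu := (c_nu C).

(** The least s whose term attains the minimum defining mu_(i+1)(g) is the left end point of the
    polygon and also the exponent that [residual_form] needs. *)
Lemma c_su_exists i (g : {poly K}) : (i < r)%N -> g != 0 ->
  exists s u, c_su C i.+1 g s u /\
  exists R, poly_in (small (phi i.+1) 0) R /\
    Hmu (mu i.+1) g = c_x pi C i.+1 ^+ s * c_p pi C i.+1 ^ u * R.[c_y pi C i.+1].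
Proof.
move=> ir g0; have lv := chain_level HC ir; have [ld [_ _]] := chain_ld hv hpi HC ir.
have phiKP := chain_KP HC ir; have aug := chain_aug HC ir.
have phi0 := monic_neq0 (lv_monic lv).
have [a ga [[s0 as0 sE] min]] := aug g g0.
have auniq b : is_expansion (phi i.+1) g b -> b = a.
  by move=> /(expansion_uniq (lv_monic lv) (lv_size lv)); apply.
pose ht s := pval (mu i) (a`_s * phi i.+1 ^+ s) + s%:R * nu i.+1.
pose P s := (a`_s != 0) && (ht s == pval (mu i.+1) g).
have exP : exists s, P s by exists s0; rewrite /P as0 /ht -sE eqxx.
case: (ex_minnP exP) => s /andP[as_ /eqP hs] smin.
have asp0 j : a`_j != 0 -> a`_j * phi i.+1 ^+ j != 0 by move=> ?; rewrite mulf_neq0 ?expf_neq0.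
have /intrP[u uE] := ram_pval_int (mu i) (asp0 s as_).
have ram0 : (ram (mu i))%:R != 0 :> rat by rewrite pnatr_eq0 -lt0n ram_gt0.
have uE' : u%:~R / (ram (mu i))%:R = pval (mu i) (a`_s * phi i.+1 ^+ s).
  by rewrite -uE mulrC mulKf.
have htE j : a`_j != 0 -> ht j = pval (mu i.+1) (a`_j * phi i.+1 ^+ j).
  move=> aj; have [aE _] := above_small (fun g => @chain_le1 _ _ _ _ HC i g ir) phiKP (chain_lt HC ir) aj (ga.2 j).
  rewrite /ht !pvalM ?expf_neq0 // !pvalX // aE (chain_phi HC ir); ring.
exists s, u; split.
  rewrite /c_su uE'; apply: left_endpoint_hull => /=.
  - by exists a => //; exists s.
  - move=> Q [b /auniq -> [j aj ->]] /=; rewrite ![nu _ * _]mulrC -/(ht s) -/(ht j) hs.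
    by apply: min; exists j.
  move=> Q [b /auniq -> [j aj ->]] /=; rewrite ![nu _ * _]mulrC -/(ht s) -/(ht j) hs => hj.
  by rewrite ler_nat; apply: smin; rewrite /P aj hj eqxx.
apply: (residual_form lv ld g0 ga) => //.
- by rewrite /nf_deg -hs /ht -uE' addrC.
- by rewrite -htE.
move=> j js aj; rewrite -htE // lt_neqAle; apply/andP; split; last by apply: min; exists j.
by apply: contraTneq js => jE; rewrite -leqNgt; apply: smin; rewrite /P aj -jE eqxx.
Qed.

Lemma residual_spec i (g : {poly K}) : (i <= r)%N -> g != 0 ->
  poly_in (small (phi i) 0) (residual pi C i g) /\ exists s u,
  Hmu (mu i) g = c_x pi C i ^+ s * c_p pi C i ^ u * (residual pi C i g).[c_y pi C i] /\
  (i = 0%N -> s = 0%N).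
Proof.
move=> ir g0; have SF := small_c_F HC ir.
suff : is_residual pi g (residual pi C i g).
  move=> [FR [s [u [su E]]]]; split; first by rewrite -SF.
  by exists s, u; split=> // i0; subst i; case: su.
rewrite /residual (negPf g0); apply: xgetPex.
case: i ir SF => [|i] ir SF; last first.
  have [s [u [su [R [SR RE]]]]] := c_su_exists ir g0; exists R; split; first by rewrite /c_Fpoly SF.
  by exists s, u.
have lv := chain_level HC ir; have [ld [_ _]] := chain_ld hv hpi HC ir.
have [s [u [R [[s1 gE SR _] [E _]]]]] := nf_exists lv ld g0.
(* The normal form has s < e_0 = 1, in agreement with the convention s_0 = 0. *)
have s0 : s = 0%N by move: s1; rewrite c_e0; case: (s).
exists R; split; first by rewrite /c_Fpoly SF.
exists s, u; split=> //; split=> //.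
by rewrite gE /nf_deg s0 mul0r add0r (gauss_ram HC) divr1.
Qed.

End Residual.

(** * Comparison of valuations with a common key polynomial *)

Section Comparison.
Variables (K : fieldType) (v : K -> int).
Implicit Types (mu : valuation v) (f g phi Phi : {poly K}).

Lemma filt_expansion mu phi g a M : is_expansion phi g a ->
  (forall s, filt mu M (a`_s * phi ^+ s)) -> filt mu M g.
Proof.
move=> [-> _] aM; rewrite horner_coef.
have [|//] := @grclass_sum _ _ mu M _ (index_enum 'I_(size a)) predT
  (fun s => a`_(val s) * phi ^+ val s).
by move=> s _; apply: aM.
Qed.

Lemma filtp_expansion mu phi g a M : is_expansion phi g a ->
  (forall s, filtp mu M (a`_s * phi ^+ s)) -> filtp mu M g.
Proof.
by move=> [-> _] aM; rewrite horner_coef; apply: filtp_sum => s _; apply: aM.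
Qed.

(** The Gauss valuation is the least one, because mu'(x) >= 0 makes every monomial at least as large
    in value. *)
Lemma gauss_le mu mu' g : is_gauss mu -> g != 0 -> pval mu g <= pval mu' g.
Proof.
move=> muG g0; apply/(filtE mu' _ g0); rewrite -[g in filt _ _ g]coefK poly_def.
have [|//] := @grclass_sum _ _ mu' (pval mu g) _ (index_enum 'I_(size g)) predT
  (fun s => g`_(val s) *: 'X^(val s)).
move=> s _; rewrite -mul_polyC; have [->|gs] := eqVneq g`_(val s) 0; first by rewrite mul0r; left.
have [_ min] := muG g g0.
right; rewrite pvalM ?polyC_eq0 ?expf_neq0 ?polyX_eq0 // pvalX ?polyX_eq0 // pval_polyC //.
have X0 : 0 <= pval mu' 'X := valX mu'.
have : pval mu g <= (v g`_(val s))%:~R by apply: min; exists (val s).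
have : 0 <= (val s)%:R * pval mu' 'X by rewrite mulr_ge0.
lra.
Qed.

Lemma KP_Hmu mu phi Phi : KP mu Phi -> phi \is monic -> size phi = size Phi ->
  Hmu mu phi = Hmu mu Phi -> KP mu phi.
Proof. by rewrite /KP /= /mu_dvd => -[_ H1 H2 H3] m s E; rewrite s E. Qed.

(** Suppose Phi keeps its value, and take g of least degree whose value grows. Dividing by Phi gives
    deg g < deg Phi, so g has an inverse h modulo Phi. *)
Lemma KP_lt mu mu' Phi : (forall g, g != 0 -> pval mu g <= pval mu' g) -> KP mu' Phi ->
  (exists2 g, g != 0 & pval mu g < pval mu' g) -> pval mu Phi < pval mu' Phi.
Proof.
move=> le PhiKP [g1 g10 g1lt]; have Phi0 := monic_neq0 (KP_monic PhiKP).
have sPhi := KP_size PhiKP.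
rewrite lt_neqAle le // andbT; apply/eqP => PhiE.
pose P n := `[< exists g, [/\ g != 0, pval mu g < pval mu' g & size g = n] >].
have exP : exists n, P n by exists (size g1); apply/asboolP; exists g1.
case: (ex_minnP exP) => n /asboolP[g [g0 glt gn]] min.
have minP f : f != 0 -> (size f < size g)%N -> pval mu f = pval mu' f.
  move=> f0 fg; apply/eqP; rewrite eq_le le //= leNgt; apply/negP => flt.
  have : P (size f) by apply/asboolP; exists f.
  by move/min; rewrite -gn leqNgt fg.
have filt_eq a f : filt mu' a f -> (size f < size g)%N -> filt mu a f.
  have [->|f0] := eqVneq f 0; first by left.
  by rewrite !filtE // => ? /(minP _ f0) ->.
have filt_mulPhi a q : filt mu' a (q * Phi) -> (size q < size g)%N -> filt mu a (q * Phi).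
  have [->|q0] := eqVneq q 0; first by rewrite mul0r; left.
  by rewrite !filtE ?mulf_neq0 // !pvalM // PhiE => H /(minP _ q0) ->.
have sg : (size g < size Phi)%N.
  rewrite ltnNge; apply/negP => sPg.
  have gE := divp_eq g Phi; have sr : (size (g %% Phi)%R < size Phi)%N by rewrite ltn_modp.
  have [] := KP_div (a := pval mu' g) PhiKP sr (q := g %/ Phi).
    by rewrite -gE; apply: filt_pval.
  move=> /filt_eq/(_ (leq_trans sr sPg)) fr /filt_mulPhi fq.
  have : filt mu (pval mu' g) g.
    rewrite [g in filt _ _ g]gE; apply: filtD => //; apply: fq.
    rewrite size_divp //; have aux (k m : nat) : (1 < k)%N -> (k <= m)%N -> (m - k.-1 < m)%N by lia.
    exact: aux.
  by rewrite filtE // leNgt glt.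
have [h [q [h0 sh E]]] := KP_bezout PhiKP g0 sg.
have [|_] := KP_mod PhiKP g0 h0 (KP_min PhiKP g0 sg) (KP_min PhiKP h0 sh) _ E.
  by rewrite size_poly1.
rewrite pval1 => gh0; rewrite -gh0 => qf.
(* As q is smaller than g, both valuations agree on q Phi. Hence mu(g h) = mu(q Phi + 1) >= 0,
   although mu(g h) < mu'(g h) = 0. *)
have sq : (size q < size g)%N.
  have [->|q0] := eqVneq q 0; first by rewrite size_poly0 size_poly_gt0.
  have : size (g * h) = size (q * Phi).
    by rewrite E size_polyDl // size_poly1 size_mul // (leq_trans sPhi) //; move: q0;
      rewrite -size_poly_gt0; case: (size q) => // k _; rewrite addSn leq_addl.
  rewrite !size_mul //; move: q0 h0 g0 sh; rewrite -!size_poly_gt0.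
  by move: (size q) (size h) (size g) (size Phi) sPhi => k l m o; lia.
have : filt mu 0 (g * h).
  by rewrite E; apply: filtD; [apply: filt_mulPhi|right; rewrite pval1].
rewrite filtE ?mulf_neq0 // pvalM //.
by move: gh0 glt (le h h0); rewrite pvalM //; lra.
Qed.

(** MacLane's equality mu(Phi) / deg Phi = mu(phi) / deg phi. *)
Definition same_slope mu phi Phi (n : nat) :=
  size Phi = (n * (size phi).-1).+1 /\ pval mu Phi = n%:R * pval mu phi.

(** Divide H(Phi) by the unit leading its graded expansion, of degree t say, and lift to a monic
    Phi2 of degree t deg phi. Phi divides Phi2 in the graded sense, so deg Phi <= t deg phi; the
    nonzero digit of Phi at t gives the converse, so that digit is 1 and contributes to mu(Phi). *)
Lemma KP_same_slope mu phi Phi : level mu phi -> KP mu Phi -> exists n, same_slope mu phi Phi n.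
Proof.
move=> lv PhiKP; have Phi0 := monic_neq0 (KP_monic PhiKP).
have [a ga] := expansion_exists (lv_monic lv) (lv_size lv) Phi.
have [G [MG gE _ GE]] := graded_of lv ga (filt_pval mu Phi).
have G0 : G != 0.
  by apply: contra_neq (Hmu_neq0 mu Phi0) => G0; rewrite HmuE // gE G0 horner0.
pose t := (size G).-1; have Gt : G`_t != 0 by rewrite -lead_coefE lead_coef_eq0.
have [u cs] := smallV lv (MG t) Gt; set c := (G`_t)^-1 in cs.
have G2 : graded phi (t%:R * pval mu phi) (c *: G).
  move=> j; rewrite coefZ; have := smallM lv cs (MG j).
  suff -> : - (pval mu Phi - t%:R * pval mu phi) + (pval mu Phi - j%:R * pval mu phi)
    = t%:R * pval mu phi - j%:R * pval mu phi by [].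
  ring.
have c1 : (c *: G)`_t = 1 by rewrite coefZ mulVr.
have s2 : size (c *: G) = size G.
  apply/eqP; rewrite eqn_leq size_scale_leq /=.
  rewrite -(prednK (_ : 0 < size G)%N) ?size_poly_gt0 // ltnNge.
  by apply/negP => /leq_sizeP/(_ t (leqnn _))/eqP; rewrite c1 oner_eq0.
have G20 : c *: G != 0 by rewrite -size_poly_gt0 s2 size_poly_gt0.
have [Phi2 [P2M P2E /(_ G20) np]] := graded_repr lv G2.
rewrite lead_coefE s2 => /(_ c1)[_ sP2].
have [P20 P2v] := filt_exact P2M np.
have sle : (size Phi <= size Phi2)%N.
  apply: (KP_dvd_size PhiKP P20); exists c.
  by rewrite -(grclass_Hmu P20 P2v) P2E hornerZ -gE mulrC HmuE.
have at0 : a`_t != 0 by apply: contra_neq Gt => at0; rewrite GE at0 grclass0.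
have a0 : a != 0 by apply: contra_neq at0 => ->; rewrite coef0.
have slt := expansion_size_coef (lv_monic lv) (lv_size lv) ga at0.
have sPhi : size Phi = (t * (size phi).-1).+1.
  by apply/eqP; rewrite eqn_leq slt andbT -sP2.
exists t; split=> //.
have [_ lE sE] := expansion_size (lv_monic lv) (lv_size lv) ga a0.
have ta : (t <= (size a).-1)%N.
  rewrite -ltnS prednK ?size_poly_gt0 // ltnNge.
  by apply/negP => /leq_sizeP/(_ t (leqnn _))/eqP; apply/negP.
have la0 : (0 < size (lead_coef a))%N by rewrite size_poly_gt0 lead_coef_eq0.
have [tE l1] : t = (size a).-1 /\ size (lead_coef a) = 1%N.
  move: sE ta la0 (lv_size lv); rewrite sPhi.
  move: (size (lead_coef a)) (size a).-1 (size phi) => k m [|[|o]] //= sE tm k0 _.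
  have := leq_mul tm (leqnn o.+1) => tmo.
  have km : (m * o.+1 <= t * o.+1)%N by lia.
  by rewrite leq_pmul2r // in km; split; [apply/eqP; rewrite eqn_leq tm|lia].
have aE : a`_t = 1.
  rewrite tE -lead_coefE; have /size1_polyC lc : (size (lead_coef a) <= 1)%N by rewrite l1.
  by move: lE; rewrite lc (monicP (KP_monic PhiKP)) lead_coefC => <-.
have := (filt_divX lv _ _ _).1 (lv_filt lv ga (filt_pval mu Phi) t).
have := GE t; rewrite aE => Gt1 /grclass_homog; rewrite -Gt1 => /(_ Gt)[_].
by rewrite pval1 => /esym/eqP; rewrite subr_eq0 => /eqP.
Qed.

(** The difference has terms of index s < n only, of mu-value at least n mu(phi). Lowering the value
    of phi by delta costs such a term s delta, but phi^n loses n delta. *)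
Lemma same_slope_gap mu mu' phi Phi n : level mu phi -> Phi \is monic ->
  same_slope mu phi Phi n ->
  (forall f, f != 0 -> (size f < size phi)%N -> pval mu' f = pval mu f) ->
  pval mu' phi < pval mu phi ->
  filtp mu' (n%:R * pval mu' phi) (phi ^+ n - Phi).
Proof.
move=> lv Phi_monic [sPhi Phiv] small_eq lt_phi.
have phi0 := monic_neq0 (lv_monic lv).
have mn : phi ^+ n \is monic by rewrite monic_exp // (lv_monic lv).
have sn : size (phi ^+ n) = size Phi by rewrite sPhi mulnC -size_exp prednK // size_poly_gt0 monic_neq0.
have sD := size_monicB mn Phi_monic sn.
have [a ga] := expansion_exists (lv_monic lv) (lv_size lv) (phi ^+ n - Phi).
apply: (filtp_expansion ga) => s; have [->|as0] := eqVneq a`_s 0; first by rewrite mul0r; left.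
have sltn : (s < n)%N.
  have := leq_trans (expansion_size_coef (lv_monic lv) (lv_size lv) ga as0) (_ : _ <= n * (size phi).-1)%N.
  by rewrite ltn_mul2r => H; have /H/andP[] : (size (phi ^+ n - Phi)%R <= n * (size phi).-1)%N
    by rewrite -ltnS -sPhi.
have fD : filt mu (n%:R * pval mu phi) (phi ^+ n - Phi).
  apply: filtB; first exact/filtX/filt_pval.
  by rewrite -Phiv; apply: filt_pval.
have asp0 : a`_s * phi ^+ s != 0 by rewrite mulf_neq0 ?expf_neq0.
have := lv_filt lv ga fD s; rewrite filtE // filtpE // !pvalM ?expf_neq0 // !pvalX //.
rewrite [pval mu' a`_s]small_eq ?(ga.2 s) //.
have : 0 < (n%:R - s%:R) * (pval mu phi - pval mu' phi) by apply: mulr_gt0; rewrite subr_gt0 ?ltr_nat.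
rewrite mulrBl !mulrBr; lra.
Qed.

Section ChainComparison.
Variables (pi : K) (C : chain v) (r : nat).
Hypothesis HC : maclane_chain C r.
Local Notation cmu := (c_mu C).
Local Notation cphi := (c_phi C).

Lemma small_chain1 i f : (i < r)%N -> f != 0 -> (size f < size (cphi i.+1))%N ->
  pval (cmu i) f = pval (cmu i.+1) f.
Proof.
move=> ir f0 sf.
by have [] := above_small (fun g => @chain_le1 _ _ _ _ HC i g ir) (chain_KP HC ir) (chain_lt HC ir) f0 sf.
Qed.

(** Downward induction: one level lower, Phi has the value of phi_(i+1)^n, and phi_(i+1), being a
    key polynomial there, has the slope of phi_i. *)
Lemma chain_same_slope Phi i : KP (cmu r) Phi -> (i <= r)%N ->
  exists n, same_slope (cmu i) (cphi i) Phi n.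
Proof.
move=> PhiKP ir; have Phi_monic := KP_monic PhiKP.
have [k ik] : exists k, (i + k)%N = r by exists (r - i)%N; rewrite subnKC.
elim: k i ik {ir} => [|k IH] i ik.
  by rewrite addn0 in ik; subst i; exact: (KP_same_slope (chain_level HC (leqnn _)) PhiKP).
have ir : (i < r)%N by rewrite -ik addnS ltnS leq_addr.
have [|n slopeE] := IH i.+1; first by rewrite addSnnS.
have phi0 := monic_neq0 (KP_monic (chain_KP HC ir)).
have lv := chain_level HC ir.
have gap := same_slope_gap lv Phi_monic slopeE (fun f nz sf => small_chain1 ir nz sf) (chain_lt HC ir).
have pn0 : cphi i.+1 ^+ n != 0 by rewrite expf_neq0.
rewrite -pvalX // in gap; have [_ PhiE] := pval_eq pn0 gap.
have [m [sm mE]] := KP_same_slope (chain_level HC (ltnW ir)) (chain_KP HC ir).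
exists (n * m)%N; split; first by case: slopeE => -> _; rewrite sm mulnA.
by rewrite PhiE pvalX // mE natrM mulrA.
Qed.

(** If [mu'] lies above mu_i but not above mu_(i+1), then [Phi] forces
    mu'(phi_(i+1)) to lie between mu_i(phi_(i+1)) and mu_(i+1)(phi_(i+1)), and
    then [phi_(i+1)] is itself a key polynomial for [mu']. *)
Lemma chain_comparable mu' Phi : KP (cmu r) Phi -> KP mu' Phi ->
  (forall g, g != 0 -> pval (cmu r) g <= pval mu' g) \/
  (forall g, g != 0 -> pval mu' g <= pval (cmu r) g).
Proof.
move=> PhiKPr PhiKP.
suff H i : (i <= r)%N -> (forall g, g != 0 -> pval (cmu i) g <= pval mu' g) \/
    (forall g, g != 0 -> pval mu' g <= pval (cmu r) g) by apply: H.
elim: i => [|i IH] ir; first by left=> g; apply: gauss_le; apply: chain_gauss HC.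
have [le|] := IH (ltnW ir); last by right.
have [[g g0 glt]|nlt] := pselect (exists2 g, g != 0 & pval (cmu i) g < pval mu' g); last first.
  right=> g g0; apply: le_trans (chain_le HC (i := i) (j := r) _ g0); last by rewrite (ltnW ir) leqnn.
  by rewrite leNgt; apply/negP => glt; apply: nlt; exists g.
have Phi_lt : pval (cmu i) Phi < pval mu' Phi by apply: KP_lt => //; exists g.
have [n slopeE] := chain_same_slope PhiKPr ir; have Phi_monic := KP_monic PhiKP.
have phiKP := chain_KP HC ir; have phi0 := monic_neq0 (KP_monic phiKP).
have lv := chain_level HC ir; have pn0 : cphi i.+1 ^+ n != 0 by rewrite expf_neq0.
have gap := same_slope_gap lv Phi_monic slopeE (fun f nz sf => small_chain1 ir nz sf) (chain_lt HC ir).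
have lt_phi : pval (cmu i) (cphi i.+1) < pval mu' (cphi i.+1).
  (* Otherwise Phi would have the value of phi_(i+1)^n for mu_i and for mu' alike, and the two
     values coincide. *)
  rewrite lt_neqAle le // andbT; apply/eqP => E; move: Phi_lt; rewrite ltNge => /negP; apply.
  have gap' := filtp_mono le gap; rewrite {1}E -pvalX // in gap'.
  have [_ ->] := pval_eq pn0 gap'; rewrite -pvalX // in gap.
  by have [_ ->] := pval_eq pn0 gap; rewrite !pvalX // E.
have small_eq f : f != 0 -> (size f < size (cphi i.+1))%N -> pval mu' f = pval (cmu i.+1) f.
  move=> f0 sf; rewrite -small_chain1 //.
  by have [] := above_small le phiKP lt_phi f0 sf.
have [ge_phi|gt_phi] := leP (pval (cmu i.+1) (cphi i.+1)) (pval mu' (cphi i.+1)).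
  left=> f f0; have [a fa] := expansion_exists (lv_monic lv) (lv_size lv) f.
  apply/(filtE _ _ f0)/(filt_expansion fa) => s.
  have := lv_filt lv fa (filt_pval _ f) s.
  have [->|as0] := eqVneq a`_s 0; first by rewrite mul0r; left.
  rewrite !filtE ?mulf_neq0 ?expf_neq0 // !pvalM ?expf_neq0 // !pvalX // [pval mu' a`_s]small_eq ?(fa.2 s) //.
  move=> H; apply: (le_trans H); rewrite lerD2l ler_wpM2l //.
have gap' := same_slope_gap lv Phi_monic slopeE small_eq gt_phi; rewrite -pvalX // in gap'.
(* Phi and phi_(i+1)^n have the same class for mu', so the prime H'(Phi) divides H'(phi_(i+1));
   degrees then leave n = 1. *)
have sle : (size Phi <= size (cphi i.+1))%N.
  apply: (KP_dvd_size PhiKP phi0); apply: contrapT => /(KP_ndvdX PhiKP (n := n)); apply.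
  by rewrite /mu_dvd (Hmu_eq pn0 gap'); apply: gr_dvd_refl.
have n1 : n = 1%N.
  have aux m k : ((m * k.-1).+1 <= k)%N -> (1 < (m * k.-1).+1)%N -> (1 < k)%N -> m = 1%N.
    case: k m => [|[|k]] [|[|m]] //=; rewrite !mulSn; lia.
  have [sP _] := slopeE; have := KP_size PhiKP; move: sle; rewrite sP => H1 H2.
  exact: aux H1 H2 (lv_size lv).
rewrite {}n1 in slopeE gap gap' pn0 *; rewrite expr1 in gap' pn0.
have phiKP' : KP mu' (cphi i.+1).
  apply: (KP_Hmu PhiKP); [exact: KP_monic phiKP| |exact: Hmu_eq gap'].
  by case: slopeE => -> _; rewrite mul1n prednK // ltnW // (lv_size lv).
right=> f f0; apply: le_trans (chain_le HC (i := i.+1) (j := r) _ f0); last by rewrite ir leqnn.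
have [a fa] := expansion_exists (lv_monic lv) (lv_size lv) f.
apply/(filtE _ _ f0)/(filt_expansion fa) => s.
have := KP_expansion_filt phiKP' fa (filt_pval _ f) s.
have [->|as0] := eqVneq a`_s 0; first by rewrite mul0r; left.
rewrite !filtE ?mulf_neq0 ?expf_neq0 // !pvalM ?expf_neq0 // !pvalX // [pval mu' a`_s]small_eq ?(fa.2 s) //.
by move=> H; apply: (le_trans H); rewrite lerD2l ler_wpM2l // ltW.
Qed.

End ChainComparison.
End Comparison.

(** * Types *)

Section Cosets.
Variables (K : fieldType) (v : K -> int).
Implicit Types (mu : valuation v) (f g h : {poly K}).
Local Open Scope classical_set_scope.

Lemma coset_grclass mu a g h : filt mu a g ->
  coset a (grclass mu a g) h <-> filt mu a h /\ grclass mu a h = grclass mu a g.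
Proof.
move=> ag; have cE : grclass mu a (hcoef (repr (grclass mu a g)) a) = grclass mu a g.
  by have := comp_grclass a ag; rewrite eqxx.
have fc := filt_hcoef (repr (grclass mu a g)) a.
split=> [[ah /(grclass_eq fc ah)]|[ah E]]; first by rewrite cE.
by split=> //; apply/grclass_eq => //; rewrite cE.
Qed.

(** The two graded algebras are distinct types, so the relation H(g) = H(f q) is first turned into
    an inequality of values. *)
Lemma mu_dvd_transfer mu mu' f g : (forall g, g != 0 -> pval mu g = pval mu' g) ->
  mu_dvd mu f g -> mu_dvd mu' f g.
Proof.
move=> E; have [->|g0] := eqVneq g 0; first by rewrite /mu_dvd !Hmu0 => _; apply: gr_dvd0.
move=> /(mu_dvdP g0)[f0 [q q0]]; rewrite -HmuM => /(Hmu_inj g0).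
have le (g1 : {poly K}) : g1 != 0 -> pval mu g1 <= pval mu' g1 by move=> /E ->.
move=> /(filtp_mono le); rewrite E // => /(Hmu_eq g0); rewrite /mu_dvd => ->.
by exists (Hmu mu' q); rewrite HmuM.
Qed.

(** The right-hand side mentions only filtrations and [mu_dvd], both of which transfer between
    valuations that agree on polynomials. *)
Lemma Rideal_cosets mu Phi : [set coset 0 d | d in Rideal mu Phi] =
  [set D | exists g, [/\ filt mu 0 g, filtp mu 0 g \/ mu_dvd mu Phi g &
    D = [set h | filt mu 0 h /\ filtp mu 0 (h - g)] ] ].
Proof.
have cosE g : filt mu 0 g ->
    coset 0 (grclass mu 0 g) = [set h | filt mu 0 h /\ filtp mu 0 (h - g)].
  move=> g0; apply/seteqP; split=> h /=.
    by move=> /(coset_grclass _ g0)[h0 /(grclass_eq h0 g0)].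
  by move=> [h0 hg]; apply/(coset_grclass _ g0); split=> //; apply/grclass_eq.
apply/seteqP; split=> D.
  move=> [c [[g g0 <-] dvd] <-]; exists g; split=> //; last exact: cosE.
  have [pg|pg] := pselect (filtp mu 0 g); [by left|right].
  have [gn0 gv] := filt_exact g0 pg.
  by rewrite /mu_dvd -(grclass_Hmu gn0 gv).
move=> [g [g0 dvd ->]]; exists (grclass mu 0 g); last exact: cosE.
split; first by exists g.
have [pg|pg] := pselect (filtp mu 0 g).
  by rewrite (grclass_eq0 g0).2 //; exists 0; rewrite mulr0.
case: dvd => // dvd; have [gn0 gv] := filt_exact g0 pg.
by rewrite (grclass_Hmu gn0 gv).
Qed.

Lemma filt_transfer mu mu' a : (forall g, g != 0 -> pval mu g = pval mu' g) ->
  filt mu a = filt mu' a.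
Proof.
move=> E; apply/seteqP; split; apply: filt_mono => g g0; by rewrite E.
Qed.

Lemma filtp_transfer mu mu' a : (forall g, g != 0 -> pval mu g = pval mu' g) ->
  filtp mu a = filtp mu' a.
Proof.
move=> E; apply/seteqP; split; apply: filtp_mono => g g0; by rewrite E.
Qed.

Lemma Rideal_cosets_transfer mu mu' Phi : (forall g, g != 0 -> pval mu g = pval mu' g) ->
  [set coset 0 d | d in Rideal mu Phi] = [set coset 0 d | d in Rideal mu' Phi].
Proof.
move=> E; rewrite !Rideal_cosets -(filt_transfer 0 E) -(filtp_transfer 0 E).
have E' g : g != 0 -> pval mu' g = pval mu g by move=> /E.
apply/seteqP; split=> D [g [g0 [pg|dvd] DE]]; exists g; split=> //; first by left.
- by right; apply: mu_dvd_transfer dvd.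
- by left.
by right; apply: mu_dvd_transfer dvd.
Qed.

(** The constant digit of 1 - phi h is 1, so this difference cannot have positive value. *)
Lemma level_phi_nunit mu phi : level mu phi -> ~ gr_dvd (Hmu mu phi) 1.
Proof.
move=> lv; rewrite -(Hmu1 mu) => /(mu_dvdP (oner_neq0 _))[phi0 [h h0]].
rewrite -HmuM => /(Hmu_inj (oner_neq0 _)); rewrite pval1 => fp.
have [a ha] := expansion_exists (lv_monic lv) (lv_size lv) (- h).
have s1 : (size (1%R : {poly K}) < size phi)%N by rewrite size_poly1 (lv_size lv).
have hE : (1 - phi * h = - (h : {poly K}) * phi + 1)%R by rewrite mulNr mulrC addrC.
have := lv_filtp lv (expansion_cons ha s1 hE) fp 0%N.
by rewrite coefD coefMX coefC add0r mulr1 filtpE ?oner_neq0 // pval1 ltxx.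
Qed.

End Cosets.

(** * The generator of the ideal of a type and the representatives *)

Section TypeFacts.
Variables (K : fieldType) (v : K -> int) (pi : K).
Hypotheses (hv : surj_discrete_valuation v) (hpi : uniformizer v pi).
Variable t : mltype v pi.
Local Notation r := (t_ord t).
Local Notation C := (t_chain t).
Local Notation mu := (t_mu t).
Local Notation phi := (c_phi C r).
Local Notation psi := (t_psi t r).

Definition t_gen : gr mu := psi.[c_y pi C r].

Let HC := t_chainP t.
Let lv := chain_level HC (leqnn r).
Let ld := (chain_ld hv hpi HC (leqnn r)).1.

Lemma t_poly_in : poly_in (small phi 0) psi.
Proof. by have [F _ _] := t_irr t; move=> k; rewrite -(small_c_F HC (leqnn r)). Qed.

Lemma t_size : (1 < size psi)%N.
Proof. by case: (t_irr t). Qed.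

Lemma c_FpolyE : @c_Fpoly _ _ C r = poly_in (small phi 0 : set (gr mu)).
Proof. by rewrite /c_Fpoly /poly_in -(small_c_F HC (leqnn r)). Qed.

Lemma t_irred P Q : poly_in (small phi 0) P -> poly_in (small phi 0) Q ->
  psi = P * Q -> size P = 1%N \/ size Q = 1%N.
Proof. by case: (t_irr t) => _ _; rewrite c_FpolyE; apply. Qed.

Lemma t_psi_X : psi != 'X \/ c_e C r = 1%N.
Proof.
have [r0|r0] := posnP r; [right|left; exact: t_neqX].
by rewrite r0 c_e0.
Qed.

Lemma residual_dvd m g : F_dvd (psi ^+ m) (residual pi C r g) <->
  gr_dvd (t_gen ^+ m) (Hmu mu g).
Proof.
have [->|g0] := eqVneq g 0.
  rewrite /residual eqxx Hmu0; split=> _; first exact: gr_dvd0.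
  by exists 0; rewrite ?mulr0 // c_FpolyE; apply: poly_in0 (S_1 lv) (@S_B _ _ _ _).
have [SR [s [u [RE s0]]]] := residual_spec hv hpi HC (leqnn r) g0.
have sX : s = 0%N \/ psi != 'X.
  by have [/s0|r0] := posnP r; [left|right; apply: t_neqX].
have := nf_dvd lv ld t_poly_in (t_monic t) t_irred m g0 SR RE sX.
by rewrite /F_dvd c_FpolyE.
Qed.

Lemma t_gen_repr : exists w, [/\ w != 0, pval mu w = 0 & t_gen = Hmu mu w].
Proof.
have [w [w0 wv wE]] := nf_homog lv ld 0 0 t_poly_in (monic_neq0 (t_monic t)).
exists w; split=> //; first by rewrite wv /nf_deg !mul0r addr0.
by rewrite wE expr0 expr0z !mul1r.
Qed.

Lemma t_gen_ideal : @t_ideal _ _ _ t t_gen.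
Proof. by exists 1; [exists 1; [exact: filt01|]|rewrite mulr1]. Qed.

(** The order is stated to differ from 0 rather than to be positive, so that the value [None] at g =
    0 is covered. *)
Lemma ordt_dvd g : ordt t g <> Some 0%N <-> gr_dvd t_gen (Hmu mu g).
Proof.
have ordP n : is_ordt t g n <-> gr_dvd (t_gen ^+ n) (Hmu mu g) /\
    forall m, gr_dvd (t_gen ^+ m) (Hmu mu g) -> (m <= n)%N.
  rewrite /is_ordt; split=> -[d H]; split; first exact/residual_dvd.
  - by move=> m /residual_dvd/H.
  - exact/residual_dvd.
  by move=> m /residual_dvd/H.
split=> [n0|Z1].
  apply: contrapT => nZ; apply: n0; rewrite /ordt.
  have is0 : is_ordt t g 0.
    apply/ordP; split; first by exists (Hmu mu g); rewrite mul1r.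
    move=> [//|m] [q E]; case: nZ; exists (t_gen ^+ m * q).
    by rewrite mulrA -exprS.
  case: xgetP => [o oE [n /ordP[dn nmax] ->]|/(_ (Some 0%N))[]]; last by exists 0%N.
  congr Some; apply/eqP; rewrite -leqn0.
  by have /ordP[_] := is0; apply.
rewrite /ordt; case: xgetP => // o oE [n /ordP[dn nmax] ->] [n0].
by have := nmax 1%N; rewrite expr1 n0 => /(_ Z1).
Qed.

Lemma t_rep_exists : exists2 Phi, Rep t Phi &
  forall c, gr_dvd (Hmu mu Phi) c <-> gr_dvd t_gen c.
Proof.
have [Phi [PhiKP dvdE RE]] := rep_exists lv ld t_poly_in (t_monic t) t_size t_irred t_psi_X.
by exists Phi.
Qed.

(** Compare Phi with the constructed Phi0, whose class is associate to Z. Equal ideals give H(Phi0)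
    = H(Phi) H(q); by primality H(Phi0) divides H(Phi), since dividing H(q) would make H(Phi) a
    unit. *)
Lemma Rep_dvd Phi c : Rep t Phi -> gr_dvd (Hmu mu Phi) c <-> gr_dvd t_gen c.
Proof.
move=> [PhiKP PhiR]; have [Phi0 [KP0 _] dvdE] := t_rep_exists.
have Phi00 := monic_neq0 (KP_monic KP0).
have : Rideal mu Phi t_gen by rewrite PhiR; exact: t_gen_ideal.
move=> [_ d1]; have /(mu_dvdP Phi00)[Phin0 [q q0 E]] : mu_dvd mu Phi Phi0.
  by apply: gr_dvd_trans d1 _; apply/dvdE/gr_dvd_refl.
suff d2 : gr_dvd t_gen (Hmu mu Phi) by split; apply: gr_dvd_trans.
apply/dvdE; have /(KP_prime KP0)[//|] : gr_dvd (Hmu mu Phi0) (Hmu mu Phi * Hmu mu q).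
  by rewrite -E; apply: gr_dvd_refl.
move=> /(mu_dvdP q0)[_ [q' q'0 E']].
case: (KP_nunit PhiKP); exists (Hmu mu q').
rewrite -HmuM -Hmu1; apply: Hmu_eq; rewrite ?oner_neq0 // pval1.
have := E; rewrite E' mulrCA -!HmuM => /(Hmu_inj Phi00).
rewrite -{2}[Phi0]mulr1 -mulrBr.
have [->|n0] := eqVneq (1 - Phi * q') 0; first by left.
by rewrite !filtpE ?mulf_neq0 // pvalM // ltrDl.
Qed.

Lemma RepP Phi : Rep t Phi <-> [/\ Phi \is monic, gr_dvd t_gen (Hmu mu Phi) &
  forall h : {poly K}, h != 0 -> (size h < size Phi)%N -> ~ gr_dvd t_gen (Hmu mu h)].
Proof.
split=> [RPhi|[Phi_monic Zd Phimin]].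
  have [PhiKP _] := RPhi; split; first exact: KP_monic PhiKP.
    exact/(Rep_dvd _ RPhi)/gr_dvd_refl.
  by move=> h h0 sh /(Rep_dvd _ RPhi); apply: KP_min PhiKP _ h0 sh.
have [Phi0 [KP0 R0] dvdE] := t_rep_exists.
have Phi00 := monic_neq0 (KP_monic KP0); have Phin0 := monic_neq0 Phi_monic.
have sE : size Phi = size Phi0.
  apply/eqP; rewrite eqn_leq; apply/andP; split.
    rewrite leqNgt; apply/negP => /(Phimin _ Phi00); apply; apply/dvdE/gr_dvd_refl.
  by apply: (KP_dvd_size KP0 Phin0); apply/dvdE.
have sD := size_monicB Phi_monic (KP_monic KP0) sE.
have /(mu_dvdP Phin0)[_ [q q0]] : mu_dvd mu Phi0 Phi by apply/dvdE.
rewrite -HmuM => /(Hmu_inj Phin0) fp.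
have E : Hmu mu Phi = Hmu mu Phi0.
  apply: (Hmu_eq Phin0); apply: (KP_div_p KP0 (q := 1 - q) sD _).1.
  have -> : (1 - q) * Phi0 + (Phi - Phi0) = Phi - Phi0 * (q : {poly K}).
    by rewrite mulrBl mul1r addrC addrA subrK mulrC.
  exact: fp.
split; first exact: KP_Hmu KP0 Phi_monic sE E.
by rewrite -R0 /Rideal E.
Qed.

Lemma t_gen_coef0 : (0 < r)%N -> forall c, gr_dvd c (c_y pi C r) -> gr_dvd c t_gen -> gr_dvd c 1.
Proof.
move=> r0 c cy cZ; have psi0 := irr_coef0 (S_1 lv) (@S_B _ _ _ _) t_poly_in (t_monic t) t_irred (t_neqX r0).
have [d _ dpsi] := S_V lv (t_poly_in 0) psi0.
suff [q tE] : exists q, t_gen = q * c_y pi C r + psi`_0.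
  have cp : gr_dvd c psi`_0.
    rewrite (_ : psi`_0 = t_gen + - (c_y pi C r * q)); last by rewrite tE mulrC; ring.
    by apply/(gr_dvdD cZ)/gr_dvdN/gr_dvdMr.
  by rewrite -dpsi mulrC; apply: gr_dvdMr.
rewrite /t_gen; elim/poly_ind: (psi) => [|p k _]; first by exists 0; rewrite horner0 coef0 mul0r addr0.
by exists p.[c_y pi C r]; rewrite hornerMXaddC coefD coefMX coefC add0r.
Qed.

Lemma phi_dvd_y : (0 < c_e C r)%N -> gr_dvd (Hmu mu phi) (c_y pi C r).
Proof.
move=> e0; rewrite /c_y; apply: gr_dvdMr; rewrite -(prednK e0) exprS; apply: gr_dvdMr.
by apply/gr_dvdMr/gr_dvd_refl.
Qed.

End TypeFacts.

(** * The three implications *)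

Section Equivalence.
Variables (K : fieldType) (v : K -> int) (pi : K).
Hypotheses (hv : surj_discrete_valuation v) (hpi : uniformizer v pi).
Implicit Types t : mltype v pi.
Local Open Scope classical_set_scope.

Lemma Rep_le_eq t t' : Rep t = Rep t' ->
  (forall g : {poly K}, g != 0 -> pval (t_mu t) g <= pval (t_mu t') g) ->
  forall g : {poly K}, g != 0 -> pval (t_mu t) g = pval (t_mu t') g.
Proof.
move=> RepE le g g0; apply/eqP; rewrite eq_le le //= leNgt; apply/negP => glt.
have [Phi RPhi _] := t_rep_exists hv hpi t; have RPhi' : Rep t' Phi by rewrite -RepE.
have [PhiKP PhiR] := RPhi; have [PhiKP' PhiR'] := RPhi'.
have Phi_lt := KP_lt le PhiKP' (ex_intro2 _ _ g g0 glt).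
pose phi := c_phi (t_chain t') (t_ord t').
have lv' : level (t_mu t') phi := chain_level (t_chainP t') (leqnn _).
have phi0 := monic_neq0 (lv_monic lv'); have Phi0 := monic_neq0 (KP_monic PhiKP).
(* If either were shorter than the other its class in Gr(mu_t') would be a unit, which neither
   is. *)
have sE : size phi = size Phi.
  case: (ltngtP (size phi) (size Phi)) => // s.
    have [_ [c [_ _ c1]]] := above_small le PhiKP Phi_lt phi0 s.
    by case: (level_phi_nunit lv'); rewrite -c1; apply/gr_dvdMr/gr_dvd_refl.
  have [c [_ _ c1]] := lv_inv lv' Phi0 s.
  by case: (KP_nunit PhiKP'); rewrite -c1; apply/gr_dvdMr/gr_dvd_refl.
have sD := size_monicB (KP_monic PhiKP) (lv_monic lv') (esym sE).
(* Phi - phi is the constant digit of Phi, so its mu_t'-value is at least that of Phi; being small,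
   it has the same value for mu_t, where Phi is strictly smaller. *)
have e1 : is_expansion phi Phi (1%:P * 'X + (Phi - phi)%:P).
  apply: expansion_cons sD _; first by apply: expansion_small; rewrite size_poly1; exact: lv_size lv'.
  by rewrite mul1r subrKC.
have := lv_filt lv' e1 (filt_pval _ Phi) 0%N.
rewrite coefD coefMX !coefC add0r mulr1 => fD.
have gap : filtp (t_mu t) (pval (t_mu t) Phi) (Phi - phi).
  have [->|D0] := eqVneq (Phi - phi) 0; first by left.
  rewrite sE in sD; have [DE _] := above_small le PhiKP Phi_lt D0 sD.
  apply/(filtpE _ _ D0); rewrite -DE; apply: lt_le_trans Phi_lt _.
  exact: (filtE _ _ D0).1 fD.
have HE := Hmu_eq Phi0 gap.
have Rphi : Rep t phi.
  split; first exact: KP_Hmu PhiKP (lv_monic lv') sE (esym HE).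
  by rewrite -PhiR /Rideal HE.
rewrite RepE in Rphi; have [_ Rphi'] := Rphi.
have [_ dZ] : Rideal (t_mu t') phi (t_gen t') by rewrite Rphi'; apply: t_gen_ideal.
(* At order 0 the larger valuation would be the Gauss valuation, which lies below all others. *)
have r0 : (0 < t_ord t')%N.
  rewrite lt0n; apply/eqP => r0; move: glt; rewrite ltNge => /negP; apply.
  rewrite /t_mu r0 /=; apply: gauss_le => //; exact: chain_gauss (t_chainP t').
apply: (level_phi_nunit lv'); apply: (t_gen_coef0 r0) dZ.
apply: phi_dvd_y; exact: ld_e (chain_ld hv hpi (t_chainP t') (leqnn _)).1.
Qed.

Lemma ram_dvd (mu mu' : valuation v) : (forall f, f != 0 -> mu f = mu' f) ->
  (ram mu %| ram mu')%N.
Proof.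
move=> E; have ram0 : (ram mu)%:R != 0 :> rat by rewrite pnatr_eq0 -lt0n ram_gt0.
have /(ramP mu)[f f0 fv] : (ram mu)%:R * (ram mu)%:R^-1 \is a @Num.int rat.
  by rewrite mulfV ?rpred1.
have /intrP[z zE] : (ram mu')%:R * (ram mu)%:R^-1 \is a @Num.int rat.
  by apply/(ramP mu'); exists f; rewrite -?E.
suff : ((ram mu)%:Z %| (ram mu')%:Z)%Z by [].
by apply/dvdzP; exists z; apply: (@intr_inj rat); rewrite rmorphM /= -zE -!pmulrn mulfVK.
Qed.

Lemma t_val_eq t t' : (forall g : {poly K}, g != 0 -> pval (t_mu t) g = pval (t_mu t') g) ->
  forall f, f != 0 -> t_val t f = t_val t' f.
Proof.
move=> E; have fE f : f != 0 -> t_mu t f = t_mu t' f.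
  move=> f0; have [n [d [n0 d0 -> fd]]] := val_numden (t_mu t) f0.
  rewrite !E // /pval -fd Defs.valM ?tofrac_eq0 ?addrK //.
have ramE : ram (t_mu t) = ram (t_mu t').
  by apply/eqP; rewrite eqn_dvd !ram_dvd // => f f0; rewrite fE.
by move=> f f0; rewrite /t_val ramE fE.
Qed.

Lemma type_equiv_pval t t' : type_equiv t t' ->
  forall g : {poly K}, g != 0 -> pval (t_mu t) g = pval (t_mu t') g.
Proof.
move=> [E _]; have [pi0 vpi] := uniformizer_val hv hpi.
(* Since mu_t(pi) = 1, the value v_t(pi) is the ramification index, and equal normalized valuations
   can be rescaled to equal ones. *)
have piv (mu : valuation v) : mu (tofrac pi%:P) = 1 by rewrite val_ext // vpi.
have piP : tofrac pi%:P != 0 by rewrite tofrac_eq0 polyC_eq0.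
have := E _ piP; rewrite /t_val !piv !mulr1 => /eqP; rewrite eqr_nat => /eqP ramE.
move=> g g0; have := E (tofrac g); rewrite tofrac_eq0 /t_val ramE => /(_ g0).
by apply: mulfI; rewrite pnatr_eq0 -lt0n ram_gt0.
Qed.

(** The coset of w, as a member of L_t, is also the coset of a multiple of the generator of L_t',
    which gives the divisibility in Gr(mu_t'). *)
Lemma type_equiv_gen t t' w w' : type_equiv t t' ->
  w != 0 -> pval (t_mu t) w = 0 -> t_gen t = Hmu (t_mu t) w ->
  w' != 0 -> pval (t_mu t') w' = 0 -> t_gen t' = Hmu (t_mu t') w' ->
  mu_dvd (t_mu t') w' w.
Proof.
move=> tt' w0 wv wE w'0 w'v w'E; have E := type_equiv_pval tt'; have [_ cosE] := tt'.
have f0 : filt (t_mu t) 0 w by right; rewrite wv.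
have : [set coset 0 d | d in @t_ideal _ _ _ t] (coset 0 (t_gen t)).
  by exists (t_gen t) => //; exact: t_gen_ideal.
rewrite cosE => -[d [c [q q0 <-] <-] dE].
have f'0 : filt (t_mu t') 0 w' by right; rewrite w'v.
have dE' : t_gen t' * grclass (t_mu t') 0 q = grclass (t_mu t') 0 (w' * q).
  by rewrite w'E -(grclass_Hmu w'0 w'v) -grclassM // addr0.
have fq : filt (t_mu t') 0 (w' * q) by have := filtM f'0 q0; rewrite addr0.
have : coset 0 (t_gen t) w.
  by rewrite wE -(grclass_Hmu w0 wv); apply/(coset_grclass _ f0).
rewrite -dE -/(t_gen t') dE' => /(coset_grclass _ fq)[_].
have w'v' : pval (t_mu t') w = 0 by rewrite -E.
rewrite (grclass_Hmu w0 w'v') -dE' w'E /mu_dvd => ->.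
exact/gr_dvdMr/gr_dvd_refl.
Qed.

Lemma type_equiv_sym t t' : type_equiv t t' -> type_equiv t' t.
Proof. by move=> [E1 E2]; split=> // f f0; rewrite E1. Qed.

Lemma mu_dvdX (mu : valuation v) f g m : mu_dvd mu f g -> gr_dvd (Hmu mu f ^+ m) (Hmu mu g ^+ m).
Proof. by move=> [q ->]; exists (q ^+ m); rewrite exprMn. Qed.

Lemma type_equiv_dvd t t' m g : type_equiv t t' ->
  gr_dvd (t_gen t ^+ m) (Hmu (t_mu t) g) -> gr_dvd (t_gen t' ^+ m) (Hmu (t_mu t') g).
Proof.
move=> tt'; have E := type_equiv_pval tt'.
have [w [w0 wv wE]] := t_gen_repr hv hpi t; have [w' [w'0 w'v w'E]] := t_gen_repr hv hpi t'.
have d := type_equiv_gen tt' w0 wv wE w'0 w'v w'E.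
rewrite wE -HmuX => /(mu_dvd_transfer E); rewrite /mu_dvd HmuX; apply: gr_dvd_trans.
by rewrite w'E; apply: mu_dvdX.
Qed.

Lemma type_equiv_ordt t t' : type_equiv t t' -> forall g, ordt t g = ordt t' g.
Proof.
move=> tt' g; rewrite /ordt; congr (xget _ _).
have sub t1 t2 : type_equiv t1 t2 -> [set o | exists2 n, is_ordt t1 g n & o = Some n] `<=`
    [set o | exists2 n, is_ordt t2 g n & o = Some n].
  move=> t12 o [n [d dmax] ->]; exists n => //; split.
    by apply/(residual_dvd hv hpi)/(type_equiv_dvd t12)/(residual_dvd hv hpi).
  move=> m dm; apply: dmax.
  by apply/(residual_dvd hv hpi)/(type_equiv_dvd (type_equiv_sym t12))/(residual_dvd hv hpi).
by apply/seteqP; split; apply: sub => //; apply: type_equiv_sym.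
Qed.

Lemma ordt_Rep t t' : (forall g, ordt t g = ordt t' g) -> Rep t = Rep t'.
Proof.
move=> E; have dE g : gr_dvd (t_gen t) (Hmu (t_mu t) g) <-> gr_dvd (t_gen t') (Hmu (t_mu t') g).
  by rewrite -!(ordt_dvd hv hpi) E.
apply/seteqP; split=> Phi /(RepP hv hpi)[Phi_monic Phid Phimin]; apply/(RepP hv hpi);
  split=> //; try exact/dE; by move=> h h0 sh /dE; apply: Phimin.
Qed.

Lemma Rep_type_equiv t t' : Rep t = Rep t' -> type_equiv t t'.
Proof.
move=> RepE; have [Phi RPhi _] := t_rep_exists hv hpi t; have RPhi' : Rep t' Phi by rewrite -RepE.
have [PhiKP PhiR] := RPhi; have [PhiKP' PhiR'] := RPhi'.
have E : forall g : {poly K}, g != 0 -> pval (t_mu t) g = pval (t_mu t') g.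
  have [le|le] := chain_comparable (t_chainP t) PhiKP PhiKP'; first exact: Rep_le_eq.
  by move=> g g0; apply/esym/(Rep_le_eq (esym RepE)).
split; first exact: t_val_eq.
by rewrite -PhiR -PhiR'; apply: Rideal_cosets_transfer.
Qed.

End Equivalence.

Theorem theorem4p7 (K : fieldType) (v : K -> int) (pi : K)
    (hv : surj_discrete_valuation v) (hpi : uniformizer v pi)
    (t t' : mltype v pi) :
  (type_equiv t t' <-> (forall g : {poly K}, ordt t g = ordt t' g)) /\
  ((forall g : {poly K}, ordt t g = ordt t' g) <-> Rep t = Rep t').
Proof.
have H12 := @type_equiv_ordt K v pi hv hpi t t'.
have H23 := @ordt_Rep K v pi hv hpi t t'.
have H31 := @Rep_type_equiv K v pi hv hpi t t'.
by split; split; [exact: H12|move=> /H23/H31|exact: H23|move=> /H31/H12].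
Qed.
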